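(* Let $k,b$ be positive integers such that either $k\ge 4$, or $k=3$ and $b\ge 2$. Let $H$ be a graph for which there exists a subgraph $H'\subseteq H$ with $d_1(H')=m_1(H)$ and either $H'=K_k$ or $H'=C_k$. Then there exist constants $c,C>0$ such that, for $G\sim G(n,p)$, $$\lim_{n\to\infty}\Pr\left[G \text{ is Maker's win in the } (1:b) \text{ Maker-Breaker vertex } H\text{-game}\right]=\begin{cases}1 & p\ge Cn^{-1/m_1(H)},\\ 0 & p\le cn^{-1/m_1(H)}.\end{cases}$$
   Context: For a graph $F$, $v(F)=|V(F)|$, $e(F)=|E(F)|$. For a graph $F$ with $v(F)\ge 2$, the 1-density is $d_1(F)=\frac{e(F)}{v(F)-1}$, and the maximum 1-density is $m_1(F)=\max\{d_1(F')\,:\,F'\subseteq F,\ v(F')\ge 2\}$. $G(n,p)$ is the binomial random graph on $n$ vertices, each edge present independently with probability $p$. For graphs $G,H$ and a positive integer $b$, the $(1:b)$ Maker-Breaker vertex $H$-game on $G$ is played as follows: Maker and Breaker alternately claim previously unclaimed vertices of $G$, Maker claiming one vertex per turn and Breaker claiming $b$ vertices per turn (the last player may claim fewer if not enough free vertices remain), until all vertices are claimed. Maker wins if the subgraph of $G$ induced by the set of vertices he claimed contains a (not necessarily induced) copy of $H$; otherwise Breaker wins. ''$G$ is Maker's win'' means Maker has a winning strategy (the statement holds with either player moving first). *)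

(* Defs.v *)
From mathcomp Require Import all_boot.
From Stdlib Require Import Reals.

Set Implicit Arguments.
Unset Strict Implicit.
Unset Printing Implicit Defensive.

Definition pairs (n : nat) : {set {set 'I_n}} := [set e : {set 'I_n} | #|e| == 2].
Definition simple_graph (n : nat) (E : {set {set 'I_n}}) : bool := E \subset pairs n.

Definition contains_copy (h : nat) (EH : {set {set 'I_h}}) (n : nat)
    (EG : {set {set 'I_n}}) (M : {set 'I_n}) : bool :=
  [exists f : {ffun 'I_h -> 'I_n},
     [&& injectiveb f, [forall x, f x \in M] & [forall e in EH, (f @: e) \in EG]]].

Fixpoint maker_wins_from (h : nat) (EH : {set {set 'I_h}}) (n : nat)
    (EG : {set {set 'I_n}}) (b : nat) (fuel : nat) (M B : {set 'I_n})
    (maker_turn : bool) {struct fuel} : bool :=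
  let F := ~: (M :|: B) in
  match fuel with
  | 0 => contains_copy EH EG M
  | f.+1 =>
      if F == set0 then contains_copy EH EG M else
      if maker_turn then
        [exists v in F, maker_wins_from EH EG b f (v |: M) B false]
      else
        [forall S : {set 'I_n},
           ((S \subset F) && (#|S| == minn b #|F|)) ==>
           maker_wins_from EH EG b f M (B :|: S) true]
  end.

(* G is Maker's win (fuel n suffices: each move claims at least one vertex). *)
Definition makers_win (h : nat) (EH : {set {set 'I_h}}) (n : nat)
    (EG : {set {set 'I_n}}) (b : nat) (maker_first : bool) : bool :=
  maker_wins_from EH EG b n set0 set0 maker_first.

Definition prob_gnp (n : nat) (p : R) (P : {set {set 'I_n}} -> bool) : R :=
  foldr Rplus 0%R
    (map (fun E : {set {set 'I_n}} =>
            if P E then Rmult (pow p #|E|) (pow (Rminus 1 p) (subn #|pairs n| #|E|)) else 0%R)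
         (enum [set E : {set {set 'I_n} } | E \subset pairs n])).

Definition is_subgraph (h : nat) (EH : {set {set 'I_h}}) (V : {set 'I_h})
    (E : {set {set 'I_h}}) : bool :=
  (E \subset EH) && [forall e in E, e \subset V].

Definition one_density (h : nat) (V : {set 'I_h}) (E : {set {set 'I_h}}) : R :=
  (INR #|E| / INR (subn #|V| 1))%R.

(* m_1(H) = max of d_1(F') over subgraphs F' with v(F') >= 2 (all are >= 0). *)
Definition max_one_density (h : nat) (EH : {set {set 'I_h}}) : R :=
  foldr Rmax 0%R
    (map (fun VE : {set 'I_h} * {set {set 'I_h}} => one_density VE.1 VE.2)
         (enum [set VE : {set 'I_h} * {set {set 'I_h}} |
                  is_subgraph EH VE.1 VE.2 && (1 < #|VE.1|)])).

Definition clique_edges (k : nat) : {set {set 'I_k}} := pairs k.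
Definition cycle_edges (k : nat) : {set {set 'I_k}} :=
  [set [set i; ordS i] | i : 'I_k].

Definition iso_to (h k : nat) (Ek : {set {set 'I_k}}) (V : {set 'I_h})
    (E : {set {set 'I_h}}) : bool :=
  [exists f : {ffun 'I_k -> 'I_h},
     [&& injectiveb f, V == f @: setT & E == [set f @: (e : {set 'I_k}) | e in Ek]]].

Definition is_Kk (h k : nat) V E := @iso_to h k (clique_edges k) V E.
Definition is_Ck (h k : nat) V E := @iso_to h k (cycle_edges k) V E.

(* Main.v *)
Require Import Defs.
From Stdlib Require Import Reals.
From mathcomp Require Import all_boot all_order all_algebra zify.
From mathcomp Require Import Rstruct_topology reals sequences exp.
From mathcomp Require ring lra.

(** Write [K] for the clique or cycle attaining [m_1(H)]; it has [k] vertices and [q] edges, so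
    [1/m_1(H) = (k-1)/q].

    Breaker's side: if some graph [P] of maximum degree at most [b] on the vertices of [G] meets
    every copy of [K] in an edge, then Breaker wins by always claiming all free [P]-neighbours of
    Maker's last vertex.  Call [G] critical if no such [P] exists for [G] but one exists for every
    proper subgraph.  A discharging argument shows that a critical graph is a connected union of
    copies of [K] with [q v < (k-1) e]; here [b = 1] suffices for [k >= 4], and [b = 2] for [k = 3].
    Exploring such a union copy by copy, the explored part either becomes too dense or reaches
    more than [log n] edges, and a first moment bound shows that with high probability neither
    happens for [p <= c n^(-(k-1)/q)].

    Maker's side: whatever Breaker does, Maker claims about [n/(b+1)] vertices.  By Janson's
    inequality a fixed set of this size spans no copy of [H] with probability at most [exp(-2n)]
    once [p >= C n^(-1/m_1(H))], and a union bound over all [2^n] sets finishes the proof. *)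

Set Implicit Arguments.
Unset Strict Implicit.
Unset Printing Implicit Defensive.

(** * Graphs *)

Lemma card2_split (T : finType) (A : {set T}) x :
  #|A| = 2 -> x \in A -> exists2 y, A = [set x; y] & x != y.
Proof.
move=> /eqP/cards2P [a [b [nab ->]]]; rewrite !inE => /orP[] /eqP ->; first by exists b.
by exists a; rewrite 1?setUC // eq_sym.
Qed.

Lemma card_gt2_other (T : finType) (A : {set T}) x y :
  2 < #|A| -> exists w, [/\ w \in A, w != x & w != y].
Proof.
move=> A3; have /card_gt0P [w] : 0 < #|A :\ x :\ y|.
  by move: A3; rewrite (cardsD1 x A) (cardsD1 y (A :\ x)); do 2!case: (_ \in _); lia.
by rewrite !inE => /and3P[nwy nwx wA]; exists w.
Qed.

Section Graph.
Variable T : finType.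
Implicit Types (E F : {set {set T}}) (e S X : {set T}) (u v x y : T).

Definition is_graph E : bool := [forall e in E, #|e| == 2].
Definition adj E u v : bool := [set u; v] \in E.
Definition nbh E u : {set T} := [set v | adj E u v].
Definition deg E u : nat := #|nbh E u|.
Definition induced E S : {set {set T}} := [set e in E | e \subset S].

Lemma card_edge E e : is_graph E -> e \in E -> #|e| = 2.
Proof. by move=> /forall_inP gE /gE /eqP. Qed.

Lemma is_graphS E F : E \subset F -> is_graph F -> is_graph E.
Proof. by move=> /subsetP sEF /forall_inP gF; apply/forall_inP => e /sEF /gF. Qed.

Lemma is_graphU E F : is_graph (E :|: F) = is_graph E && is_graph F.
Proof.
apply/idP/andP => [gEF|[/forall_inP gE /forall_inP gF]].
  by split; apply: is_graphS gEF; rewrite (subsetUl, subsetUr).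
by apply/forall_inP => e /setUP[/gE|/gF].
Qed.

Lemma is_graph_edge x y : is_graph [set [set x; y]] = (x != y).
Proof.
apply/forall_inP/idP => [/(_ _ (set11 _))|nxy e /set1P ->]; rewrite cards2.
  by case: (x != y).
by rewrite nxy.
Qed.

Lemma adjC E u v : adj E u v = adj E v u.
Proof. by rewrite /adj setUC. Qed.

Lemma in_nbh E u v : (v \in nbh E u) = adj E u v.
Proof. by rewrite inE. Qed.

Lemma nbhC E u v : (v \in nbh E u) = (u \in nbh E v).
Proof. by rewrite !in_nbh adjC. Qed.

Lemma adj_neq E u v : is_graph E -> adj E u v -> u != v.
Proof. by move=> gE /(card_edge gE); rewrite cards2; case: eqP. Qed.

Lemma adjxx E u : is_graph E -> adj E u u = false.
Proof. by move=> gE; apply/negP => /(adj_neq gE); rewrite eqxx. Qed.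

Lemma adj_cover E u v : adj E u v -> u \in cover E.
Proof. by move=> uv; apply/bigcupP; exists [set u; v]; rewrite ?set21. Qed.

Lemma nbh_cover E u v : v \in nbh E u -> v \in cover E.
Proof. by rewrite nbhC in_nbh; apply: adj_cover. Qed.

Lemma in_cover_deg E u : is_graph E -> (u \in cover E) = (0 < deg E u).
Proof.
move=> gE; apply/bigcupP/card_gt0P => [[e eE ue]|[v]].
  by have [v ev _] := card2_split (card_edge gE eE) ue; exists v; rewrite in_nbh /adj -ev.
by rewrite in_nbh => uv; exists [set u; v]; rewrite ?set21.
Qed.

Lemma coverU E F : cover (E :|: F) = cover E :|: cover F.
Proof. exact: bigcup_setU. Qed.

Lemma coverS E F : E \subset F -> cover E \subset cover F.
Proof. by move=> sEF; rewrite -(setUidPr sEF) coverU subsetUl. Qed.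

Lemma nbhS E F u : E \subset F -> nbh E u \subset nbh F u.
Proof. by move=> /subsetP sEF; apply/subsetP => v; rewrite !in_nbh; apply: sEF. Qed.

Lemma degS E F u : E \subset F -> deg E u <= deg F u.
Proof. by move=> sEF; apply/subset_leq_card/nbhS. Qed.

Lemma nbhU E F u : nbh (E :|: F) u = nbh E u :|: nbh F u.
Proof. by apply/setP => v; rewrite !inE /adj inE. Qed.

Lemma nbh_notin_cover E u : u \notin cover E -> nbh E u = set0.
Proof.
by move=> uE; apply/setP => v; rewrite in_nbh inE; apply: contraNF uE; apply: adj_cover.
Qed.

Lemma nbh_edge x y : x != y -> nbh [set [set x; y]] x = [set y].
Proof.
move=> nxy; apply/setP => v; rewrite in_nbh /adj !inE.
apply/eqP/eqP => [/setP e|->//]; have := e y; rewrite !inE eqxx orbT eq_sym (negPf nxy) /=.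
by move/eqP.
Qed.

Lemma inducedS E S : induced E S \subset E.
Proof. by apply/subsetP => e; rewrite inE => /andP[]. Qed.

Lemma induced_mono E F S X : E \subset F -> S \subset X -> induced E S \subset induced F X.
Proof.
move=> /subsetP sEF sSX; apply/subsetP => e; rewrite !inE => /andP[/sEF -> eS].
exact: subset_trans sSX.
Qed.

Lemma cover_induced E S : cover (induced E S) \subset S.
Proof. by apply/bigcupsP => e; rewrite inE => /andP[]. Qed.

Lemma adj_induced E S u v : adj (induced E S) u v = [&& adj E u v, u \in S & v \in S].
Proof. by rewrite /adj inE subUset !sub1set. Qed.

Lemma deg_incident E u : is_graph E -> deg E u = #|[set e in E | u \in e]|.
Proof.
move=> gE; rewrite /deg -(card_in_imset (f := fun v => [set u; v])).
  apply: eq_card => e; rewrite !inE; apply/imsetP/andP => [[v]|[eE ue]].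
    by rewrite in_nbh => uv ->; rewrite set21.
  by have [v ev _] := card2_split (card_edge gE eE) ue; exists v; rewrite ?in_nbh /adj -?ev.
move=> v w; rewrite !in_nbh => uv uw /setP eq.
have := eq v; rewrite !inE eqxx orbT => /esym /orP [] /eqP // vu.
by move: (adj_neq gE uv); rewrite vu eqxx.
Qed.

Lemma handshake E : is_graph E -> \sum_(v in cover E) deg E v = 2 * #|E|.
Proof.
move=> gE; under eq_bigr => v _ do rewrite deg_incident // -sum1dep_card.
rewrite (exchange_big_dep (mem E)) /=; last by move=> v e _ /andP[].
rewrite mulnC -sum_nat_const; apply: eq_bigr => e eE.
rewrite sum1dep_card -(card_edge gE eE); apply: eq_card => v; rewrite inE eE andbC.
by case ve: (v \in e); rewrite //=; apply/bigcupP; exists e.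
Qed.

End Graph.

Lemma imset_pair (aT rT : finType) (f : aT -> rT) x y : f @: [set x; y] = [set f x; f y].
Proof. by rewrite imsetU !imset_set1. Qed.

(* Double counting of the transfers [sends]; a tight total forces every vertex to be tight. *)
Lemma discharging (T : finType) (V : {set T}) (charge demand : T -> nat) (sends : rel T) :
    (forall u v, sends u v -> (u \in V) && (v \in V)) ->
    {in V, forall v, demand v + #|[set u | sends u v]| <= charge v + #|[set u | sends v u]|} ->
  \sum_(v in V) demand v < \sum_(v in V) charge v \/
    {in V, forall v, demand v + #|[set u | sends u v]| = charge v + #|[set u | sends v u]|}.
Proof.
move=> sendsV enough.
have in_out : \sum_(v in V) #|[set u | sends u v]| = \sum_(v in V) #|[set u | sends v u]|.
  under eq_bigr => v _ do rewrite -sum1dep_card.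
  under [RHS]eq_bigr => v _ do rewrite -sum1dep_card.
  rewrite (exchange_big_dep (mem V)) /= => [|v u _ /sendsV /andP[] //].
  apply: eq_bigr => u uV; apply: eq_bigl => v.
  by case: (boolP (sends u v)) => [/sendsV /andP[_ ->]|]; rewrite ?andbF.
have := leqif_sum (P := mem V) (fun v vV => conj (enough v vV) (erefl _)).
rewrite !big_split /= in_out => -[le_sum /esym eq_sum].
have [lt|ge] := ltnP (\sum_(v in V) demand v) (\sum_(v in V) charge v); first by left.
have /forall_inP tight : [forall (v | v \in V),
    demand v + #|[set u | sends u v]| == charge v + #|[set u | sends v u]|].
  by rewrite eq_sum eqn_leq le_sum leq_add2r.
by right => v vV; apply/eqP/tight.
Qed.

Lemma graph_discharging (T : finType) (E : {set {set T}}) (a c : nat) (sends : rel T) :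
    is_graph E -> (forall u v, sends u v -> adj E u v) ->
    {in cover E, forall v,
      2 * a + #|[set u | sends u v]| <= c * deg E v + #|[set u | sends v u]|} ->
  a * #|cover E| < c * #|E| \/
    {in cover E, forall v,
      2 * a + #|[set u | sends u v]| = c * deg E v + #|[set u | sends v u]|}.
Proof.
move=> gE sendsE /discharging [u v /sendsE uv|lt|]; last by right.
  by rewrite (adj_cover uv); move: uv; rewrite adjC; apply: adj_cover.
left; move: lt; rewrite sum_nat_const -big_distrr handshake //=; lia.
Qed.

(** * Copies of a fixed graph *)

Section Copies.
Variables (k : nat) (EK : {set {set 'I_k}}) (T : finType).
Implicit Types (f : {ffun 'I_k -> T}) (E F : {set {set T}}) (S : {set T}).

Definition copy_edges f : {set {set T}} := [set f @: (e : {set 'I_k}) | e in EK].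

Definition embeds E f : bool := injectiveb f && (copy_edges f \subset E).

Definition copy_set E S : bool := [exists f, embeds E f && (S == f @: setT)].

Lemma embedsP E f : reflect (injective f /\ copy_edges f \subset E) (embeds E f).
Proof. by apply: (iffP andP) => -[/injectiveP]. Qed.

Lemma copy_setP E S : reflect (exists2 f, embeds E f & S = f @: setT) (copy_set E S).
Proof.
apply: (iffP existsP) => [[f /andP[fE /eqP ->]]|[f fE ->]]; exists f => //.
by rewrite fE eqxx.
Qed.

Lemma copy_edges_subP f E :
  reflect {in EK, forall e : {set 'I_k}, f @: e \in E} (copy_edges f \subset E).
Proof.
apply: (iffP subsetP) => [fE e eK|fE _ /imsetP[e eK ->]]; last exact: fE.
by apply: fE; apply: imset_f.
Qed.

Lemma card_copy_edges f : injective f -> #|copy_edges f| = #|EK|.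
Proof. by move=> fi; rewrite card_imset //; apply: imset_inj. Qed.

Lemma is_graph_copy f : is_graph EK -> injective f -> is_graph (copy_edges f).
Proof.
move=> gK fi; apply/forall_inP => _ /imsetP[e eK ->].
by rewrite card_imset // (card_edge gK).
Qed.

Lemma copy_set_induced E F S : induced E S \subset F -> copy_set E S -> copy_set F S.
Proof.
move=> sF /copy_setP [f /embedsP [fi fE] eS]; apply/copy_setP; exists f => //.
apply/embedsP; split=> //; apply/copy_edges_subP => e eK; apply: (subsetP sF).
by rewrite inE (copy_edges_subP _ _ fE) // eS imsetS ?subsetT.
Qed.

Lemma card_copy_set E S : copy_set E S -> #|S| = k.
Proof. by case/copy_setP => f /embedsP [fi _] ->; rewrite card_imset // cardsT card_ord. Qed.

Lemma copy_set_deg d E S v : (forall i, d <= deg EK i) ->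
  copy_set E S -> v \in S -> d <= #|nbh E v :&: S|.
Proof.
move=> dK /copy_setP [f /embedsP [fi /copy_edges_subP fE] ->] /imsetP [i _ ->].
apply: leq_trans (dK i) _; rewrite /deg -(card_imset _ fi); apply/subset_leq_card.
by apply/subsetP => _ /imsetP [j + ->]; rewrite in_nbh !inE /adj -imset_pair => /fE ->;
  rewrite imset_f.
Qed.

End Copies.

(** * Pairings and critical graphs *)

Section Hitting.
Variable T : finType.
Implicit Types (P Q : {set {set T}}) (S W D : {set T}) (x y : T).

Definition hits P S : bool := [exists e in P, e \subset S].

Definition bounded_graph b P : bool := is_graph P && [forall v, deg P v <= b].

Lemma hitsS P Q S : P \subset Q -> hits P S -> hits Q S.
Proof. by move=> /subsetP sPQ /exists_inP [e eP eS]; apply/exists_inP; exists e; rewrite ?sPQ. Qed.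

Lemma adj_hits P S x y : adj P x y -> x \in S -> y \in S -> hits P S.
Proof.
by move=> xy xS yS; apply/exists_inP; exists [set x; y]; rewrite // subUset !sub1set xS.
Qed.

Lemma hits_adj P S : is_graph P -> hits P S ->
  exists x y, [/\ x \in S, y \in S & adj P x y].
Proof.
move=> gP /exists_inP [e eP eS]; have /eqP/cards2P [x [y [_ ee]]] := card_edge gP eP.
by move: eP eS; rewrite ee subUset !sub1set => xyP /andP[xS yS]; exists x, y.
Qed.

Lemma bounded_graphP b P :
  reflect (is_graph P /\ forall v, deg P v <= b) (bounded_graph b P).
Proof. by apply: (iffP andP) => -[gP /forallP]. Qed.

Lemma bounded_graphS b P Q : P \subset Q -> bounded_graph b Q -> bounded_graph b P.
Proof.
move=> sPQ /bounded_graphP [gQ dQ]; apply/bounded_graphP; split; first exact: is_graphS gQ.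
by move=> v; apply: leq_trans (degS v sPQ) (dQ v).
Qed.

Lemma bounded_graphU b P Q : [disjoint cover P & cover Q] ->
  bounded_graph b P -> bounded_graph b Q -> bounded_graph b (P :|: Q).
Proof.
move=> dPQ /bounded_graphP [gP dP] /bounded_graphP [gQ dQ]; apply/bounded_graphP.
rewrite is_graphU gP gQ; split=> // v; rewrite /deg nbhU.
have [vP|vP] := boolP (v \in cover P); last by rewrite (nbh_notin_cover vP) set0U; apply: dQ.
by rewrite (@nbh_notin_cover _ Q) ?setU0 ?(disjointFr dPQ) //; apply: dP.
Qed.

Lemma bounded_graph_add b P x y : x != y -> bounded_graph b P ->
  deg P x < b -> deg P y < b -> bounded_graph b ([set x; y] |: P).
Proof.
move=> nxy /bounded_graphP [gP dP] dx dy; apply/bounded_graphP.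
rewrite is_graphU is_graph_edge nxy gP; split=> // v; rewrite /deg nbhU.
have [->|nvx] := eqVneq v x; first by rewrite nbh_edge // (leq_trans (leq_card_setU _ _)) ?cards1.
have [->|nvy] := eqVneq v y.
  by rewrite setUC [X in [set X]]setUC nbh_edge 1?eq_sym // (leq_trans (leq_card_setU _ _))
    ?cards1 ?addn1.
rewrite nbh_notin_cover ?set0U ?dP //; apply/bigcupP => -[_ /set1P ->].
by rewrite !inE (negPf nvx) (negPf nvy).
Qed.

Lemma bounded_graph_edge x y : x != y -> bounded_graph 1 [set [set x; y]].
Proof.
move=> nxy; rewrite -[[set _]]setU0.
have deg0 v : deg set0 v = 0 :> nat by rewrite /deg nbh_notin_cover ?cards0 // /cover big_set0 inE.
apply: bounded_graph_add; rewrite ?deg0 //; apply/bounded_graphP; split=> [|v];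
  last by rewrite deg0.
by apply/forall_inP => e; rewrite inE.
Qed.

Lemma bounded_graph_matching (D : {set T}) (j : T -> T) :
  {in D &, injective j} -> [disjoint D & j @: D] ->
  bounded_graph 1 [set [set x; j x] | x in D].
Proof.
move=> ji dD; have jD x y : x \in D -> y \in D -> j x != y.
  by move=> xD yD; apply: contraTneq yD => <-; rewrite (disjointFl dD) ?imset_f.
apply/bounded_graphP; split.
  by apply/forall_inP => _ /imsetP [x xD ->]; rewrite cards2 (eq_sym x) jD.
move=> v; apply/card_le1_eqP => y z; rewrite !in_nbh.
have mate w : adj [set [set x; j x] | x in D] v w ->
    v \in D /\ w = j v \/ w \in D /\ v = j w.
  case/imsetP => x xD e; have [vx wx] : v \in [set x; j x] /\ w \in [set x; j x].
    by rewrite -e set21 set22.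
  move: vx wx; rewrite !inE => /orP[] /eqP ev /orP[] /eqP ew; subst v w; try by [left|right].
    by have /setP /(_ (j x)) := e; rewrite !inE eqxx orbT orbb (negPf (jD _ _ xD xD)).
  by have /setP /(_ x) := e; rewrite !inE eqxx orbb (eq_sym x) (negPf (jD _ _ xD xD)).
case/mate=> -[aD ea] /mate[] [cD ec]; first by rewrite ea ec.
- by have := jD _ _ cD aD; rewrite -ec eqxx.
- by have := jD _ _ aD cD; rewrite -ea eqxx.
- by apply: ji => //; rewrite -ea -ec.
Qed.

End Hitting.

Section Critical.
Variables (b k : nat) (EK : {set {set 'I_k}}) (T : finType).
Implicit Types (E P U : {set {set T}}) (S X : {set T}) (u v x y : T).

(* Breaker answers every vertex of Maker by its neighbours in [P]. *)
Definition pairing P E : bool :=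
  bounded_graph b P && [forall S, copy_set EK E S ==> hits P S].

Definition pairable E : bool := [exists P, pairing P E].

Definition critical E : bool := minset (fun E' => ~~ pairable E') E.

Definition connected_copies E : Prop := forall U, U \subset E -> U != set0 ->
  (forall f, embeds EK E f -> (exists i, f i \in cover U) -> copy_edges EK f \subset U) ->
  U = E.

Lemma pairableP E :
  reflect (exists2 P, bounded_graph b P & forall S, copy_set EK E S -> hits P S) (pairable E).
Proof.
apply: (iffP existsP) => [[P /andP[bP /forallP hP]]|[P bP hP]]; exists P => //.
  by move=> S; apply/implyP/hP.
by rewrite /pairing bP; apply/forallP => S; apply/implyP/hP.
Qed.

Variable E : {set {set T}}.
Hypothesis crE : critical E.

Lemma critical_unhit P : bounded_graph b P -> exists2 S, copy_set EK E S & ~~ hits P S.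
Proof.
move=> bP; have /existsPn /(_ P) := minsetp crE; rewrite /pairing bP /= => /forallPn [S].
by rewrite negb_imply => /andP[]; exists S.
Qed.

Lemma critical_copy : exists S, copy_set EK E S.
Proof.
have [|S CS _] := @critical_unhit set0; last by exists S.
apply/bounded_graphP; split=> [|v]; first by apply/forall_inP => e; rewrite inE.
by rewrite /deg nbh_notin_cover ?cards0 // /cover big_set0 inE.
Qed.

Lemma critical_proper E' : E' \proper E -> pairable E'.
Proof.
by case/andP=> sE' nsE; apply: contraNT nsE => /(minsetinf crE) /(_ sE') ->.
Qed.

Lemma critical_edge e : e \in E -> exists2 S, copy_set EK E S & e \subset S.
Proof.
move=> eE; have /pairableP [P bP hP] := critical_proper (properD1 eE).
have [S CS nPS] := critical_unhit bP; exists S => //.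
apply: contraNT nPS => neS; apply/hP/copy_set_induced/CS.
by apply/subsetP => e' /setIdP[e'E e'S]; rewrite !inE e'E andbT; apply: contraNneq neS => <-.
Qed.

Lemma critical_adj u v : adj E u v -> exists S, [/\ copy_set EK E S, u \in S & v \in S].
Proof.
by move=> /critical_edge [S CS]; rewrite subUset !sub1set => /andP[uS vS]; exists S.
Qed.

Lemma critical_cover x : x \in cover E -> exists2 S, copy_set EK E S & x \in S.
Proof. by case/bigcupP => e /critical_edge [S CS /subsetP eS] /eS xS; exists S. Qed.

Lemma avoiding_pairing X x : x \in X -> x \in cover E ->
  exists P, [/\ bounded_graph b P,
    forall S, copy_set EK E S -> [disjoint S & X] -> hits P S &
    forall e, e \in P -> exists S, [/\ copy_set EK E S, [disjoint S & X] & e \subset S]].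
Proof.
move=> xX /bigcupP [e eE xe].
have /critical_proper /pairableP [P bP hP] : induced E (~: X) \proper E.
  apply/properP; split; first exact: inducedS.
  by exists e; rewrite // inE eE /= -disjoints_subset; apply/negP => /disjointFr /(_ xe);
    rewrite xX.
exists [set e in P | [exists S, [&& copy_set EK E S, [disjoint S & X] & e \subset S]]]; split.
- by apply: bounded_graphS bP; apply/subsetP => e'; rewrite inE => /andP[].
- move=> S CS dSX; have /hP /exists_inP [e' e'P e'S] : copy_set EK (induced E (~: X)) S.
    by apply: copy_set_induced CS; apply: induced_mono; rewrite -?disjoints_subset.
  by apply/exists_inP; exists e'; rewrite // inE e'P; apply/existsP; exists S; rewrite CS dSX.
by move=> e'; rewrite inE => /andP[_ /existsP [S /and3P[CS dSX e'S]]]; exists S.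
Qed.

(* A pairing of the copies avoiding [X] would combine with [P] to a pairing of all copies. *)
Lemma no_local_pairing X P x : x \in X -> x \in cover E -> bounded_graph b P -> cover P \subset X ->
  (forall S y, copy_set EK E S -> y \in S -> y \in X -> hits P S) -> False.
Proof.
move=> xX xE bP sPX hP; have [Q [bQ hQ inQ]] := avoiding_pairing xX xE.
have [|S CS] := @critical_unhit (P :|: Q).
  apply: bounded_graphU => //; apply/pred0P => v /=; apply/negP.
  case/andP => /(subsetP sPX) vX /bigcupP [e /inQ [S [_ dSX eS]] /(subsetP eS)].
  by rewrite (disjointFl dSX vX).
case/negP; have [/hQ|/pred0Pn [y /andP[yS yX]]] := boolP [disjoint S & X].
  by move/(_ CS); apply: hitsS; apply: subsetUr.
by apply: hitsS (hP S y CS yS yX); apply: subsetUl.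
Qed.

Lemma critical_connected : is_graph E -> cover EK = setT -> connected_copies E.
Proof.
move=> gE cK U sU /set0Pn [e0 e0U] closed; apply/eqP; apply: contraT => nUE.
have /critical_proper /pairableP [P bP hP] : U \proper E by rewrite properEneq nUE.
have /set0Pn [x xe] : e0 != set0 by rewrite -card_gt0 (card_edge gE) // (subsetP sU).
have xU : x \in cover U by apply/bigcupP; exists e0.
apply: False_ind; apply: (no_local_pairing xU) (subsetP (coverS sU) x xU) _ (cover_induced P _) _.
  exact: bounded_graphS (inducedS _ _) bP.
move=> S y /copy_setP [f fE SE] yS yU; have /embedsP [fi _] := fE.
have fU : copy_edges EK f \subset U.
  by apply: closed fE _; move: yS; rewrite SE => /imsetP [i _ e']; exists i; rewrite -e'.
have /exists_inP [e eP eS] : hits P S by apply/hP/copy_setP; exists f => //; apply/embedsP.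
apply/exists_inP; exists e => //; rewrite inE eP; apply: subset_trans eS _.
rewrite SE; apply/subsetP => _ /imsetP [i _ ->].
have /bigcupP [e' e'K ie'] : i \in cover EK by rewrite cK inE.
by apply/bigcupP; exists (f @: e'); rewrite ?imset_f // (copy_edges_subP _ _ _ fU).
Qed.

Hypothesis b_gt0 : 0 < b.

Lemma bounded_graph1 P : bounded_graph 1 P -> bounded_graph b P.
Proof.
move=> /bounded_graphP [gP dP]; apply/bounded_graphP; split=> // v.
exact: leq_trans (dP v) b_gt0.
Qed.

Lemma critical_no_twins x y : x != y -> x \in cover E ->
  (forall S, copy_set EK E S -> (x \in S) = (y \in S)) -> False.
Proof.
move=> nxy xE twins; apply: (no_local_pairing (set21 x y) xE).
- exact/bounded_graph1/bounded_graph_edge/nxy.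
- by rewrite /cover big_set1.
move=> S z CS zS; rewrite !inE => zxy.
have [xS yS] : x \in S /\ y \in S.
  by case/orP: zxy zS => /eqP ->; rewrite ?twins // -twins.
by apply: adj_hits xS yS; rewrite /adj set11.
Qed.

Lemma critical_no_two_pairs x y z w : uniq [:: x; y; z; w] -> x \in cover E ->
  (forall S, copy_set EK E S -> [|| x \in S, y \in S, z \in S | w \in S] ->
     (x \in S) && (y \in S) || (z \in S) && (w \in S)) -> False.
Proof.
rewrite /= !inE !negb_or !andbT => /and3P[/and3P[nxy nxz nxw] /andP[nyz nyw] nzw] xE pairs2.
apply: (@no_local_pairing ([set x; y] :|: [set z; w]) [set [set x; y]; [set z; w]] x) => //.
- by rewrite !inE eqxx.
- apply/bounded_graph1/bounded_graphU; try exact: bounded_graph_edge.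
  rewrite /cover !big_set1; apply/pred0P => v /=; rewrite !inE.
  by apply/negP => /andP[/orP[] /eqP -> /orP[]]; apply/negP.
- by rewrite /cover bigcup_setU !big_set1.
move=> S v CS vS; rewrite !inE -orbA => vl.
have /pairs2 : [|| x \in S, y \in S, z \in S | w \in S].
  by case/or4P: vl => /eqP <-; rewrite vS ?orbT.
by case/(_ CS)/orP => /andP[]; apply: adj_hits; rewrite /adj !inE eqxx ?orbT.
Qed.

Lemma critical_no_matching (D : {set T}) (j : T -> T) x : x \in D -> x \in cover E ->
  {in D &, injective j} -> [disjoint D & j @: D] ->
  (forall S y, copy_set EK E S -> y \in S -> y \in D :|: j @: D ->
     exists z, [/\ z \in D, z \in S & j z \in S]) -> False.
Proof.
move=> xD xE ji dD matched.
apply: (@no_local_pairing (D :|: j @: D) [set [set y; j y] | y in D] x) => //.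
- by rewrite inE xD.
- exact/bounded_graph1/bounded_graph_matching.
- apply/bigcupsP => _ /imsetP [y yD ->]; apply/subsetP => z; rewrite !inE.
  by case/orP => /eqP ->; rewrite ?yD // imset_f ?orbT.
move=> S y CS yS yDj; have [z [zD zS jzS]] := matched S y CS yS yDj.
by apply: adj_hits zS jzS; apply: imset_f.
Qed.

End Critical.

Lemma exists_critical b k (EK : {set {set 'I_k}}) (T : finType) (G : {set {set T}}) :
  ~~ pairable b EK G -> exists2 E, critical b EK E & E \subset G.
Proof. by move=> nG; have [E] := minset_exists (P := fun E => ~~ pairable b EK E) nG; exists E. Qed.

(** * Degree two vertices and long cycles *)

Section Hall.
Variables (I T : finType).
Implicit Types (A X : {set I}) (N : I -> {set T}).

Definition hall_condition A N : Prop :=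
  forall X, X \subset A -> #|X| <= #|\bigcup_(i in X) N i|.

Lemma hall_condition_tight A X N : hall_condition A N -> X \subset A ->
  #|\bigcup_(i in X) N i| <= #|X| ->
  hall_condition (A :\: X) (fun i => N i :\: \bigcup_(i in X) N i).
Proof.
move=> hallA sXA tight Y; rewrite subsetD => /andP[sYA dYX]; set V := \bigcup_(i in X) N i.
have := hallA (Y :|: X); rewrite subUset sYA sXA bigcup_setU => /(_ isT).
rewrite !cardsU (disjoint_setI0 dYX) cards0 subn0 -/V.
have -> : \bigcup_(i in Y) (N i :\: V) = (\bigcup_(i in Y) N i) :\: V.
  by under eq_bigr => i _ do rewrite setDE; rewrite setDE big_distrl.
rewrite cardsD; have := subset_leq_card (subsetIl (\bigcup_(i in Y) N i) V).
by move: tight; rewrite -/V; lia.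
Qed.

Lemma hall_marriage (t0 : T) A N : hall_condition A N ->
  exists j : I -> T, {in A, forall i, j i \in N i} /\ {in A &, injective j}.
Proof.
elim: {A}_.+1 {-2}A (ltnSn #|A|) N => // m IH A ltA N hallA.
have [->|/set0Pn [a aA]] := eqVneq A set0.
  by exists (fun=> t0); split=> i; rewrite inE.
suff [X [V [j [[X0 sXA] [jN jV ji] hallD]]]] : exists X (V : {set T}) (j : I -> T),
    [/\ X != set0 /\ X \subset A,
        [/\ {in X, forall i, j i \in N i}, {in X, forall i, j i \in V} & {in X &, injective j}] &
        hall_condition (A :\: X) (fun i => N i :\: V)].
  have [|j' [jN' ji']] := IH _ _ _ hallD.
    by rewrite cardsD (setIidPr sXA); move: ltA X0; rewrite -card_gt0;
      have := subset_leq_card sXA; lia.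
  exists (fun i => if i \in X then j i else j' i); split=> [i iA|i1 i2 i1A i2A].
    by have [/jN //|niX] := ifPn; have := jN' i; rewrite !inE niX iA => /(_ isT) /andP[].
  have outV i : i \in A -> i \notin X -> j' i \notin V.
    by move=> iA niX; have := jN' i; rewrite !inE niX iA => /(_ isT) /andP[].
  have [X1|X1] := ifPn; have [X2|X2] := ifPn; first exact: ji.
  - by move=> e; have := outV i2 i2A X2; rewrite -e jV.
  - by move=> e; have := outV i1 i1A X1; rewrite e jV.
  - by apply: ji'; rewrite inE ?X1 ?X2.
have [/existsP [X /and3P[X0 /andP[sXA ltXA] tight]]|/existsPn slack] := boolP [exists X : {set I},
    [&& X != set0, X \proper A & #|\bigcup_(i in X) N i| <= #|X|]].
  have [|j [jN ji]] := IH X _ N (fun Y sYX => hallA Y (subset_trans sYX sXA)).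
    by rewrite -ltnS; apply: leq_trans ltA; rewrite ltnS proper_card // properE sXA.
  exists X, (\bigcup_(i in X) N i), j; split=> //; last exact: hall_condition_tight.
  by split=> // i iX; apply/bigcupP; exists i; rewrite // jN.
have /card_gt0P [b bNa] : 0 < #|N a|.
  by have := hallA [set a]; rewrite sub1set big_set1 cards1; apply.
exists [set a], [set b], (fun=> b); split.
- by rewrite -card_gt0 cards1 sub1set.
- by split=> [i /set1P ->|i _|i1 i2 /set1P -> /set1P ->] //; rewrite inE.
move=> Y; rewrite subsetD1 => /andP[sYA naY].
have [->|Y0] := eqVneq Y set0; first by rewrite cards0.
have nsAY : ~~ (A \subset Y) by apply: contra naY => /subsetP; apply.
have := slack Y; rewrite Y0 properE sYA nsAY /= -ltnNge.
have -> : \bigcup_(i in Y) (N i :\ b) = (\bigcup_(i in Y) N i) :\ b.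
  by under eq_bigr => i _ do rewrite setDE; rewrite setDE big_distrl.
by rewrite (cardsD1 b (\bigcup_(i in Y) N i)); lia.
Qed.

Lemma hall_condition_regular d A N : 0 < d -> {in A, forall i, d <= #|N i|} ->
  (forall t, #|[set i in A | t \in N i]| <= d) -> hall_condition A N.
Proof.
move=> d0 dA dT X /subsetP sXA; rewrite -(leq_pmul2l d0) mulnC -sum_nat_const.
apply: (@leq_trans (\sum_(i in X) #|N i|)); first by apply: leq_sum => i /sXA /dA.
under eq_bigr => i _ do rewrite -sum1_card.
rewrite (exchange_big_dep (mem (\bigcup_(i in X) N i))) /=; last first.
  by move=> i t iX tN; apply/bigcupP; exists i.
rewrite mulnC -sum_nat_const; apply: leq_sum => t _; rewrite sum1dep_card.
by apply: leq_trans (dT t); apply/subset_leq_card/subsetP => i; rewrite !inE => /andP[/sXA ->].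
Qed.

End Hall.

Lemma card3_split (T : finType) (A D : {set T}) : #|A| = 3 -> 1 < #|A :&: D| ->
  exists x1 x2 w, [/\ A = [set x1; x2; w], uniq [:: x1; x2; w], x1 \in D & x2 \in D].
Proof.
move=> A3 /card_gt1P [x [y [/setIP[xA xD] /setIP[yA yD] nxy]]].
have /card_gt0P [w] : 0 < #|A :\ x :\ y|.
  by move: A3; rewrite (cardsD1 x A) xA (cardsD1 y (A :\ x)) !inE eq_sym nxy yA; lia.
rewrite !inE => /and3P[nwy nwx wA].
exists x, y, w; split=> //=; last by rewrite !inE negb_or nxy !(eq_sym _ w) nwx nwy.
apply/esym/eqP; rewrite eqEcard A3; apply/andP; split.
  by apply/subsetP => z; rewrite !inE -orbA => /or3P[] /eqP ->.
by rewrite setUC cardsU1 cards2 !inE negb_or nwx nwy nxy.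
Qed.

Definition deg2 (T : finType) (E : {set {set T}}) : {set T} := [set v | deg E v == 2].

Lemma deg2P (T : finType) (E : {set {set T}}) v : reflect (deg E v = 2) (v \in deg2 E).
Proof. by rewrite inE; apply: eqP. Qed.

Section DegreeTwo.
Variables (k : nat) (EK : {set {set 'I_k}}) (T : finType) (E : {set {set T}}).
Hypothesis K_deg : forall i, 1 < deg EK i.
Hypotheses (gE : is_graph E) (crE : critical 1 EK E).

Local Notation nb := (nbh E).
Implicit Types (S : {set T}) (u v x y : T).

Lemma copy_deg S v : copy_set EK E S -> v \in S -> 1 < #|nb v :&: S|.
Proof. exact: copy_set_deg. Qed.

Lemma cover_deg v : v \in cover E -> 1 < deg E v.
Proof.
move=> /(critical_cover crE) [S CS vS].
by apply: leq_trans (copy_deg CS vS) _; apply/subset_leq_card/subsetIl.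
Qed.

Lemma deg2_nbh_sub x S : deg E x = 2 -> copy_set EK E S -> x \in S -> nb x \subset S.
Proof.
move=> dx CS xS; apply/setIidPl/eqP; rewrite eqEcard subsetIl -/(deg E x) dx.
exact: copy_deg.
Qed.

Lemma deg2_adj x y S : deg E x = 2 -> adj E x y -> copy_set EK E S -> x \in S -> y \in S.
Proof. by move=> dx xy CS xS; apply: (subsetP (deg2_nbh_sub dx CS xS)); rewrite in_nbh. Qed.

Lemma deg2_nonadj x y : adj E x y -> deg E x = 2 -> deg E y <> 2.
Proof.
move=> xy dx dy; apply: (critical_no_twins crE isT (adj_neq gE xy) (adj_cover xy)) => S CS.
by apply/idP/idP; apply: deg2_adj => //; rewrite adjC.
Qed.

Lemma deg2_nbh_isolated v : v \in deg2 E -> nb v :&: deg2 E = set0.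
Proof.
move=> /deg2P dv; apply/setP => u; rewrite in_setI in_nbh in_set0.
by apply/negP => /andP[vu /deg2P]; apply: deg2_nonadj vu dv.
Qed.

Lemma deg3_copy v x1 x2 x3 S : nb v = [set x1; x2; x3] -> copy_set EK E S -> v \in S ->
  [|| (x1 \in S) && (x2 \in S), (x1 \in S) && (x3 \in S) | (x2 \in S) && (x3 \in S)].
Proof.
move=> nv CS vS; have /card_gt1P [a [c [/setIP[anv aS] /setIP[cnv cS] nac]]] := copy_deg CS vS.
move: anv cnv nac aS cS; rewrite nv !inE -!orbA.
by move=> /or3P[]/eqP-> /or3P[]/eqP->; rewrite ?eqxx // => _ -> ->; rewrite ?orbT.
Qed.

Lemma deg3_nbh_deg2 v : deg E v = 3 -> #|nb v :&: deg2 E| <= 2.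
Proof.
move=> d3; rewrite leqNgt; apply/negP => lt.
have /setIidPl/subsetP sD : nb v :&: deg2 E = nb v.
  by apply/eqP; rewrite eqEcard subsetIl -/(deg E v) d3.
have [x1 [x2 [x3 [nv ux _ _]]]] := card3_split d3 (ltnW lt).
have vx x : x \in [:: x1; x2; x3] -> adj E v x /\ deg E x = 2.
  move=> xs; have xv : x \in nb v by move: xs; rewrite nv !inE orbA.
  by move: (sD x xv) => /deg2P ->; rewrite -in_nbh.
have [[a1 d1] [a2 d2] [a3 d3']] : [/\ adj E v x1 /\ deg E x1 = 2, adj E v x2 /\ deg E x2 = 2 &
    adj E v x3 /\ deg E x3 = 2] by split; apply: vx; rewrite !inE eqxx ?orbT.
apply: (@critical_no_two_pairs _ _ _ _ _ crE isT v x1 x2 x3); last 1 first.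
- move=> S CS meetS; have vS : v \in S.
    by case/or4P: meetS => // xS; apply: (deg2_adj _ _ CS xS); rewrite // adjC.
  by rewrite vS; have := deg3_copy nv CS vS; case: (x1 \in S).
- rewrite cons_uniq ux andbT !inE !negb_or.
  by rewrite (adj_neq gE a1) (adj_neq gE a2) (adj_neq gE a3).
exact: adj_cover a1.
Qed.

Lemma critical_cover_neq0 : 0 < k -> cover E != set0.
Proof.
move=> k0; have [S CS] := critical_copy crE.
have /card_gt0P [v vS] : 0 < #|S| by rewrite (card_copy_set CS).
apply/set0Pn; exists v; rewrite in_cover_deg //.
by apply: leq_trans (subset_leq_card (subsetIl _ S)); apply/ltnW/copy_deg.
Qed.

(* Hall's theorem matches [D] into its neighbours; the matching hits all copies it meets. *)
Lemma deg2_no_matching (D B : {set T}) x : x \in D -> x \in cover E ->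
  {in D, forall y, deg E y = 2 /\ nb y \subset B} -> [disjoint D & B] ->
  {in B, forall v, #|nb v :&: D| <= 2} ->
  (forall S v, copy_set EK E S -> v \in S -> v \in B -> exists2 y, y \in S & y \in D) -> False.
Proof.
move=> xD xE D2 dDB B2 BD.
have [|j [jN ji]] := @hall_marriage _ _ x D nb.
  apply: (@hall_condition_regular _ _ 2) => // [y /D2 [<-] //|v].
  have [vB|vB] := boolP (v \in B).
    by apply: leq_trans (B2 v vB); apply/subset_leq_card/subsetP => y; rewrite !inE adjC andbC.
  rewrite eq_card0 // => y; rewrite inE; apply/negP => /andP[/D2 [_ /subsetP sB] /sB].
  exact/negP.
have jB y : y \in D -> j y \in B by move=> yD; apply: (subsetP (D2 y yD).2); apply: jN.
apply: (@critical_no_matching _ _ _ _ _ crE isT D j x) => //.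
  by apply: disjointWr dDB; apply/subsetP => _ /imsetP [y yD ->]; apply: jB.
move=> S y CS yS yDj; have [z zS zD] : exists2 z, z \in S & z \in D.
  case/setUP: yDj => [yD|/imsetP [z zD ez]]; first by exists y.
  by apply: (BD S y CS yS); rewrite ez jB.
exists z; split=> //; apply: (deg2_adj _ _ CS zS); first exact: (D2 z zD).1.
by rewrite -in_nbh jN.
Qed.

Definition deg2_sends u v : bool := adj E u v && (u \in deg2 E).

Lemma deg2_receives v : [set u | deg2_sends u v] = nb v :&: deg2 E.
Proof. by apply/setP => u; rewrite in_setI nbhC in_nbh inE. Qed.

Lemma deg2_sent v : [set u | deg2_sends v u] = if v \in deg2 E then nb v else set0.
Proof.
by apply/setP => u; rewrite inE /deg2_sends; case: ifP; rewrite ?inE ?andbT ?andbF.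
Qed.

Section LargeOrder.
Hypothesis k_gt4 : 4 < k.

Lemma deg2_charge v : v \in cover E ->
  2 * k + #|[set u | deg2_sends u v]| <= k.-1 * deg E v + #|[set u | deg2_sends v u]|.
Proof.
move=> /cover_deg d2; rewrite deg2_receives deg2_sent; case: ifPn => [vD|/deg2P ndv].
  by rewrite deg2_nbh_isolated // cards0 -/(deg E v); move/deg2P: vD => ->; lia.
have := deg3_nbh_deg2 (v := v); have : #|nb v :&: deg2 E| <= deg E v.
  exact/subset_leq_card/subsetIl.
by rewrite cards0; move: (deg E v) #|_| k_gt4 d2 ndv => d t; nia.
Qed.

Lemma deg2_charge_tight v : v \in cover E -> v \notin deg2 E ->
  2 * k + #|[set u | deg2_sends u v]| = k.-1 * deg E v + #|[set u | deg2_sends v u]| ->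
  deg E v = 3 /\ #|nb v :&: deg2 E| = 2.
Proof.
move=> /cover_deg d2 vD; rewrite deg2_receives deg2_sent (negPf vD) cards0.
move/deg2P: vD => ndv; have := deg3_nbh_deg2 (v := v).
have : #|nb v :&: deg2 E| <= deg E v by apply/subset_leq_card/subsetIl.
by move: (deg E v) #|_| k_gt4 d2 ndv => d t; nia.
Qed.

Lemma deg2_charge_not_tight :
  ~ {in cover E, forall v, v \notin deg2 E -> deg E v = 3 /\ #|nb v :&: deg2 E| = 2}.
Proof.
move=> tight; have k0 : 0 < k by apply: leq_trans k_gt4.
have /set0Pn [x0 x0E] := critical_cover_neq0 k0.
have [x xD xE] : exists2 x, x \in deg2 E & x \in cover E.
  have [x0D|/(tight _ x0E) [_ c2]] := boolP (x0 \in deg2 E); first by exists x0.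
  have /card_gt0P [x /setIP[xx0 xD]] : 0 < #|nb x0 :&: deg2 E| by rewrite c2.
  by exists x => //; apply: nbh_cover xx0.
apply: (@deg2_no_matching (deg2 E) (cover E :\: deg2 E) x) => //.
- move=> y yD; split; first exact/deg2P.
  apply/subsetP => v vy; rewrite inE (nbh_cover vy) andbT; apply/negP => vD.
  by have /setP /(_ v) := deg2_nbh_isolated yD; rewrite in_setI vy vD inE.
- by rewrite disjoint_sym disjoints_subset setDE subsetIr.
- by move=> v /setDP[vE vD]; have [_ ->] := tight _ vE vD.
move=> S v CS vS /setDP[vE vD]; have [d3 c2] := tight _ vE vD.
have : 0 < #|(nb v :&: S) :&: (nb v :&: deg2 E)|.
  have := cardsUI (nb v :&: S) (nb v :&: deg2 E); rewrite c2 -setIUr.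
  have := copy_deg CS vS; have := subset_leq_card (subsetIl (nb v) (S :|: deg2 E)).
  by rewrite -/(deg E v) d3; lia.
by case/card_gt0P => y /setIP[/setIP[_ yS] /setIP[_ yD]]; exists y.
Qed.

Lemma critical_dense_min_deg2 : k * #|cover E| < k.-1 * #|E|.
Proof.
have [|//|tight] := graph_discharging gE (sends := deg2_sends) _ deg2_charge.
  by move=> u v /andP[].
by case: deg2_charge_not_tight => v vE vD; apply: deg2_charge_tight (tight v vE).
Qed.

End LargeOrder.

End DegreeTwo.

(** * Cliques *)

Lemma clique_copyP k (T : finType) (E : {set {set T}}) (S : {set T}) :
  reflect (#|S| = k /\ {in S &, forall u v, u != v -> adj E u v})
    (copy_set (clique_edges k) E S).
Proof.
apply: (iffP idP) => [CS|[cS aS]].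
  split; first exact: card_copy_set CS.
  have /copy_setP [f /embedsP [fi /copy_edges_subP fE] ->] := CS.
  move=> _ _ /imsetP [i _ ->] /imsetP [j _ ->] nij; rewrite /adj -imset_pair; apply: fE.
  by rewrite inE cards2; have [e|//] := eqVneq i j; move: nij; rewrite e eqxx.
pose f := [ffun i : 'I_k => enum_val (cast_ord (esym cS) i)].
have fi : injective f by move=> i j; rewrite !ffunE => /enum_val_inj /cast_ord_inj.
have fS i : f i \in S by rewrite ffunE enum_valP.
apply/copy_setP; exists f; last first.
  apply/esym/eqP; rewrite eqEcard card_imset // cardsT card_ord cS leqnn andbT.
  by apply/subsetP => _ /imsetP [i _ ->].
apply/embedsP; split=> //; apply/copy_edges_subP => e.
rewrite inE => /cards2P [i [j [nij ->]]]; rewrite imset_pair; apply: aS => //.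
by apply: contra nij => /eqP /fi ->.
Qed.

Section CriticalCliques.
Variables (b k : nat) (T : finType) (E : {set {set T}}).
Hypothesis k_gt0 : 0 < k.
Hypotheses (gE : is_graph E) (crE : critical b (clique_edges k) E).

Local Notation clique := (copy_set (clique_edges k) E).
Local Notation nb := (nbh E).
Implicit Types (P : {set {set T}}) (S W K : {set T}) (u v x y z : T).

Definition simplicial : {set T} := [set v in cover E | deg E v == k.-1].

Lemma simplicialP x : reflect (x \in cover E /\ deg E x = k.-1) (x \in simplicial).
Proof. by rewrite inE; apply: (iffP andP) => -[xE /eqP]. Qed.

Lemma card_closed_nbh v : #|v |: nb v| = (deg E v).+1.
Proof. by rewrite cardsU1 in_nbh adjxx. Qed.

Lemma clique_sub S v : clique S -> v \in S -> S \subset v |: nb v.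
Proof.
move=> /clique_copyP [_ aS] vS; apply/subsetP => u uS; rewrite !inE.
by have [//|nuv] := eqVneq u v; rewrite aS // eq_sym.
Qed.

Lemma clique_deg v : v \in cover E -> k.-1 <= deg E v.
Proof.
move=> /(critical_cover crE) [S CS vS]; have := subset_leq_card (clique_sub CS vS).
by rewrite card_closed_nbh (card_copy_set CS) -{1}(prednK k_gt0).
Qed.

Lemma simplicial_copy x S : x \in simplicial -> clique S -> x \in S -> S = x |: nb x.
Proof.
move=> /simplicialP [_ dx] CS xS; apply/eqP; rewrite eqEcard clique_sub //=.
by rewrite card_closed_nbh dx (card_copy_set CS) prednK.
Qed.

Lemma simplicial_clique x : x \in simplicial -> clique (x |: nb x).
Proof.
move=> xs; have /simplicialP [/(critical_cover crE) [S CS xS] _] := xs.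
by rewrite -(simplicial_copy xs CS xS).
Qed.

Lemma simplicial_adj x y z :
  x \in simplicial -> y \in nb x -> z \in nb x -> y != z -> adj E y z.
Proof.
move=> /simplicial_clique /clique_copyP [_ aS] yx zx.
by apply: aS; rewrite in_setU1 (yx, zx) orbT.
Qed.

(* Replacing the pairs of [P] at [W] by the single pair [y, z] would hit every clique. *)
Lemma no_exchange P W x y z : bounded_graph b P ->
  (forall S, clique S -> x \notin S -> hits P S) -> y != z ->
  (forall S w, clique S -> w \in S -> w \in x |: W -> (y \in S) && (z \in S)) ->
  deg (induced P (~: W)) y < b -> deg (induced P (~: W)) z < b -> False.
Proof.
move=> bP hP nyz SW dy dz; have [|S CS] := critical_unhit crE (bounded_graph_add nyz _ dy dz).
  exact: bounded_graphS (inducedS _ _) bP.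
case/negP; have [[w wS wW]|dSW] : (exists2 w, w \in S & w \in x |: W) \/ [disjoint S & x |: W].
- have [|/pred0Pn [w /andP[wS wW]]] := boolP [disjoint S & x |: W]; first by right.
  by left; exists w.
- by have /andP[yS zS] := SW S w CS wS wW; apply: adj_hits yS zS; rewrite /adj setU11.
have xS : x \notin S by rewrite (disjointFl dSW) ?setU11.
have /exists_inP [e eP eS] := hP S CS xS; apply/exists_inP; exists e => //.
rewrite !inE eP -disjoints_subset orbC (disjointWl eS) //.
by apply: disjointWr dSW; apply: subsetUr.
Qed.

Definition saturated_at x P : Prop :=
  [/\ bounded_graph b P, forall S, clique S -> x \notin S -> hits P S,
      forall e, e \in P -> exists S, [/\ clique S, x \notin S & e \subset S],
      ~~ hits P (x |: nb x) & {in nb x, forall y, deg P y = b}].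

Lemma saturated_adj x P u v : saturated_at x P -> adj P u v -> adj E u v.
Proof.
move=> [/bounded_graphP [gP _] _ inP _ _] uv; have [S [/clique_copyP [_ aS] _]] := inP _ uv.
by rewrite subUset !sub1set => /andP[uS vS]; apply: aS; rewrite // (adj_neq gP uv).
Qed.

Lemma saturated_nbh x P y : saturated_at x P -> y \in nb x ->
  nbh P y \subset nb y :\: (x |: nb x).
Proof.
move=> satP yx; have [_ _ _ nhK _] := satP; apply/subsetP => u; rewrite in_nbh => yu.
rewrite in_setD in_nbh (saturated_adj satP yu) andbT.
by apply: contra nhK => uK; apply: adj_hits yu _ uK; rewrite in_setU1 yx orbT.
Qed.

Lemma simplicial_nbr_deg x y : x \in simplicial -> y \in nb x ->
  deg E y = #|nb y :\: (x |: nb x)| + k.-1.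
Proof.
move=> xs yx; have /clique_copyP [cK aK] := simplicial_clique xs; set K := x |: nb x in cK aK *.
have yK : y \in K by rewrite in_setU1 yx orbT.
rewrite /deg -(cardsID K (nb y)) addnC; congr (_ + _); rewrite -cK (cardsD1 y K) yK.
apply: eq_card => u; rewrite in_setI in_setD1 in_nbh andbC.
have [uK|] /= := boolP (u \in K); last by rewrite andbF.
by have [->|nuy] := eqVneq u y; rewrite ?adjxx // aK // eq_sym.
Qed.

Hypothesis b_gt0 : 0 < b.

Lemma saturated_pairing x : x \in simplicial -> exists P, saturated_at x P.
Proof.
move=> xs; have /simplicialP [xE dx] := xs.
have [P [bP hP inP]] := avoiding_pairing crE (set11 x) xE.
have hP' S : clique S -> x \notin S -> hits P S.
  by move=> CS xS; apply: hP; rewrite // disjoint_sym disjoints1.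
have inP' : forall e, e \in P -> exists S, [/\ clique S, x \notin S & e \subset S].
  by move=> e /inP [S [CS dS eS]]; exists S; rewrite -disjoints1 disjoint_sym.
exists P; split=> // [|y yx].
  apply/negP => hK; have [S CS] := critical_unhit crE bP; case/negP.
  have [xS|xS] := boolP (x \in S); last exact: hP'.
  by rewrite (simplicial_copy xs CS xS).
have /bounded_graphP [gP dP] := bP; apply/eqP; rewrite eqn_leq dP leqNgt; apply/negP => lt.
have lt0 u : deg (induced P (~: set0)) u <= deg P u by apply/degS/inducedS.
apply: (@no_exchange P set0 x x y bP hP') (leq_ltn_trans (lt0 y) lt).
- by apply: (adj_neq gE); rewrite -in_nbh.
- move=> S w CS wS; rewrite setU0 => /set1P ew; rewrite ew in wS.
  by rewrite (simplicial_copy xs CS wS) setU11 in_setU1 yx orbT.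
apply: leq_ltn_trans (lt0 x) _; rewrite /deg nbh_notin_cover ?cards0 //.
by apply/bigcupP => -[e /inP' [S [_ /negP nxS /subsetP eS]] /eS].
Qed.

Lemma simplicial_nbr_deg_ge x y : x \in simplicial -> y \in nb x -> b + k.-1 <= deg E y.
Proof.
move=> xs yx; rewrite (simplicial_nbr_deg xs yx) leq_add2r.
have [P satP] := saturated_pairing xs; have [_ _ _ _ dP] := satP.
by rewrite -(dP y yx); apply/subset_leq_card/saturated_nbh.
Qed.

Hypothesis k_gt2 : 2 < k.

Lemma regular_nbh K v : {in cover E, forall u, deg E u = k} -> clique K -> v \in K ->
  exists2 v', v' \notin K & nb v = v' |: K :\ v.
Proof.
move=> regular CK vK; have /clique_copyP [cK aK] := CK.
have subK : K :\ v \subset nb v.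
  by apply/subsetP => u /setD1P[nuv uK]; rewrite in_nbh aK // eq_sym.
have cKv : #|K :\ v| = k.-1 by rewrite -cK (cardsD1 v K) vK.
have /card_gt0P [u /(subsetP subK) uv] : 0 < #|K :\ v| by rewrite cKv -ltnS prednK // ltnW.
have dv : deg E v = k by apply/regular/nbh_cover; rewrite nbhC; exact: uv.
have /card_gt0P [v' /setDP[v'v v'K]] : 0 < #|nb v :\: (K :\ v)|.
  by rewrite cardsDS // -/(deg E v) dv cKv subn_gt0 prednK.
have nv'v : v' != v by apply: contraTneq v'v => ->; rewrite in_nbh adjxx.
have v'K' : v' \notin K by move: v'K; rewrite in_setD1 nv'v.
exists v' => //; apply/esym/eqP; rewrite eqEcard subUset sub1set v'v subK /=.
by rewrite -/(deg E v) dv cardsU1 v'K cKv add1n prednK.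
Qed.

Lemma regular_outer K S v' z : {in cover E, forall u, deg E u = k} ->
  clique K -> v' \notin K -> z \in K -> clique S -> z \in S -> v' \in S ->
  nb z = v' |: K :\ z.
Proof.
move=> regular CK v'K zK /clique_copyP [_ aS] zS v'S.
have [z' z'K nz] := regular_nbh regular CK zK; suff -> : v' = z' by [].
have : v' \in nb z by rewrite in_nbh; apply: aS => //; apply: contraNneq v'K => <-.
by rewrite nz in_setU1 in_setD1 (negPf v'K) andbF orbF => /eqP.
Qed.

Lemma regular_component : {in cover E, forall v, deg E v = k} ->
  exists K x', [/\ clique K, x' \notin K & {in K, forall z, nb z = x' |: K :\ z}].
Proof.
move=> regular; have [K CK] := critical_copy crE; have cK := card_copy_set CK.
have /card_gt0P [x0 x0K] : 0 < #|K| by rewrite cK.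
have [x' x'K nx0] := regular_nbh regular CK x0K; exists K, x'; split=> //.
have [K' [CK' x0K' x'K']] : exists S, [/\ clique S, x0 \in S & x' \in S].
  by apply: (critical_adj crE); rewrite -in_nbh nx0 setU11.
have inK' z : z \in K -> z \in K' -> nb z = x' |: K :\ z.
  by move=> zK zK'; apply: (regular_outer regular CK x'K zK CK').
have sK' : K' \subset x' |: K.
  by apply: subset_trans (clique_sub CK' x0K') _; rewrite nx0 setUCA setD1K.
have K'K : #|(x' |: K) :\: K'| = 1.
  by rewrite cardsDS // cardsU1 x'K cK (card_copy_set CK') addnK.
move=> z zK; have [zK'|zK'] := boolP (z \in K'); first exact: inK'.
(* The outer neighbour of [z] is adjacent to some other vertex of [K], which lies in [K']. *)
have [z' z'K nz] := regular_nbh regular CK zK.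
have [S [CS zS z'S]] : exists S, [/\ clique S, z \in S & z' \in S].
  by apply: (critical_adj crE); rewrite -in_nbh nz setU11.
have [|w [wS nwz nwz']] := @card_gt2_other _ S z z'; first by rewrite (card_copy_set CS).
have wK : w \in K.
  by have := subsetP (clique_sub CS zS) w wS; rewrite nz !inE (negPf nwz) (negPf nwz').
have wK' : w \in K'.
  apply/negPn/negP => wK'; case/eqP: nwz; have /card_le1_eqP := eq_leq K'K.
  by apply; rewrite !inE (wK, zK) (negPf wK', negPf zK') orbT.
have /clique_copyP [_ aS] := CS; have := aS w z' wS z'S nwz'; rewrite -in_nbh inK' //.
by rewrite in_setU1 in_setD1 (negPf z'K) andbF orbF nz => /eqP ->.
Qed.

Lemma regular_clique : {in cover E, forall v, deg E v = k} -> exists K, [/\ clique K,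
  K \subset cover E & forall S z, clique S -> z \in S -> z \in K -> #|K :\: S| <= 1].
Proof.
move=> /regular_component [K [x' [CK x'K nK]]]; exists K; split=> //.
  apply/subsetP => v vK; apply: (@adj_cover _ _ _ x').
  by rewrite -in_nbh nK // setU11.
move=> S z CS zS zK; have sSK : S \subset x' |: K.
  by apply: subset_trans (clique_sub CS zS) _; rewrite nK // setUCA setD1K.
apply: leq_trans (subset_leq_card (setSD S (subsetUr [set x'] K))) _.
by rewrite cardsDS // cardsU1 x'K (card_copy_set CK) (card_copy_set CS) addnK.
Qed.

End CriticalCliques.

Section LargeCliques.
Variables (k : nat) (T : finType) (E : {set {set T}}).
Hypothesis k_gt3 : 3 < k.
Hypotheses (gE : is_graph E) (crE : critical 1 (clique_edges k) E).

Local Notation clique := (copy_set (clique_edges k) E).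
Local Notation nb := (nbh E).
Local Notation simplicial := (simplicial k E).
Implicit Types (P : {set {set T}}) (S Q : {set T}) (u v w x y z : T).

Let k_gt0 : 0 < k. Proof. exact: leq_trans k_gt3. Qed.

Lemma simplicial_nonadj x y : x \in simplicial -> y \in simplicial -> ~~ adj E x y.
Proof.
move=> xs ys; apply/negP => xy.
apply: (critical_no_twins crE isT (adj_neq gE xy) (adj_cover xy)) => S CS.
apply/idP/idP => [xS|yS].
  by rewrite (simplicial_copy k_gt0 gE xs CS xS) in_setU1 in_nbh xy orbT.
by rewrite (simplicial_copy k_gt0 gE ys CS yS) in_setU1 in_nbh adjC xy orbT.
Qed.

Section Partners.
Variable x : T.
Hypothesis xs : x \in simplicial.
Local Notation K := (x |: nb x).

(* [m y] is the partner of the neighbour [y] of [x] in a pairing of the copies avoiding [x]. *)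
Definition partner_map (m : T -> T) : Prop :=
  {in nb x, forall y, m y \in nb y :\: K} /\ {in nb x &, injective m} /\
  {in nb x, forall y, exists S, [/\ clique S, x \notin S, y \in S & m y \in S]}.

Lemma exists_partner_map : exists m, partner_map m.
Proof.
have [P satP] := saturated_pairing k_gt0 gE crE isT xs.
have [/bounded_graphP [gP dP] _ inP _ dK] := satP.
have [m Pm] : exists m, {in nb x, forall y, nbh P y = [set m y]}.
  exists (fun y => odflt y [pick u in nbh P y]) => y /dK /eqP/cards1P [u ->].
  by case: pickP => [u' /set1P ->|/(_ u)]; rewrite ?set11.
have Pym y : y \in nb x -> adj P y (m y) by move=> yx; rewrite -in_nbh Pm ?set11.
exists m; split=> [y yx|]; last split=> [y z yx zx e|y /Pym /inP [S [CS xS]]].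
- by apply: (subsetP (saturated_nbh satP yx)); rewrite Pm ?set11.
- by have /card_le1_eqP := dP (m y); apply; rewrite in_nbh adjC ?Pym // e Pym.
- by rewrite subUset !sub1set => /andP[yS mS]; exists S.
Qed.

Variable m : T -> T.
Hypothesis partner_map_m : partner_map m.

Let mN y : y \in nb x -> m y \in nb y :\: K. Proof. exact: partner_map_m.1. Qed.
Let mI : {in nb x &, injective m}. Proof. exact: partner_map_m.2.1. Qed.

Lemma low_nbr_outer y : y \in nb x -> deg E y = k -> nb y :\: K = [set m y].
Proof.
move=> yx; rewrite (simplicial_nbr_deg k_gt0 gE crE xs) // => dy; apply/esym/eqP.
by rewrite eqEcard sub1set mN // cards1; lia.
Qed.

Lemma low_nbr_partner y z : y \in nb x -> deg E y = k -> z \in nb x -> m y \in nb z :\: K.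
Proof.
move=> yx dy zx; have /setDP[_ myK] := mN yx.
have [S [CS xS yS myS]] := partner_map_m.2.2 y yx; have /clique_copyP [cS aS] := CS.
have nzmy : z != m y by apply: contraNneq myK => <-; rewrite in_setU1 zx orbT.
rewrite in_setD myK in_nbh; apply: aS => //; rewrite -(_ : m y |: nb x = S) ?in_setU1 ?zx ?orbT //.
apply/esym/eqP; rewrite eqEcard cS cardsU1 -/(deg E x).
have /simplicialP [_ ->] := xs.
apply/andP; split; last by rewrite -[leqRHS](prednK k_gt0) -[leqRHS]add1n leq_add2r leq_b1.
apply/subsetP => u uS; have nux : u != x by apply: contraNneq xS => <-.
have := subsetP (clique_sub CS yS) u uS; rewrite !in_setU1 => /predU1P[->|uy].
  by rewrite yx orbT.
have [ux|ux] := boolP (u \in nb x); rewrite ?orbT // orbF.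
by rewrite -in_set1 -low_nbr_outer // in_setD uy in_setU1 negb_or nux ux.
Qed.

Lemma second_nbr_outer y z : y \in nb x -> deg E y = k -> z \in nb x -> z != y ->
  k < deg E z /\ (deg E z = k.+1 -> nb z :\: K = [set m y; m z]).
Proof.
move=> yx dy zx nzy.
have sub : [set m y; m z] \subset nb z :\: K by rewrite subUset !sub1set low_nbr_partner // mN.
have c2 : #|[set m y; m z]| = 2.
  by rewrite cards2; case: eqP => // /(mI yx zx) e; rewrite e eqxx in nzy.
rewrite (simplicial_nbr_deg k_gt0 gE crE xs) //; split=> [|dz];
  first by have := subset_leq_card sub; rewrite c2; lia.
by apply/esym/eqP; rewrite eqEcard sub c2; lia.
Qed.

Lemma second_nbr_partner y z u : y \in nb x -> deg E y = k -> z \in nb x -> deg E z = k.+1 ->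
  z != y -> u \in nb x -> u != y -> m z \in nb u :\: K.
Proof.
move=> yx dy zx dz nzy ux nuy; have [_ /(_ dz) outer_z] := second_nbr_outer yx dy zx nzy.
have /setDP[_ mzK] := mN zx; have /setDP[_ myK] := mN yx.
have [S [CS xS zS mzS]] := partner_map_m.2.2 z zx; have /clique_copyP [cS aS] := CS.
have yS : y \notin S.
  apply/negP => yS; have : m z \in nb y :\: K.
    rewrite in_setD mzK in_nbh; apply: aS => //.
    by apply: contraNneq mzK => <-; rewrite in_setU1 yx orbT.
  by rewrite low_nbr_outer // in_set1 => /eqP /(mI zx yx) e; rewrite e eqxx in nzy.
have nuz : u != m z by apply: contraNneq mzK => <-; rewrite in_setU1 ux orbT.
rewrite in_setD mzK in_nbh; apply: aS => //.
suff <- : m z |: (m y |: nb x :\ y) = S by rewrite !in_setU1 in_setD1 nuy ux !orbT.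
apply/esym/eqP; rewrite eqEcard cS !cardsU1; apply/andP; split; last first.
  have /simplicialP [_] := xs; rewrite /deg (cardsD1 y) yx; move: k_gt0.
  by case: (m z \notin _); case: (m y \notin _); clear; lia.
apply/subsetP => w wS; have nwx : w != x by apply: contraNneq xS => <-.
have nwy : w != y by apply: contraNneq yS => <-.
have := subsetP (clique_sub CS zS) w wS; rewrite !in_setU1 in_setD1 nwy => /predU1P[->|wz].
  by rewrite zx !orbT.
have [wx|wx] := boolP (w \in nb x); rewrite ?orbT // orbF orbC -in_set2 -outer_z.
by rewrite in_setD wz in_setU1 negb_or nwx wx.
Qed.

Lemma third_nbr_deg y z u : y \in nb x -> deg E y = k -> z \in nb x -> deg E z = k.+1 ->
  z != y -> u \in nb x -> u != y -> u != z -> k.+1 < deg E u.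
Proof.
move=> yx dy zx dz nzy ux nuy nuz; rewrite (simplicial_nbr_deg k_gt0 gE crE xs) //.
have : [set m u; m y; m z] \subset nb u :\: K.
  by rewrite !subUset !sub1set mN // low_nbr_partner // (second_nbr_partner yx dy).
have neq v w : v \in nb x -> w \in nb x -> v != w -> m v != m w.
  by move=> vx wx; apply: contra => /eqP /(mI vx wx) ->.
move/subset_leq_card; rewrite -setUA cardsU1 cards2 !inE negb_or.
by rewrite !neq // 1?eq_sym //; clear; lia.
Qed.

End Partners.

Lemma simplicial_nbr_ge x y : x \in simplicial -> y \in nb x -> k <= deg E y.
Proof.
by move=> xs yx; have := simplicial_nbr_deg_ge k_gt0 gE crE isT xs yx; rewrite add1n prednK.
Qed.

Lemma low_nbrs_le1 x : x \in simplicial -> #|[set u in nb x | deg E u <= k]| <= 1.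
Proof.
move=> xs; have [m pm] := exists_partner_map xs; apply/card_le1_eqP => y z.
rewrite ![in _ \in _]inE -!in_nbh => /andP[yx ly] /andP[zx lz].
have dy : deg E y = k by apply/eqP; rewrite eqn_leq ly (simplicial_nbr_ge xs).
apply/eqP/negPn/negP => nzy; have [+ _] := second_nbr_outer xs pm yx dy zx nzy.
by rewrite ltnNge lz.
Qed.

(* The two pairs through [x2] and [x3] can be traded for one pair inside the common
   neighbourhood, which then hits all three copies. *)
Lemma no_three_twins x1 x2 x3 Q : uniq [:: x1; x2; x3] ->
  {in [:: x1; x2; x3], forall x, x \in simplicial /\ nb x = Q} -> False.
Proof.
rewrite /= !inE negb_or andbT => /andP[/andP[n12 n13] n23] twins.
have [[s1 N1] [s2 N2] [s3 N3]] : [/\ x1 \in simplicial /\ nb x1 = Q,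
    x2 \in simplicial /\ nb x2 = Q & x3 \in simplicial /\ nb x3 = Q].
  by split; apply: twins; rewrite !inE eqxx ?orbT.
have [P [bP hP _ nhK _]] := saturated_pairing k_gt0 gE crE isT s1.
have /bounded_graphP [gP dP] := bP.
have mate x : x \in simplicial -> nb x = Q -> x != x1 -> exists2 q, q \in Q & adj P q x.
  move=> xs Nx nx1; have [u [v [uS vS Puv]]] : exists u v,
      [/\ u \in x |: Q, v \in x |: Q & adj P u v].
    apply: hits_adj gP (hP _ _ _); first by rewrite -Nx (simplicial_clique k_gt0 gE crE).
    by rewrite in_setU1 eq_sym (negPf nx1) -N1 in_nbh adjxx.
  have noQ : u \in Q -> v \notin Q.
    move=> uQ; apply: contra nhK => vQ.
    by apply: adj_hits Puv _ _; rewrite N1 in_setU1 (uQ, vQ) orbT.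
  move: uS vS; rewrite !in_setU1 => /predU1P[eu|uQ] /predU1P[ev|vQ].
  - by move: (adj_neq gP Puv); rewrite eu ev eqxx.
  - by exists v; rewrite // adjC -eu.
  - by exists u; rewrite // -ev.
  - by have := noQ uQ; rewrite vQ.
have [|q2 q2Q P2] := mate x2 s2 N2; first by rewrite eq_sym.
have [|q3 q3Q P3] := mate x3 s3 N3; first by rewrite eq_sym.
have alone q x : adj P q x -> x \in [set x2; x3] -> deg (induced P (~: [set x2; x3])) q < 1.
  move=> Pqx xW; rewrite /deg ltnS leqn0 cards_eq0; apply/eqP/setP => u.
  rewrite in_nbh adj_induced in_set0; apply/negP => /and3P[Pqu _]; rewrite in_setC => /negP; apply.
  by have /card_le1_eqP /(_ x u) -> := dP q; rewrite ?in_nbh.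
apply: (no_exchange crE bP hP (y := q2) (z := q3) _ _ (alone _ _ P2 _) (alone _ _ P3 _)).
- apply: contraNneq n23 => e; have /card_le1_eqP := dP q2; move/(_ x3 x2) => ->; rewrite ?in_nbh //.
  by rewrite e.
- move=> S w CS wS wx; suff -> : S = w |: Q by rewrite !in_setU1 q2Q q3Q !orbT.
  have [ws Nw] : w \in simplicial /\ nb w = Q by apply: twins; move: wx; rewrite !inE.
  by rewrite (simplicial_copy k_gt0 gE ws CS wS) Nw.
- exact: set21.
- exact: set22.
Qed.

Lemma many_simplicial_nbrs y : 2 < #|nb y :&: simplicial| ->
  #|nb y :&: simplicial| + k.-1 <= deg E y.
Proof.
move=> t3; rewrite leqNgt; apply/negP => lt.
have twin x : x \in nb y :&: simplicial -> x \in simplicial /\ nb x = y |: nb y :\: simplicial.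
  case/setIP => xy xs; split=> //; have /simplicialP [_ dx] := xs.
  have yx : y \in nb x by rewrite nbhC.
  rewrite -(setD1K yx); congr (_ |: _); apply/eqP; rewrite eqEcard; apply/andP; split.
    apply/subsetP => u /setD1P[nuy ux]; rewrite in_setD in_nbh (simplicial_adj k_gt0 gE crE xs) //.
      by rewrite andbT; apply: contraL ux => us; rewrite in_nbh simplicial_nonadj.
    by rewrite eq_sym.
  by move: dx lt; rewrite /deg -(cardsID simplicial (nb y)) (cardsD1 y (nb x)) yx; lia.
have /card_gt2P [x1 [x2 [x3 [[p1 p2 p3] [n12 n23 n31]]]]] := t3.
apply: (@no_three_twins x1 x2 x3 (y |: nb y :\: simplicial)).
  by rewrite /= !inE negb_or n12 eq_sym n31 n23.
by move=> x; rewrite !in_cons orbF => /or3P[] /eqP ->; apply: twin.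
Qed.

Definition simplicial_sends u v : bool := [&& adj E u v, u \in simplicial & k < deg E v].

Lemma simplicial_receives v :
  [set u | simplicial_sends u v] = if k < deg E v then nb v :&: simplicial else set0.
Proof.
apply/setP => u; rewrite inE /simplicial_sends adjC.
by case: ifP; rewrite ?in_setI ?in_nbh ?andbT ?andbF ?in_set0.
Qed.

Lemma simplicial_sent v : [set u | simplicial_sends v u] =
  if v \in simplicial then [set u in nb v | k < deg E u] else set0.
Proof. by apply/setP => u; rewrite inE /simplicial_sends; case: ifP; rewrite ?inE ?andbF. Qed.

Lemma high_not_simplicial v : k < deg E v -> v \notin simplicial.
Proof. by apply: contraL => /simplicialP [_ ->]; lia. Qed.

Lemma high_charge v : k < deg E v -> 2 * k + #|nb v :&: simplicial| <= 2 * deg E v ?=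
  iff ((deg E v == k.+1) && (#|nb v :&: simplicial| == 2)).
Proof.
have := @many_simplicial_nbrs v; move: (deg E v) #|_| k_gt3 => d t k4 many kd.
by apply/leqifP; case: (d =P k.+1) => ?; case: (t =P 2) => ? /=; lia.
Qed.

Lemma simplicial_nbrs_split x :
  #|[set u in nb x | deg E u <= k]| + #|[set u in nb x | k < deg E u]| = deg E x.
Proof.
rewrite /deg -[RHS](cardsID [set u | #|nb u| <= k] (nb x)); congr (_ + _); apply: eq_card => u.
  by rewrite !inE.
by rewrite !inE -ltnNge andbC.
Qed.

Lemma simplicial_charge v : v \in cover E ->
  2 * k + #|[set u | simplicial_sends u v]| <= 2 * deg E v + #|[set u | simplicial_sends v u]|.
Proof.
move=> vE; rewrite simplicial_receives simplicial_sent; case: ltnP => [hi|lo].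
  by rewrite (negPf (high_not_simplicial hi)) cards0 addn0 high_charge.
rewrite cards0 addn0; case: ifPn => [vs|nvs].
  have /simplicialP [_ dv] := vs.
  by have := low_nbrs_le1 vs; have := simplicial_nbrs_split v; rewrite dv; lia.
have := clique_deg k_gt0 gE crE vE; move: nvs; rewrite inE vE cards0 /=.
by move: (deg E v) lo; lia.
Qed.

Hypothesis tight : {in cover E, forall v,
  2 * k + #|[set u | simplicial_sends u v]| = 2 * deg E v + #|[set u | simplicial_sends v u]|}.

Lemma tight_high_deg v : k < deg E v -> deg E v = k.+1 /\ #|nb v :&: simplicial| = 2.
Proof.
move=> hi; have vE : v \in cover E by rewrite in_cover_deg //; lia.
have := tight vE; rewrite simplicial_receives simplicial_sent hi.
rewrite (negPf (high_not_simplicial hi)) cards0 addn0 => /eqP.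
by rewrite high_charge // => /andP[/eqP -> /eqP].
Qed.

Lemma tight_not_simplicial x : x \notin simplicial.
Proof.
apply/negP => xs; have /simplicialP [xE dx] := xs; have [m pm] := exists_partner_map xs.
have := tight xE; rewrite simplicial_receives simplicial_sent xs ltnNge dx leq_pred cards0 /=.
have := low_nbrs_le1 xs; have := simplicial_nbrs_split x; rewrite dx => sum_nbrs low1 hi2.
have /card_gt1P [z [u [zh uh nzu]]] : 1 < #|[set u in nb x | k < deg E u]| by lia.
have /card_gt0P [y yl] : 0 < #|[set u in nb x | deg E u <= k]| by lia.
move: zh uh yl; rewrite ![in _ \in _]inE -!in_nbh => /andP[zx hz] /andP[ux hu] /andP[yx ly].
have dy : deg E y = k by apply/eqP; rewrite eqn_leq ly (simplicial_nbr_ge xs).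
have n_y w : k < deg E w -> w != y by apply: contraTneq => ->; rewrite dy ltnn.
have [dz _] := tight_high_deg hz; have [du _] := tight_high_deg hu.
have := third_nbr_deg xs pm yx dy zx dz (n_y z hz) ux (n_y u hu).
by rewrite eq_sym nzu du ltnn => /(_ isT).
Qed.

Lemma tight_regular : {in cover E, forall v, deg E v = k}.
Proof.
move=> v vE; have := clique_deg k_gt0 gE crE vE.
have := tight_not_simplicial v; rewrite inE vE /=.
have := tight_high_deg (v := v); rewrite (_ : nb v :&: simplicial = set0) ?cards0.
  by move: (deg E v) => d; lia.
by apply/setP => u; rewrite in_setI in_set0 (negPf (tight_not_simplicial u)) andbF.
Qed.

End LargeCliques.

Lemma large_clique_irregular k (T : finType) (E : {set {set T}}) : 3 < k -> is_graph E ->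
  critical 1 (clique_edges k) E -> ~ {in cover E, forall v, deg E v = k}.
Proof.
move=> k4 gE crE regular; have [K [CK sKE near]] :=
  regular_clique (leq_trans (isT : 0 < 4) k4) gE crE (ltnW k4) regular.
have cK := card_copy_set CK.
have [a [c [d [e [uK sK]]]]] : exists a c d e, uniq [:: a; c; d; e] /\
    {subset [:: a; c; d; e] <= K}.
  have := take_uniq 4 (enum_uniq K); have : {subset take 4 (enum K) <= K}.
    by move=> z /mem_take; rewrite mem_enum.
  have : size (take 4 (enum K)) = 4 by rewrite size_takel // -cardE cK.
  by case: (take _ _) => [|a [|c [|d [|e []]]]] // _ sK uK; exists a, c, d, e.
apply: (@critical_no_two_pairs _ _ _ _ _ crE isT a c d e uK).
  by apply/(subsetP sKE)/sK/mem_head.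
move=> S CS meetS; have [z zS zK] : exists2 z, z \in S & z \in K.
  have inK z : z \in [:: a; c; d; e] -> z \in S -> exists2 z, z \in S & z \in K.
    by move=> /sK zK zS; exists z.
  by case/or4P: meetS; apply: inK; rewrite !inE eqxx ?orbT.
have two w w' : w \in [:: a; c; d; e] -> w' \in [:: a; c; d; e] -> w != w' ->
    (w \in S) || (w' \in S).
  move=> /sK wK /sK w'K; apply: contraNT; rewrite negb_or => /andP[wS w'S].
  by have /card_le1_eqP /(_ w' w) -> := near S z CS zS zK; rewrite ?in_setD ?wS ?w'S.
move: uK; rewrite /= !inE !negb_or andbT => /and3P[/and3P[nac nad nae] /andP[ncd nce] nde].
have := two a d; have := two a e; have := two c d; have := two c e.
rewrite !inE !eqxx !orbT nad nae ncd nce => /(_ isT isT isT) + /(_ isT isT isT).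
move=> + + /(_ isT isT isT) + /(_ isT isT isT).
by case: (a \in S); case: (c \in S); case: (d \in S); case: (e \in S).
Qed.

Lemma large_clique_dense k (T : finType) (E : {set {set T}}) : 3 < k -> is_graph E ->
  critical 1 (clique_edges k) E -> k * #|cover E| < 2 * #|E|.
Proof.
move=> k4 gE crE.
have [|//|tight] :=
  graph_discharging gE (sends := simplicial_sends k E) _ (simplicial_charge k4 gE crE).
  by move=> u v /and3P[].
by case: (large_clique_irregular k4 gE crE); apply: tight_regular.
Qed.

Section Triangles.
Variables (T : finType) (E : {set {set T}}).
Hypotheses (gE : is_graph E) (crE : critical 2 (clique_edges 3) E).

Local Notation triangle := (copy_set (clique_edges 3) E).
Local Notation nb := (nbh E).
Local Notation simplicial := (simplicial 3 E).
Implicit Types (P : {set {set T}}) (S K : {set T}) (u v w x y z : T).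

Let k_gt0 : 0 < 3. Proof. by []. Qed.

Lemma triangle_apex x v : x \in simplicial -> v \in nb x ->
  exists u, [/\ nb x = [set v; u], u \notin simplicial, adj E v u & 3 < deg E u].
Proof.
move=> xs vx; have /simplicialP [_ dx] := xs.
have [u nx nvu] := card2_split dx vx; have ux : u \in nb x by rewrite nx set22.
have du : 3 < deg E u := simplicial_nbr_deg_ge k_gt0 gE crE isT xs ux.
exists u; split=> //; last exact: (simplicial_adj k_gt0 gE crE xs).
by apply: contraL du => /simplicialP [_ ->].
Qed.

Lemma simplicial_nbr_notin x y : x \in simplicial -> y \in nb x -> y \notin simplicial.
Proof.
move=> xs yx; have := simplicial_nbr_deg_ge k_gt0 gE crE isT xs yx.
by apply: contraL => /simplicialP [_ ->].
Qed.

Definition weak : {set T} := [set v | (deg E v == 4) && (2 < #|nb v :&: simplicial|)].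

Definition weak_apex y u : Prop :=
  [/\ u \notin simplicial, nb y = u |: nb y :&: simplicial &
      {in nb y :&: simplicial, forall x, nb x = [set y; u]}].

Lemma weakP y : reflect (deg E y = 4 /\ 2 < #|nb y :&: simplicial|) (y \in weak).
Proof. by rewrite inE; apply: (iffP andP) => -[/eqP]. Qed.

Lemma weak_not_simplicial y : y \in weak -> y \notin simplicial.
Proof. by move=> /weakP [d4 _]; apply/negP => /simplicialP [_]; rewrite d4. Qed.

Lemma exists_weak_apex y : y \in weak -> exists u, weak_apex y u.
Proof.
move=> /weakP [d4 t3]; have /card_gt0P [x /setIP[xy xs]] := ltnW (ltnW t3).
have yx : y \in nb x by rewrite nbhC.
have [u [nx us yu du]] := triangle_apex xs yx.
have ny : nb y = u |: nb y :&: simplicial.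
  apply/esym/eqP; rewrite eqEcard subUset sub1set in_nbh yu subsetIl -/(deg E y) d4 cardsU1.
  by rewrite in_setI (negPf us) andbF.
exists u; split=> // x' /setIP[x'y x's]; rewrite nbhC in x'y.
have [u' [nx' u's yu' _]] := triangle_apex x's x'y.
move: yu'; rewrite -in_nbh ny in_setU1 in_setI (negPf u's) andbF orbF => /eqP eu.
by rewrite nx' eu.
Qed.

(* If the pairing spared [u] with respect to the three triangles at [y], these would
   already give [u] six neighbours; otherwise one pair [y, u] could hit all of them. *)
Lemma weak_apex_deg y u : y \in weak -> weak_apex y u -> 5 < deg E u.
Proof.
move=> /weakP [d4 t3] [us ny nx]; set W := nb y :&: simplicial in t3 ny nx *.
have /card_gt0P [x xW] := ltnW (ltnW t3); have /setIP[xy xs] := xW.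
have yu : adj E y u by rewrite -in_nbh ny setU11.
have [P satP] := saturated_pairing k_gt0 gE crE isT xs; have [bP hP _ _ dP] := satP.
have [yx ux] : y \in nb x /\ u \in nb x by rewrite nx // set21 set22.
have Py : nbh P y \subset W.
  apply/subsetP => w /(subsetP (saturated_nbh satP yx)) /setDP[].
  by rewrite {1}ny => /setU1P[->|//]; rewrite nx // !inE eqxx !orbT.
have Pu := saturated_nbh satP ux.
have [/pred0P dW|/pred0Pn [w /= /andP[wPu wW]]] := boolP [disjoint nbh P u & W].
  have sub : nbh P u :|: (y |: W) \subset nb u.
    rewrite !subUset sub1set nbhC in_nbh yu (subset_trans Pu (subsetDl _ _)) /=.
    by apply/subsetP => w wW; rewrite nbhC nx // set22.
  have ynPu : y \notin nbh P u by apply/negP => /(subsetP Pu); rewrite inE nx // !inE eqxx orbT.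
  apply: leq_trans (subset_leq_card sub); rewrite cardsU cardsU1 -/(deg P u) dP //.
  rewrite disjoint_setI0; last first.
    apply/pred0P => w /=; rewrite in_setU1.
    by have [->|_] := eqVneq w y; [rewrite (negPf ynPu)|exact: dW].
  by rewrite in_setI in_nbh adjxx // cards0; move: t3; rewrite -/W; case: #|W| => [|[|[|]]].
case: (no_exchange crE bP hP (adj_neq gE yu) (W := W)).
- move=> S v CS vS vxW; have vW : v \in W by case/setU1P: vxW => [->|].
  have /setIP[_ vs] := vW; rewrite (simplicial_copy k_gt0 gE vs CS vS) nx //.
  by rewrite !inE !eqxx !orbT.
- rewrite /deg (_ : nbh _ y = set0) ?cards0 //; apply/setP => v.
  rewrite in_nbh adj_induced -in_nbh in_set0; apply/negP => /and3P[/(subsetP Py) vW _].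
  by rewrite inE vW.
have /bounded_graphP [_ /(_ u)] := bP; rewrite {1}/deg (cardsD1 w) wPu => le1.
apply: leq_trans le1; rewrite ltnS; apply/subset_leq_card/subsetP => v; rewrite in_nbh adj_induced.
by rewrite in_setD1 in_nbh => /and3P[-> _]; rewrite inE andbT; apply: contraNneq => ->.
Qed.

Section WeakNeighbours.
Variable v : T.
Hypothesis vs : v \notin simplicial.

Lemma weak_nbr_apex c : c \in nb v -> c \in weak -> weak_apex c v.
Proof.
move=> cv cw; have [u au] := exists_weak_apex cw; have [us nc nx] := au.
have : v \in nb c by rewrite nbhC.
by rewrite nc in_setU1 in_setI (negPf vs) andbF orbF => /eqP ->.
Qed.

Lemma weak_nbr_block c : c \in nb v -> c \in weak ->
  #|c |: nb c :&: simplicial| = 4 /\ c |: nb c :&: simplicial \subset nb v.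
Proof.
move=> cv cw; have [_ nc nx] := weak_nbr_apex cv cw; have /weakP [d4 _] := cw; split.
  rewrite cardsU1 in_setI in_nbh adjxx // -d4 /deg {2}nc cardsU1 in_setI (negPf vs) andbF.
  by [].
rewrite subUset sub1set cv; apply/subsetP => x xc; rewrite nbhC nx //; exact: set22.
Qed.

Lemma weak_nbr_uniq c c' : deg E v < 8 -> c \in nb v -> c \in weak -> c' \in nb v -> c' \in weak ->
  c = c'.
Proof.
move=> d8 cv cw c'v c'w; apply/eqP; apply: contraLR d8 => ncc'; rewrite -leqNgt.
have [card_c sub_c] := weak_nbr_block cv cw; have [card_c' sub_c'] := weak_nbr_block c'v c'w.
have [_ _ nx] := weak_nbr_apex cv cw; have [_ _ nx'] := weak_nbr_apex c'v c'w.
have notin d x : d \in weak -> x \in simplicial -> d != x.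
  by move=> /weak_not_simplicial ds xs; apply: contraNneq ds => ->.
have /andP := conj sub_c sub_c'; rewrite -subUset => /subset_leq_card; apply: leq_trans.
rewrite cardsU card_c card_c' disjoint_setI0 ?cards0 //; apply/pred0P => x /=; apply/negP.
move=> /andP[/setU1P[->|xc] /setU1P[exc|xc']].
- by rewrite exc eqxx in ncc'.
- by have /setIP[_ cs] := xc'; have := notin c c cw cs; rewrite eqxx.
- by have /setIP[_ xs] := xc; have := notin c' x c'w xs; rewrite exc eqxx.
have /setP /(_ c) := nx x xc; rewrite nx' // !inE eqxx (negPf ncc') /= => /eqP ecv.
by move: cv; rewrite ecv in_nbh adjxx.
Qed.

Lemma simplicial_weak_nbh_deg : deg E v < 8 -> nb v \subset simplicial :|: weak -> deg E v <= 4.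
Proof.
move=> d8 /subsetP sub.
have apex a : a \in nb v -> a \in simplicial ->
    exists c, [/\ c \in nb v, c \in weak & a \in nb c].
  move=> av as_; have va : v \in nb a by rewrite nbhC.
  have [c [na cs vc _]] := triangle_apex as_ va; exists c; rewrite in_nbh vc nbhC na set22.
  by split=> //; have := sub c; rewrite in_nbh vc in_setU (negPf cs) => /(_ isT).
have [v0|/set0Pn [a av]] := eqVneq (nb v) set0; first by rewrite /deg v0 cards0.
have [c cv cw] : exists2 c, c \in nb v & c \in weak.
  by have /setUP [/(apex a av) [c [cv cw _]]|aw] := sub a av; [exists c|exists a].
have [<- _] := weak_nbr_block cv cw; apply/subset_leq_card/subsetP => x xv.
have /setUP [xs|xw] := sub x xv; last by rewrite (weak_nbr_uniq d8 xv xw cv cw) setU11.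
have [c' [c'v c'w xc']] := apex x xv xs.
by rewrite in_setU1 in_setI xs andbT (weak_nbr_uniq d8 cv cw c'v c'w) xc' orbT.
Qed.

End WeakNeighbours.

Definition triangle_sends u v : bool :=
  adj E u v && ((u \in simplicial) || (u \in weak) && (v \notin simplicial)).

Lemma triangle_receives_simplicial v :
  v \in simplicial -> [set u | triangle_sends u v] = set0.
Proof.
move=> vs; apply/setP => u; rewrite inE in_set0 /triangle_sends vs andbF orbF.
by apply/negP => /andP[uv us]; have := simplicial_nbr_notin us (y := v);
  rewrite in_nbh vs => /(_ uv).
Qed.

Lemma triangle_receives v : v \notin simplicial ->
  [set u | triangle_sends u v] = nb v :&: (simplicial :|: weak).
Proof.
by move=> vs; apply/setP => u; rewrite inE in_setI in_setU nbhC in_nbh /triangle_sends vs andbT.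
Qed.

Lemma triangle_sent_simplicial v : v \in simplicial -> [set u | triangle_sends v u] = nb v.
Proof. by move=> vs; apply/setP => u; rewrite inE in_nbh /triangle_sends vs andbT. Qed.

Lemma triangle_sent_weak v : v \in weak -> #|[set u | triangle_sends v u]| = 1.
Proof.
move=> vw; have [w [ws nv _]] := exists_weak_apex vw.
rewrite -(cards1 w); apply: eq_card => u; rewrite [LHS]inE in_set1 /triangle_sends.
rewrite (negPf (weak_not_simplicial vw)) vw /= -in_nbh nv in_setU1 in_setI.
by have [->|_] := eqVneq u w; rewrite ?ws //=; case: (u \in simplicial); rewrite ?andbF.
Qed.

Lemma triangle_sent v :
  v \notin simplicial -> v \notin weak -> [set u | triangle_sends v u] = set0.
Proof.
by move=> vs vw; apply/setP => u; rewrite inE in_set0 /triangle_sends (negPf vs) (negPf vw) andbF.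
Qed.

Lemma simplicial_nbrs v : 0 < #|nb v :&: simplicial| ->
  3 < deg E v /\ #|nb v :&: simplicial| < deg E v.
Proof.
move=> /card_gt0P [x /setIP[xv xs]]; have vx : v \in nb x by rewrite nbhC.
split; first exact: (simplicial_nbr_deg_ge k_gt0 gE crE isT xs vx).
have [u [_ us vu _]] := triangle_apex xs vx; apply: proper_card; apply/properP.
by split; [exact: subsetIl|exists u; rewrite ?in_nbh // in_setI (negPf us) andbF].
Qed.

Lemma low_receives v : v \notin simplicial -> deg E v <= 5 ->
  nb v :&: (simplicial :|: weak) = nb v :&: simplicial.
Proof.
move=> vs d5; rewrite setIUr; apply/setUidPl/subsetP => y /setIP[yv yw].
by have := weak_apex_deg yw (weak_nbr_apex vs yv yw); rewrite ltnNge d5.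
Qed.

Lemma triangle_charge v : v \in cover E ->
  2 * 3 + #|[set u | triangle_sends u v]| <= 2 * deg E v + #|[set u | triangle_sends v u]|.
Proof.
move=> vE; have [vs|vs] := boolP (v \in simplicial).
  have /simplicialP [_ dv] := vs.
  by rewrite triangle_receives_simplicial // triangle_sent_simplicial // -/(deg E v) dv cards0.
have d3 : 2 < deg E v.
  by rewrite ltn_neqAle eq_sym (clique_deg k_gt0 gE crE vE) andbT; move: vs; rewrite inE vE.
rewrite triangle_receives //; have [d6|d5] := ltnP 5 (deg E v).
  have : #|nb v :&: (simplicial :|: weak)| <= deg E v by apply/subset_leq_card/subsetIl.
  by move: #|_| #|_| (deg E v) d6; clear; lia.
rewrite low_receives //; have nbrs := simplicial_nbrs (v := v).
have [vw|vw] := boolP (v \in weak).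
  rewrite triangle_sent_weak //; have /weakP [d4 t3] := vw.
  by move: nbrs; rewrite d4; move: #|_| t3; clear; lia.
rewrite triangle_sent // cards0 addn0; move: vw nbrs; rewrite inE.
by move: #|_| (deg E v) d3 d5; clear; lia.
Qed.

Section Tight.
Hypothesis tight : {in cover E, forall v, 2 * 3 + #|[set u | triangle_sends u v]| =
  2 * deg E v + #|[set u | triangle_sends v u]|}.

Lemma tight_deg_le5 v : v \in cover E -> deg E v <= 5.
Proof.
move=> vE; rewrite leqNgt; apply/negP => d6.
have vs : v \notin simplicial by apply/negP => /simplicialP [_ d2]; rewrite d2 in d6.
have vw : v \notin weak by apply/negP => /weakP [d4 _]; rewrite d4 in d6.
have := tight vE; rewrite triangle_receives // triangle_sent // cards0 addn0 => tv.
have le : #|nb v :&: (simplicial :|: weak)| <= deg E v by apply/subset_leq_card/subsetIl.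
have e6 : deg E v = 6 by move: #|_| (deg E v) d6 tv le; clear; lia.
have : deg E v <= 4; last by rewrite e6.
apply: simplicial_weak_nbh_deg => //; first by rewrite e6.
apply/setIidPl/eqP; rewrite eqEcard subsetIl -/(deg E v).
by rewrite e6 in tv *; move: #|_| tv; clear; lia.
Qed.

Lemma tight_not_weak v : v \notin weak.
Proof.
apply/negP => vw; have [u au] := exists_weak_apex vw; have [_ nv _] := au.
have uE : u \in cover E by apply: (nbh_cover (u := v)); rewrite nv setU11.
by have := weak_apex_deg vw au; rewrite ltnNge tight_deg_le5.
Qed.

Lemma tight_shape v : v \in cover E -> v \notin simplicial ->
  deg E v = 3 \/ [/\ 3 < deg E v, #|nb v :\: simplicial| <= 2 & 0 < #|nb v :&: simplicial|].
Proof.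
move=> vE vs; have := tight vE; rewrite triangle_receives // triangle_sent ?tight_not_weak //.
rewrite cards0 addn0 low_receives ?tight_deg_le5 //.
have := cardsID simplicial (nb v); have := tight_deg_le5 vE; have := clique_deg k_gt0 gE crE vE.
rewrite -/(deg E v); move: #|_| (deg E v) #|_ :\: _|; clear => t d s ge2 le5 sum charge.
by have [->|ne3] := eqVneq d 3; [left|right; split; lia].
Qed.

(* The edges between non-simplicial vertices of degree at least four form a pairing of all
   triangles that contain such a vertex or a simplicial one. *)
Definition high : {set T} := [set v in cover E | (v \notin simplicial) && (3 < deg E v)].

Lemma highP v : v \in high -> [/\ v \in cover E, v \notin simplicial & 3 < deg E v].
Proof. by rewrite inE => /and3P[]. Qed.

Lemma bounded_high : bounded_graph 2 (induced E high).
Proof.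
apply/bounded_graphP; split=> [|v]; first exact: is_graphS (inducedS _ _) gE.
have [vh|vh] := boolP (v \in high); last first.
  rewrite /deg nbh_notin_cover ?cards0 //; apply: contra vh; exact/subsetP/cover_induced.
have [vE vs d4] := highP vh; have [d3|[_ c2 _]] := tight_shape vE vs; first by rewrite d3 in d4.
apply: leq_trans c2; apply/subset_leq_card/subsetP => u; rewrite in_nbh adj_induced.
by move=> /and3P[vu _ /highP [_ us _]]; rewrite in_setD us in_nbh.
Qed.

Lemma apex_high x v : x \in simplicial -> v \in nb x -> v \in high.
Proof.
move=> xs vx; rewrite inE (nbh_cover vx) (simplicial_nbr_notin xs vx).
exact: (simplicial_nbr_deg_ge k_gt0 gE crE isT xs vx).
Qed.

Lemma simplicial_hit S x : triangle S -> x \in S -> x \in simplicial -> hits (induced E high) S.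
Proof.
move=> CS xS xs; rewrite (simplicial_copy k_gt0 gE xs CS xS).
have /card_gt0P [v vx] : 0 < deg E x by have /simplicialP [_ ->] := xs.
have [u [nx us vu _]] := triangle_apex xs vx; have ux : u \in nb x by rewrite nx set22.
apply: (@adj_hits _ _ _ v u); rewrite ?in_setU1 ?vx ?ux ?orbT //.
by rewrite adj_induced vu !(apex_high xs).
Qed.

Lemma high_hit S v : triangle S -> v \in S -> v \in high -> hits (induced E high) S.
Proof.
move=> CS vS vh; have [[x xS xs]|noS] : (exists2 x, x \in S & x \in simplicial) \/
    [disjoint S & simplicial].
- have [|/pred0Pn [x /andP[xS xs]]] := boolP [disjoint S & simplicial]; first by right.
  by left; exists x.
- exact: simplicial_hit xS xs.
have [vE vs d4] := highP vh.
have [d3|[_ c2 /card_gt0P [x /setIP[xv xs]]]] := tight_shape vE vs; first by rewrite d3 in d4.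
have vx : v \in nb x by rewrite nbhC.
have [u [nx us vu du]] := triangle_apex xs vx.
have SE : S :\ v = nb v :\: simplicial.
  apply/eqP; rewrite eqEcard; apply/andP; split.
    apply/subsetP => w /setD1P[nwv wS]; rewrite in_setD (disjointFr noS wS).
    by have := subsetP (clique_sub CS vS) w wS; rewrite in_setU1 (negPf nwv).
  by apply: leq_trans c2 _; have := card_copy_set CS; rewrite (cardsD1 v) vS add1n => -[->].
have uS : u \in S.
  by have /setD1P [] : u \in S :\ v by rewrite SE in_setD us in_nbh.
apply: (@adj_hits _ _ _ v u); rewrite // adj_induced vu vh.
by rewrite (apex_high xs) // nx set22.
Qed.

Lemma tight_cubic : {in cover E, forall v, deg E v = 3}.
Proof.
have no_simplicial x : x \notin simplicial.
  apply/negP => xs; have /simplicialP [xE _] := xs.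
  apply: (no_local_pairing crE (X := simplicial :|: high)) xE bounded_high _ _.
  - by rewrite in_setU xs.
  - by apply: subset_trans (cover_induced _ _) (subsetUr _ _).
  by move=> S y CS yS /setUP[ys|yh]; [exact: simplicial_hit yS ys|exact: high_hit yS yh].
move=> v vE; have [//|[_ _ /card_gt0P [x /setIP[_ xs]]]] := tight_shape vE (no_simplicial v).
by have := no_simplicial x; rewrite xs.
Qed.

End Tight.

(* The complete graph on the triangle of [regular_clique] is a local pairing. *)
Lemma triangle_irregular : ~ {in cover E, forall v, deg E v = 3}.
Proof.
move=> cubic; have [K [CK sKE near]] := regular_clique k_gt0 gE crE isT cubic.
have /clique_copyP [cK aK] := CK; have /card_gt0P [x xK] : 0 < #|K| by rewrite cK.
apply: (no_local_pairing crE xK (subsetP sKE x xK) (P := induced E K)); last 2 first.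
- exact: cover_induced.
- move=> S z CS zS zK; have /card_gt1P [u [v [/setIP[uK uS] /setIP[vK vS] nuv]]] : 1 < #|K :&: S|.
    by have := near S z CS zS zK; have := cardsID S K; rewrite cK; clear; lia.
  by apply: (@adj_hits _ _ _ u v); rewrite // adj_induced aK ?uK.
apply/bounded_graphP; split=> [|v]; first exact: is_graphS (inducedS _ _) gE.
have [vK|vK] := boolP (v \in K); last first.
  by rewrite /deg nbh_notin_cover ?cards0 //; apply: contra vK; apply/subsetP/cover_induced.
have : #|K :\ v| = 2 by move: cK; rewrite (cardsD1 v) vK add1n => -[].
move=> <-; apply/subset_leq_card/subsetP => u; rewrite in_nbh adj_induced in_setD1.
by move=> /and3P[vu _ ->]; rewrite eq_sym (adj_neq gE vu).
Qed.

Lemma triangle_dense : 3 * #|cover E| < 2 * #|E|.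
Proof.
have [|//|tight] := graph_discharging gE (sends := triangle_sends) _ triangle_charge.
  by move=> u v /andP[].
by case: triangle_irregular; apply: tight_cubic.
Qed.

End Triangles.

(** * Cycles *)

Section Cycle.
Variable k : nat.
Hypothesis k_gt2 : 2 < k.

Lemma ordS_neq (i : 'I_k) : ordS i != i.
Proof.
rewrite -val_eqE /=; have ik := ltn_ord i; have [lt|ge] := ltnP i.+1 k.
  by rewrite modn_small //; lia.
by have -> : i.+1 = k; [lia|rewrite modnn; lia].
Qed.

Lemma ordS2_neq (i : 'I_k) : ordS (ordS i) != i.
Proof.
rewrite -val_eqE /=; have ik := ltn_ord i; have [lt|ge] := ltnP i.+1 k; last first.
  by have -> : i.+1 = k; [lia|rewrite modnn modn_small; lia].
rewrite (modn_small lt); have [lt2|ge2] := ltnP i.+2 k; first by rewrite modn_small //; lia.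
by have -> : i.+2 = k; [lia|rewrite modnn; lia].
Qed.

Lemma cycle_edge_inj : injective (fun i : 'I_k => [set i; ordS i]).
Proof.
move=> i j /setP eij; have := eij i; have := eij j; rewrite !inE !eqxx /=.
move=> /orP[/eqP //|/eqP ej] /esym /orP[/eqP //|/eqP ei].
by move: (ordS2_neq i); rewrite -ej -ei eqxx.
Qed.

Lemma card_cycle_edges : #|cycle_edges k| = k.
Proof. by rewrite card_imset ?card_ord //; apply: cycle_edge_inj. Qed.

Lemma is_graph_cycle : is_graph (cycle_edges k).
Proof. by apply/forall_inP => _ /imsetP [i _ ->]; rewrite cards2 (eq_sym i) ordS_neq. Qed.

Lemma adj_ordS (i : 'I_k) : adj (cycle_edges k) i (ordS i).
Proof. exact: imset_f. Qed.

Lemma cycle_deg (i : 'I_k) : 1 < deg (cycle_edges k) i.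
Proof.
apply/card_gt1P; exists (ordS i), (ord_pred i); split.
- by rewrite in_nbh adj_ordS.
- by rewrite nbhC in_nbh -{2}(ord_predK i) adj_ordS.
by apply/eqP => e; have := ordS2_neq (ord_pred i); rewrite ord_predK e eqxx.
Qed.

End Cycle.

Lemma four_cycle_copy (T : finType) (E : {set {set T}}) S v :
  copy_set (cycle_edges 4) E S -> v \in S -> exists p w q,
  [/\ S = [set v; p; w; q], uniq [:: v; p; w; q], adj E v p, adj E p w & adj E w q /\ adj E q v].
Proof.
move=> /copy_setP [f /embedsP [fi /copy_edges_subP fE] ->] /imsetP [i _ ->].
have fadj j : adj E (f j) (f (ordS j)) by rewrite /adj -imset_pair; apply/fE/imset_f.
have us : uniq [:: i; ordS i; ordS (ordS i); ordS (ordS (ordS i))].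
  by move: i => [[|[|[|[|]]]] ?].
have i4 : ordS (ordS (ordS (ordS i))) = i.
  by apply/val_inj; move: i {us} => [[|[|[|[|]]]] ?].
exists (f (ordS i)), (f (ordS (ordS i))), (f (ordS (ordS (ordS i)))); split=> //.
- have -> : [set: 'I_4] = [set i; ordS i; ordS (ordS i); ordS (ordS (ordS i))].
    apply/esym/eqP; rewrite eqEcard subsetT cardsT card_ord.
    suff -> : [set i; ordS i; ordS (ordS i); ordS (ordS (ordS i))] =
        [set j in [:: i; ordS i; ordS (ordS i); ordS (ordS (ordS i))]].
      by rewrite cardsE (card_uniqP us).
    by apply/setP => j; rewrite !inE -!orbA.
  by rewrite !imsetU !imset_set1.
- by rewrite -[[:: _; _; _; _]]/(map f
    [:: i; ordS i; ordS (ordS i); ordS (ordS (ordS i))]) map_inj_uniq.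
- by split=> //; have := fadj (ordS (ordS (ordS i))); rewrite i4.
Qed.

(** * Four-cycles *)

Lemma nbh_enum (T : finType) (E : {set {set T}}) v (s : seq T) :
  deg E v = size s -> all (adj E v) s -> uniq s -> nbh E v =i s.
Proof.
move=> dv /allP vs us u; apply/idP/idP => [|/vs]; last by rewrite in_nbh.
suff -> : nbh E v = [set w in s] by rewrite inE.
apply/esym/eqP; rewrite eqEcard -/(deg E v) dv cardsE (card_uniqP us) leqnn andbT.
by apply/subsetP => w; rewrite inE in_nbh => /vs.
Qed.

Lemma nbh3 (T : finType) (E : {set {set T}}) v a c d : deg E v = 3 ->
  adj E v a -> adj E v c -> adj E v d -> uniq [:: a; c; d] -> nbh E v = [set a; c; d].
Proof.
move=> d3 va vc vd us; apply/setP => u.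
by rewrite (@nbh_enum _ _ _ [:: a; c; d]) //= ?va ?vc ?vd // !inE orbA.
Qed.

Section FourCycles.
Variables (T : finType) (E : {set {set T}}).
Hypotheses (gE : is_graph E) (crE : critical 1 (cycle_edges 4) E).

Local Notation C4 := (copy_set (cycle_edges 4) E).
Local Notation nb := (nbh E).
Local Notation D := (deg2 E).
Implicit Types (S : {set T}) (a b c s t u v w x y z : T).

Let C4_deg := cycle_deg (isT : 2 < 4).
Let cover_deg v := @cover_deg 4 _ T E C4_deg crE v.
Let deg2_adj x y S := @deg2_adj 4 _ T E C4_deg x y S.
Let deg2_nonadj x y := @deg2_nonadj 4 _ T E C4_deg gE crE x y.
Let deg3_nbh_deg2 v := @deg3_nbh_deg2 4 _ T E C4_deg gE crE v.
Let deg3_copy v x1 x2 x3 S := @deg3_copy 4 _ T E C4_deg v x1 x2 x3 S.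
Let no_twins x y := @critical_no_twins _ _ _ _ _ crE isT x y.
Let no_two_pairs x y z w := @critical_no_two_pairs _ _ _ _ _ crE isT x y z w.

Lemma adj_of_nbh v u (A : {set T}) : nb v = A -> u \in A -> adj E v u.
Proof. by move=> <-; rewrite in_nbh. Qed.

Lemma deg_gt3 v : v \in cover E -> deg E v <> 2 -> deg E v <> 3 -> 3 < deg E v.
Proof. by move=> /cover_deg; move: (deg E v); clear; lia. Qed.

Lemma deg2_copy S x a b : nb x = [set a; b] -> deg E x = 2 -> C4 S -> x \in S ->
  exists y, [/\ y != x, adj E a y, adj E b y & S = [set x; a; y; b]].
Proof.
move=> nx dx CS xS; have [p [w [q [SE us xp pw [wq qx]]]]] := four_cycle_copy CS xS.
move: us; rewrite /= !inE !negb_or => /and4P[/and3P[nxp nxw nxq] /andP[npw npq] nwq _].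
have px : p \in nb x by rewrite in_nbh.
have xq : q \in nb x by rewrite nbhC in_nbh.
exists w; rewrite eq_sym nxw; move: px xq; rewrite nx !inE.
move=> /orP[] /eqP ep /orP[] /eqP eq; subst p q; rewrite ?eqxx // in npq *.
  by rewrite pw adjC wq.
rewrite pw adjC wq SE; split=> //.
by rewrite -!setUA; congr (_ :|: _); rewrite setUCA [[set b] :|: _]setUC setUCA.
Qed.

Lemma deg2_common x a b : nb x = [set a; b] -> deg E x = 2 ->
  exists y, [/\ y != x, adj E a y & adj E b y].
Proof.
move=> nx dx; have xa : adj E x a by apply: adj_of_nbh nx _; rewrite set21.
have [S [CS xS _]] := critical_adj crE xa.
by have [y [nyx ay by_ _]] := deg2_copy nx dx CS xS; exists y.
Qed.

Lemma deg2_other x a : deg E x = 2 -> adj E x a ->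
  exists b, [/\ nb x = [set a; b], a != b & deg E b <> 2].
Proof.
move=> dx xa; have [b nx nab] : exists2 b, nb x = [set a; b] & a != b.
  by apply: card2_split; rewrite ?in_nbh.
by exists b; split=> //; apply: deg2_nonadj dx; apply: adj_of_nbh nx _; rewrite set22.
Qed.

Definition bad_config v x1 x2 w z1 z2 : Prop :=
  [/\ nb v = [set x1; x2; w], uniq [:: x1; x2; w], deg E x1 = 2 /\ deg E x2 = 2,
      nb x1 = [set v; z1] /\ nb x2 = [set v; z2] & v != z1 /\ v != z2].

Lemma bad_config_sym v x1 x2 w z1 z2 : bad_config v x1 x2 w z1 z2 -> bad_config v x2 x1 w z2 z1.
Proof.
move=> [nv ux [d1 d2] [n1 n2] [nz1 nz2]]; split=> //; first by rewrite nv (setUC [set x1]).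
by move: ux; rewrite /= !inE !negb_or (eq_sym x2 x1) => /and3P[/andP[-> ->] -> _].
Qed.

Section BadVertex.
Variables v x1 x2 w z1 z2 : T.
Hypothesis cfg : bad_config v x1 x2 w z1 z2.

Let nv : nb v = [set x1; x2; w]. Proof. by case: cfg. Qed.
Let d1 : deg E x1 = 2. Proof. by case: cfg => _ _ []. Qed.
Let d2 : deg E x2 = 2. Proof. by case: cfg => _ _ []. Qed.
Let n1 : nb x1 = [set v; z1]. Proof. by case: cfg => _ _ _ []. Qed.
Let n2 : nb x2 = [set v; z2]. Proof. by case: cfg => _ _ _ []. Qed.
Let nz1 : v != z1. Proof. by case: cfg => _ _ _ _ []. Qed.
Let nz2 : v != z2. Proof. by case: cfg => _ _ _ _ []. Qed.
Let neqs : [/\ x1 != x2, x1 != w & x2 != w].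
Proof. by case: cfg => _ + _ _ _; rewrite /= !inE negb_or => /and3P[/andP[]]. Qed.
Let vx1 : adj E v x1. Proof. by apply: adj_of_nbh nv _; rewrite !inE eqxx. Qed.
Let vx2 : adj E v x2. Proof. by apply: adj_of_nbh nv _; rewrite !inE eqxx orbT. Qed.
Let vw : adj E v w. Proof. by apply: adj_of_nbh nv _; rewrite !inE eqxx !orbT. Qed.
Let x1z1 : adj E x1 z1. Proof. by apply: adj_of_nbh n1 _; rewrite set22. Qed.
Let x2z2 : adj E x2 z2. Proof. by apply: adj_of_nbh n2 _; rewrite set22. Qed.

Lemma bad_nbr_copy S : C4 S ->
  (x1 \in S -> v \in S /\ z1 \in S) /\ (x2 \in S -> v \in S /\ z2 \in S).
Proof.
by move=> CS; split=> xS; split; apply: deg2_adj CS xS; rewrite // adjC.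
Qed.

Lemma bad_nbr_deg : deg E w <> 2.
Proof.
move=> dw; have [n12 n1w n2w] := neqs.
have sub : nb v \subset nb v :&: D.
  rewrite subsetI subxx nv; apply/subsetP => u; rewrite !in_setU !in_set1 -orbA.
  by case/or3P => /eqP ->; apply/deg2P.
have d3 : deg E v = 3 by rewrite /deg nv -setUA cardsU1 cards2 !inE negb_or n12 n1w n2w.
by have := leq_trans (subset_leq_card sub) (deg3_nbh_deg2 d3); rewrite -/(deg E v) d3.
Qed.

Lemma bad_end_deg : deg E z1 <> 2 /\ deg E z2 <> 2.
Proof. by split; [apply: deg2_nonadj x1z1 d1|apply: deg2_nonadj x2z2 d2]. Qed.

Lemma bad_twins_adj : z1 = z2 -> adj E z1 w.
Proof.
move=> ez; have [n12 _ _] := neqs; apply: contraT => nzw.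
have other S u u' : nb v = [set u; u'; w] -> nb u = [set v; z1] -> deg E u = 2 -> C4 S ->
    u \in S -> u' \in S.
  move=> nv' nu du CS uS; have [y [nyu vy zy ->]] := deg2_copy nu du CS uS.
  move: vy; rewrite -in_nbh nv' !inE (negPf nyu) /= => /orP[] /eqP ey; subst y; last first.
    by rewrite zy in nzw.
  by rewrite eqxx !orbT.
apply: False_ind; apply: (no_twins n12) => [|S CS].
  by apply: (adj_cover (v := v)); rewrite adjC.
by apply/idP/idP; apply: other => //; rewrite ?(setUC [set x2]) // n2 ez.
Qed.

Lemma bad_end_adj : adj E z1 w.
Proof.
have [y [nyx vy zy]] := deg2_common n1 d1.
move: vy; rewrite -in_nbh nv !inE (negPf nyx) /= => /orP[] /eqP ey; subst y => //.
apply: bad_twins_adj; move: zy; rewrite adjC -in_nbh n2 !inE (eq_sym z1) (negPf nz1).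
by move/eqP.
Qed.

Lemma bad_twins_deg : z1 = z2 -> deg E z1 <> 3.
Proof.
move=> ez d3; have [n12 n1w n2w] := neqs.
have nz : nb z1 = [set x1; x2; w].
  apply: nbh3 d3 _ _ bad_end_adj _; [by rewrite adjC|by rewrite adjC ez|].
  by rewrite /= !inE negb_or n12 n1w n2w.
apply: (@no_two_pairs v x1 z1 x2); last first.
- move=> S CS meetS; have [b1 b2] := bad_nbr_copy CS.
  have [vS zS] : v \in S /\ z1 \in S.
    have step u : nb u = [set x1; x2; w] -> u \in S -> v \in S /\ z1 \in S.
      by move=> nu /(deg3_copy nu CS) /or3P[] /andP[] => [/b1 //|/b1 //|/b2 []]; rewrite ez.
    case/or4P: meetS => [/(step _ nv)|/b1|/(step _ nz)|/b2 []] //.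
    by rewrite ez.
  by rewrite vS zS; have := deg3_copy nv CS vS; case: (x1 \in S); case: (x2 \in S).
- exact: adj_cover vx1.
rewrite /= !inE !negb_or nz1 (adj_neq gE vx1) (adj_neq gE vx2) n12.
by rewrite (adj_neq gE x1z1) eq_sym ez (adj_neq gE x2z2).
Qed.

Lemma bad_ends_deg : z1 != z2 -> nb w = [set v; z1; z2] -> deg E z2 <> 3.
Proof.
move=> nz nw d3; have [n12 n1w n2w] := neqs.
have wz2 : adj E w z2 by apply: adj_of_nbh nw _; rewrite !inE eqxx orbT.
have z2x2 : adj E z2 x2 by rewrite adjC.
have z2w : adj E z2 w by rewrite adjC.
have [s [zs nsx nsw]] : exists s, [/\ s \in nb z2, s != x2 & s != w].
  by apply: card_gt2_other; rewrite -/(deg E z2) d3.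
have nbz2 : nb z2 = [set x2; w; s].
  by apply: nbh3 => //; rewrite -?in_nbh //= !inE negb_or n2w !(eq_sym _ s) nsx nsw.
apply: (@no_two_pairs v x1 w z2); last first.
- move=> S CS; have [b1 b2] := bad_nbr_copy CS.
  have pairs_v : v \in S -> (v \in S) && (x1 \in S) || (w \in S) && (z2 \in S).
    move=> vS; have := deg3_copy nv CS vS; rewrite vS.
    by case/or3P => /andP[s1 s2]; rewrite ?s1 // s2 (b2 s1).2 orbT.
  case/or4P => [|/b1 [/pairs_v]|wS|zS] //.
    case/or3P: (deg3_copy nw CS wS) => /andP[s1 s2]; try exact: pairs_v s1.
    by rewrite wS s2 orbT.
  case/or3P: (deg3_copy nbz2 CS zS) => /andP[s1 s2]; try exact: pairs_v (b2 s1).1.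
  by rewrite zS s1 orbT.
- exact: adj_cover vw.
rewrite /= !inE !negb_or (adj_neq gE vw) (adj_neq gE vx1) nz2 n1w (adj_neq gE wz2) !andbT /=.
by apply/eqP => e; have := bad_end_deg.2; rewrite -e d1.
Qed.

End BadVertex.

Definition bad : {set T} := [set v | (deg E v == 3) && (#|nb v :&: D| == 2)].
Definition poor : {set T} :=
  [set v | [&& deg E v == 3, v \notin bad & 1 < #|nb v :&: (D :|: bad)|]].

Lemma badP v : reflect (deg E v = 3 /\ #|nb v :&: D| = 2) (v \in bad).
Proof. by rewrite inE; apply: (iffP andP) => -[/eqP ? /eqP]. Qed.

Lemma bad_deg v : v \in bad -> deg E v = 3.
Proof. by case/badP. Qed.

Lemma poor_deg v : v \in poor -> deg E v = 3.
Proof. by rewrite inE => /and3P[/eqP]. Qed.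

Lemma poor_not_bad v : v \in poor -> v \notin bad.
Proof. by rewrite inE => /and3P[]. Qed.

Lemma deg3_notin_deg2 v : deg E v = 3 -> v \notin D.
Proof. by move=> d3; rewrite inE d3. Qed.

Lemma notin_deg2_bad v : deg E v <> 2 -> deg E v <> 3 -> v \notin D :|: bad.
Proof. by move=> d2 d3; apply/setUP => -[/deg2P|/bad_deg]. Qed.

Lemma exists_bad_config v : v \in bad -> exists x1 x2 w z1 z2, bad_config v x1 x2 w z1 z2.
Proof.
move=> /badP [d3 t2]; have [||x1 [x2 [w [nv ux]]]] := @card3_split _ (nb v) D => //.
  by rewrite t2.
move=> /deg2P d1 /deg2P d2.
have [||z1 [n1 nz1 _]] := @deg2_other x1 v => //.
  by rewrite adjC; apply: adj_of_nbh nv _; rewrite !inE eqxx.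
have [||z2 [n2 nz2 _]] := @deg2_other x2 v => //.
  by rewrite adjC; apply: adj_of_nbh nv _; rewrite !inE eqxx orbT.
by exists x1, x2, w, z1, z2.
Qed.

Lemma bad_config_apex v x1 x2 w z1 z2 u :
  bad_config v x1 x2 w z1 z2 -> adj E v u -> deg E u <> 2 -> u = w.
Proof.
move=> [nv _ [d1 d2] _ _]; rewrite -in_nbh nv !inE -orbA.
by case/or3P => /eqP ->.
Qed.

Lemma bad_nonadj u v : u \in bad -> v \in bad -> ~~ adj E u v.
Proof.
move=> ub vb; apply/negP => uv.
have [x1 [x2 [w [z1 [z2 cfg]]]]] := exists_bad_config ub.
have [d3 t2] := badP _ vb; have [_ _ _ _ [nz1 _]] := cfg.
have ew : v = w by apply: bad_config_apex cfg uv _; rewrite d3.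
have : #|[set u; z1]| <= #|nb v :\: D|.
  apply/subset_leq_card/subsetP => y; rewrite in_set2 in_setD in_nbh.
  case/orP => /eqP ->; first by rewrite adjC uv deg3_notin_deg2 ?bad_deg.
  rewrite ew adjC (bad_end_adj cfg) andbT; apply/deg2P; exact: (bad_end_deg cfg).1.
by rewrite cards2 nz1; have := cardsID D (nb v); rewrite -/(deg E v) t2 d3; clear; lia.
Qed.

Definition poor_config w v z u x1 x2 : Prop :=
  [/\ nb w = [set v; z; u], uniq [:: v; z; u], v \in bad /\ u \in D :|: bad, 3 < deg E z &
      bad_config v x1 x2 w z z].

Lemma poor_bad_nbr w : w \in poor -> exists2 v, v \in bad & adj E w v.
Proof.
rewrite inE => /and3P[/eqP d3 wb t2].
have tD : #|nb w :&: D| <= 1.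
  have := deg3_nbh_deg2 d3; move: wb; rewrite inE d3 eqxx /=.
  by case: #|_| => [|[|[]]].
have /card_gt0P [v /setIP[vw vb]] : 0 < #|nb w :&: bad|.
  have := leq_card_setU (nb w :&: D) (nb w :&: bad); rewrite -setIUr => -[le _].
  by move: #|_ :&: bad| #|_ :&: D| #|_ :&: (_ :|: _)| t2 tD le; clear; lia.
by exists v; rewrite -?in_nbh.
Qed.

Lemma bad_nbr_ends v x1 x2 w z1 z2 : bad_config v x1 x2 w z1 z2 -> w \in poor -> z1 = z2.
Proof.
move=> cfg wp; have d3 := poor_deg wp; have [nv _ _ _ [nz1 nz2]] := cfg.
have cfg' := bad_config_sym cfg; have [dz1 dz2] := bad_end_deg cfg.
have wv : adj E w v by rewrite adjC; apply: adj_of_nbh nv _; rewrite !inE eqxx !orbT.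
have wz1 : adj E w z1 by rewrite adjC (bad_end_adj cfg).
have wz2 : adj E w z2 by rewrite adjC (bad_end_adj cfg').
apply/eqP; apply: contraT => nz; have nw : nb w = [set v; z1; z2].
  by apply: nbh3; rewrite //= !inE negb_or nz1 nz2 nz.
have nw' : nb w = [set v; z2; z1] by rewrite nw -!setUA (setUC [set z1]).
have nz' : z2 != z1 by rewrite eq_sym.
have /negPf z1n := notin_deg2_bad dz1 (bad_ends_deg cfg' nz' nw').
have /negPf z2n := notin_deg2_bad dz2 (bad_ends_deg cfg nz nw).
suff le1 : #|nb w :&: (D :|: bad)| <= 1 by move: wp; rewrite inE ltnNge le1 !andbF.
rewrite -(cards1 v); apply/subset_leq_card/subsetP => y; rewrite in_setI nw in_set1.
rewrite 2![in X in X && _]in_setU !in_set1 => /andP[/orP[/orP[//|/eqP ->]|/eqP ->]].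
  by rewrite z1n.
by rewrite z2n.
Qed.

Lemma exists_poor_config w : w \in poor -> exists v z u x1 x2, poor_config w v z u x1 x2.
Proof.
move=> wp; have d3 := poor_deg wp; have [v vb wv] := poor_bad_nbr wp.
have [x1 [x2 [w' [z1 [z2 cfg]]]]] := exists_bad_config vb.
have ew : w = w' by apply: (bad_config_apex cfg); rewrite 1?adjC // d3.
subst w'; have ez := bad_nbr_ends cfg wp; subst z2; rename z1 into z.
have [dz2 _] := bad_end_deg cfg; have [_ _ _ _ [nvz _]] := cfg.
have wz : adj E w z by rewrite adjC (bad_end_adj cfg).
have dz3 := bad_twins_deg cfg erefl.
have /card_gt0P [u] : 0 < #|(nb w :&: (D :|: bad)) :\ v|.
  move: wp; rewrite inE => /and3P[_ _]; rewrite (cardsD1 v) in_setI in_nbh wv in_setU vb orbT.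
  by [].
rewrite in_setD1 in_setI => /and3P[nuv uw uDb].
have nuz : u != z by apply: contraTneq uDb => ->; apply: notin_deg2_bad.
have uvz : uniq [:: v; z; u] by rewrite /= !inE negb_or nvz !(eq_sym _ u) nuv nuz.
exists v, z, u, x1, x2; split=> //; first by apply: nbh3; rewrite -?in_nbh // in_nbh.
by apply: deg_gt3 => //; apply: (adj_cover (v := w)); rewrite adjC.
Qed.

Lemma poor_nbr w u : w \in poor -> adj E w u ->
  u \notin poor /\ (u \notin D :|: bad -> 3 < deg E u).
Proof.
move=> wp wu; have [v [z [u' [x1 [x2 [nw _ [vb u'Db] dz _]]]]]] := exists_poor_config wp.
have low y : y \in D :|: bad -> y \notin poor.
  case/setUP => [/deg2P d2|yb]; apply/negP => yp.
    by have := poor_deg yp; rewrite d2.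
  by have := poor_not_bad yp; rewrite yb.
move: wu; rewrite -in_nbh nw !in_setU !in_set1 -orbA -!in_setU => /or3P[] /eqP ->.
- by rewrite low in_setU vb ?orbT.
- by split=> //; apply/negP => /poor_deg d3; rewrite d3 in dz.
- by rewrite low // u'Db.
Qed.

Definition four_cycle_sends u v : bool :=
  adj E u v && [|| u \in D, (u \in bad) && (v \notin D) | (u \in poor) && (v \notin D :|: bad)].

Lemma received_deg2 v : v \in D -> [set u | four_cycle_sends u v] = set0.
Proof.
move=> vD; apply/setP => u; rewrite inE in_set0 /four_cycle_sends in_setU vD /= !andbF !orbF.
by apply/negP => /andP[uv /deg2P du]; apply: (deg2_nonadj uv du); apply/deg2P.
Qed.

Lemma received_bad v : v \in bad -> [set u | four_cycle_sends u v] = nb v :&: D.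
Proof.
move=> vb; have vD := deg3_notin_deg2 (bad_deg vb).
apply/setP => u; rewrite inE in_setI nbhC in_nbh /four_cycle_sends in_setU vD vb orbT !andbF orbF.
have [uv|] := boolP (adj E u v) => //=; have [ub|] := boolP (u \in bad); rewrite ?orbF //.
by have := bad_nonadj ub vb; rewrite uv.
Qed.

Lemma received_other v : v \notin D -> v \notin bad ->
  [set u | four_cycle_sends u v] = nb v :&: (D :|: bad :|: poor).
Proof.
move=> vD vb; apply/setP => u; rewrite inE in_setI nbhC in_nbh /four_cycle_sends.
by rewrite [v \in _ :|: _]in_setU vD (negPf vD) (negPf vb) !andbT !in_setU orbA.
Qed.

Lemma sent_deg2 v : v \in D -> [set u | four_cycle_sends v u] = nb v.
Proof. by move=> vD; apply/setP => u; rewrite inE in_nbh /four_cycle_sends vD andbT. Qed.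

Lemma sent_bad v : v \in bad -> [set u | four_cycle_sends v u] = nb v :\: D.
Proof.
move=> vb; apply/setP => u; rewrite inE in_setD in_nbh /four_cycle_sends.
have /negPf -> : v \notin poor by apply: contraL vb; apply: poor_not_bad.
by rewrite (negPf (deg3_notin_deg2 (bad_deg vb))) vb /= orbF andbC.
Qed.

Lemma sent_poor v : v \in poor -> [set u | four_cycle_sends v u] = nb v :\: (D :|: bad).
Proof.
move=> vp; apply/setP => u; rewrite inE in_setD in_nbh /four_cycle_sends.
by rewrite (negPf (deg3_notin_deg2 (poor_deg vp))) (negPf (poor_not_bad vp)) vp /= andbC.
Qed.

Lemma sent_other v : v \notin D -> v \notin bad -> v \notin poor ->
  [set u | four_cycle_sends v u] = set0.
Proof.
move=> vD vb vp; apply/setP => u; rewrite inE in_set0 /four_cycle_sends.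
by rewrite (negPf vD) (negPf vb) (negPf vp) andbF.
Qed.

Lemma poor_balance v : v \in poor ->
  #|nb v :&: (D :|: bad :|: poor)| = 2 /\ #|nb v :\: (D :|: bad)| = 1.
Proof.
move=> vp; have [v' [z [u [x1 [x2 [nw _ [v'b uDb] dz _]]]]]] := exists_poor_config vp.
have zDb : z \notin D :|: bad by apply: notin_deg2_bad => e; rewrite e in dz.
have nvD : nb v :\: (D :|: bad) = [set z].
  apply/setP => t; rewrite in_setD nw in_set1 2![in X in _ && X]in_setU !in_set1.
  have [->|ntz] := eqVneq t z; first by rewrite zDb orbT.
  rewrite orbF; apply/negP => /andP[+ /orP[] /eqP et]; rewrite et; last by rewrite uDb.
  by rewrite in_setU v'b orbT.
rewrite nvD cards1; split=> //.
have -> : nb v :&: (D :|: bad :|: poor) = nb v :&: (D :|: bad).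
  apply/setP => t; rewrite !in_setI in_setU in_nbh; case: (boolP (adj E v t)) => //= vt.
  by have [/negPf -> _] := poor_nbr vp vt; rewrite orbF.
have := cardsID (D :|: bad) (nb v); rewrite -/(deg E v) nvD cards1 (poor_deg vp).
by rewrite addn1 => -[].
Qed.

Lemma deg3_receives v : deg E v = 3 -> v \notin bad -> v \notin poor ->
  #|nb v :&: (D :|: bad :|: poor)| <= 1.
Proof.
move=> d3 vb vp; have vDb : v \notin D :|: bad by rewrite in_setU (negPf (deg3_notin_deg2 d3)).
have -> : nb v :&: (D :|: bad :|: poor) = nb v :&: (D :|: bad).
  apply/setP => t; rewrite !in_setI in_setU nbhC in_nbh; case: (boolP (adj E t v)) => //= tv.
  case: (boolP (t \in poor)) => tp; rewrite ?orbF // orbT.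
  by have [_ /(_ vDb)] := poor_nbr tp tv; rewrite d3.
by rewrite leqNgt; apply: contra vp => lt; rewrite inE d3 vb lt.
Qed.

Lemma four_cycle_charge v : v \in cover E ->
  2 * 4 + #|[set u | four_cycle_sends u v]| <= 3 * deg E v + #|[set u | four_cycle_sends v u]|.
Proof.
move=> vE; have [vD|vD] := boolP (v \in D).
  by rewrite received_deg2 // sent_deg2 // cards0 -/(deg E v); move/deg2P: vD => ->.
have [vb|vb] := boolP (v \in bad).
  have [d3 t2] := badP _ vb; rewrite received_bad // sent_bad // d3 t2.
  by have := cardsID D (nb v); rewrite -/(deg E v) t2 d3; clear; lia.
rewrite received_other //; have [vp|vp] := boolP (v \in poor).
  by have [-> c1] := poor_balance vp; rewrite sent_poor // c1 poor_deg.
rewrite sent_other // cards0 addn0.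
have [d3|d3] := eqVneq (deg E v) 3; first by rewrite d3; apply: deg3_receives.
have d4 : 3 < deg E v by apply: deg_gt3 => //; [apply/deg2P|apply/eqP].
apply: (@leq_trans (2 * 4 + deg E v)); first by rewrite leq_add2l; apply/subset_leq_card/subsetIl.
by move: (deg E v) d4; clear; lia.
Qed.

Section PoorVertex.
Variables w v z u x1 x2 : T.
Hypotheses (wp : w \in poor) (pcfg : poor_config w v z u x1 x2).

Let nw : nb w = [set v; z; u]. Proof. by case: pcfg. Qed.
Let uvz : uniq [:: v; z; u]. Proof. by case: pcfg. Qed.
Let vb : v \in bad. Proof. by case: pcfg => _ _ []. Qed.
Let cfg : bad_config v x1 x2 w z z. Proof. by case: pcfg. Qed.
Let dw : deg E w = 3. Proof. exact: poor_deg. Qed.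
Let dv : deg E v = 3. Proof. exact: bad_deg. Qed.
Let wu : adj E w u. Proof. by apply: adj_of_nbh nw _; rewrite !inE eqxx !orbT. Qed.
Let wz : adj E w z. Proof. by apply: adj_of_nbh nw _; rewrite !inE eqxx orbT. Qed.
Let zx1 : adj E z x1.
Proof. by case: cfg => _ _ _ [n1 _] _; rewrite adjC; apply: adj_of_nbh n1 _; rewrite set22. Qed.
Let zx2 : adj E z x2.
Proof. by case: cfg => _ _ _ [_ n2] _; rewrite adjC; apply: adj_of_nbh n2 _; rewrite set22. Qed.

Lemma poor_deg2_nbh y : deg E y = 2 -> (y == x1) || (y == x2) -> nb y = [set v; z].
Proof. by case: cfg => _ _ _ [n1 n2] _ _ /orP[] /eqP ->. Qed.

Lemma poor_third_not_bad : deg E z = 4 -> u \notin bad.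
Proof.
move=> dz4; apply/negP => ub; have [y1 [y2 [w' [c1 [c2 cfgu]]]]] := exists_bad_config ub.
have [nv ux [d1 d2] _ _] := cfg; have [_ uy [e1 e2] [m1 m2] [nc1 nc2]] := cfgu.
have uw' : adj E u w by rewrite adjC.
have ew : w = w' by apply: bad_config_apex cfgu uw' _; rewrite dw.
subst w'; have /and3P[] := uvz; rewrite !inE negb_or => /andP[_ nvu] nzu _.
have unx y : nb y = [set v; z] -> u \notin nb y.
  by move=> ->; rewrite !inE negb_or !(eq_sym u) nvu nzu.
have notx y c : nb y = [set u; c] -> (y == x1) || (y == x2) = false.
  move=> my; apply/negP => yx; have dy : deg E y = 2 by case/orP: yx => /eqP ->.
  by have := unx y (poor_deg2_nbh dy yx); rewrite my set21.
have zy y c : nb y = [set u; c] -> u != c -> adj E c w -> deg E y = 2 -> adj E z y.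
  move=> my nuc cw dy; have yc : adj E y c by apply: adj_of_nbh my _; rewrite set22.
  have : c \in nb w by rewrite nbhC in_nbh.
  rewrite nw !inE (eq_sym c u) (negPf nuc) orbF => /orP[] /eqP ec; subst c; last by rewrite adjC.
  rewrite adjC -in_nbh nv !inE (notx y v my) /= in yc.
  by rewrite (eqP yc) dw in dy.
have : size [:: x1; x2; w; y1; y2] <= deg E z; last by rewrite dz4.
rewrite /deg cardE; apply: uniq_leq_size => [|a]; last first.
  rewrite mem_enum in_nbh !inE => /or4P[/eqP->|/eqP->|/eqP->|/orP[]/eqP->] //.
  - by rewrite adjC.
  - exact: (zy y1 c1 m1 nc1 (bad_end_adj cfgu) e1).
  - exact: (zy y2 c2 m2 nc2 (bad_end_adj (bad_config_sym cfgu)) e2).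
move: ux uy (notx y1 c1 m1) (notx y2 c2 m2); rewrite /= !inE !negb_or !andbT.
move=> /andP[/andP[-> ->] ->] /andP[/andP[-> ny1w] ny2w] /norP[n11 n12] /norP[n21 n22].
by rewrite !(eq_sym x1) !(eq_sym x2) !(eq_sym w) n11 n12 n21 n22 ny1w ny2w.
Qed.

Lemma poor_third_deg2 : u \in D -> exists y,
  [/\ deg E u = 2, nb u = [set w; y], w != y, deg E y <> 2 & adj E z y].
Proof.
move=> /deg2P du; have uw : adj E u w by rewrite adjC.
have [y [nu nwy dy]] := deg2_other du uw; have [t [ntu wt yt]] := deg2_common nu du.
exists y; split=> //; move: wt; rewrite -in_nbh nw !inE (negPf ntu) orbF.
case/orP => /eqP et; subst t; last by rewrite adjC.
have vy : adj E v y by rewrite adjC.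
by have := bad_config_apex cfg vy dy => ey; rewrite ey eqxx in nwy.
Qed.

Lemma poor_fourth_nbh y : deg E z = 4 -> w != y -> deg E y <> 2 -> adj E z y ->
  nb z =i [:: x1; x2; w; y].
Proof.
move=> dz4 nwy dy zy; have [_ ux [d1 d2] _ _] := cfg; apply: nbh_enum => //.
  by rewrite /= zx1 zx2 zy adjC wz.
move: ux; rewrite /= !inE !negb_or nwy !andbT => /andP[/andP[-> ->] ->].
by rewrite /=; apply/andP; split; apply/eqP => e; rewrite -e in dy.
Qed.

Lemma poor_fourth_not_bad y : deg E z = 4 -> nb z =i [:: x1; x2; w; y] -> deg E y <> 2 ->
  deg E u = 2 -> adj E z y -> y \notin bad.
Proof.
move=> dz4 nz dy du zy; apply/negP => yb.
have [a1 [a2 [w' [c1 [c2 cfgy]]]]] := exists_bad_config yb.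
have yz : adj E y z by rewrite adjC.
have ew : z = w' by apply: bad_config_apex cfgy yz _; rewrite dz4.
subst w'; have [_ uy [e1 e2] [m1 m2] [nc1 nc2]] := cfgy; have [_ _ [d1 d2] _ _] := cfg.
have eu a c : nb a = [set y; c] -> y != c -> adj E c z -> deg E c <> 2 -> deg E a = 2 -> a = u.
  move=> ma nc cz dc da; have : c \in nb z by rewrite nbhC in_nbh.
  rewrite nz !inE (eq_sym c y) (negPf nc) orbF => /or3P[] /eqP ec; subst c => //.
  have : a \in nb w by rewrite nbhC ma set22.
  rewrite nw !inE -orbA => /or3P[] /eqP ea //; first by rewrite ea dv in da.
  by rewrite ea dz4 in da.
have [dc1 dc2] := bad_end_deg cfgy; have cz1 := bad_end_adj cfgy.
have cz2 := bad_end_adj (bad_config_sym cfgy).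
by move: uy; rewrite (eu a1 c1) // (eu a2 c2) //= !inE eqxx.
Qed.

Lemma poor_fourth_not_poor y : deg E z = 4 -> nb z =i [:: x1; x2; w; y] -> w != y ->
  deg E y <> 2 -> adj E z y -> y \notin poor.
Proof.
move=> dz4 nz nwy dy zy; apply/negP => yp.
have [v' [z' [u' [x1' [x2' [ny _ [v'b u'Db] _ cfg']]]]]] := exists_poor_config yp.
have ez : z = z'.
  have : z \in nb y by rewrite nbhC in_nbh.
  rewrite ny !inE -orbA => /or3P[] /eqP e //; first by have := bad_deg v'b; rewrite -e dz4.
  by move: u'Db; rewrite -e => /setUP[/deg2P|/bad_deg]; rewrite dz4.
subst z'; have [nv' _ [d1' _] [n1' _] _] := cfg'.
have x1'x : (x1' == x1) || (x1' == x2).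
  have : x1' \in nb z by rewrite nbhC n1' set22.
  rewrite nz !inE orbA => /orP[//|/orP[] /eqP e]; last by rewrite e in d1'.
  by rewrite e dw in d1'.
have ev : v = v'.
  have : v' \in nb x1' by rewrite n1' set21.
  rewrite (poor_deg2_nbh d1' x1'x) !inE => /orP[] /eqP // e.
  by have := bad_deg v'b; rewrite e dz4.
have vy : adj E v y by rewrite ev; apply: adj_of_nbh nv' _; rewrite !inE eqxx !orbT.
by have := bad_config_apex cfg vy dy => ey; rewrite ey eqxx in nwy.
Qed.

End PoorVertex.

Section TightFourCycles.
Hypothesis tight : {in cover E, forall v, 2 * 4 + #|[set u | four_cycle_sends u v]| =
  3 * deg E v + #|[set u | four_cycle_sends v u]|}.

Lemma tight_full v : 3 < deg E v -> deg E v = 4 /\ nb v \subset D :|: bad :|: poor.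
Proof.
move=> d4; have vE : v \in cover E by rewrite in_cover_deg // (leq_trans _ d4).
have vD : v \notin D by apply/deg2P => e; rewrite e in d4.
have vb : v \notin bad by apply/negP => /bad_deg e; rewrite e in d4.
have vp : v \notin poor by apply/negP => /poor_deg e; rewrite e in d4.
have := tight vE; rewrite received_other // sent_other // cards0 addn0 => tv.
have le : #|nb v :&: (D :|: bad :|: poor)| <= deg E v by apply/subset_leq_card/subsetIl.
have e4 : deg E v = 4 by move: #|_| (deg E v) d4 tv le; clear; lia.
split=> //; apply/setIidPl/eqP; rewrite eqEcard subsetIl -/(deg E v).
by rewrite e4 in tv *; move: #|_| tv; clear; lia.
Qed.

Lemma tight_deg3_receives v : deg E v = 3 -> v \notin bad -> v \notin poor ->
  #|nb v :&: (D :|: bad :|: poor)| = 1.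
Proof.
move=> d3 vb vp; have vE : v \in cover E by rewrite in_cover_deg // d3.
have := tight vE; rewrite received_other // ?deg3_notin_deg2 // sent_other ?deg3_notin_deg2 //.
by rewrite cards0 addn0 d3; move: #|_|; clear; lia.
Qed.

Lemma no_poor w : w \notin poor.
Proof.
apply/negP => wp; have [v [z [u [x1 [x2 pcfg]]]]] := exists_poor_config wp.
have [_ _ [_ uDb] dz _] := pcfg; have [dz4 /subsetP sz] := tight_full dz.
have /orP[uD|ub] : (u \in D) || (u \in bad) by rewrite -in_setU.
  have [y [du nu nwy dy zy]] := poor_third_deg2 pcfg uD.
  have nz := poor_fourth_nbh pcfg dz4 nwy dy zy.
  have := sz y; rewrite in_nbh zy !in_setU => /(_ isT) /orP[/orP[/deg2P //|yb]|yp].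
    by have := poor_fourth_not_bad pcfg dz4 nz dy du zy; rewrite yb.
  by have := poor_fourth_not_poor wp pcfg dz4 nz nwy dy zy; rewrite yp.
by have := poor_third_not_bad wp pcfg dz4; rewrite ub.
Qed.

Lemma tight_bad_nbr v x1 x2 w z1 z2 : v \in bad -> bad_config v x1 x2 w z1 z2 -> 3 < deg E w.
Proof.
move=> vb cfg; have [nv _ _ _ [nz1 nz2]] := cfg; have dw := bad_nbr_deg cfg.
have vw : adj E v w by apply: adj_of_nbh nv _; rewrite !inE eqxx !orbT.
have wv : adj E w v by rewrite adjC.
have [dz1 dz2] := bad_end_deg cfg; have cfg' := bad_config_sym cfg.
apply: deg_gt3 (adj_cover wv) dw _ => d3.
have wb : w \notin bad by apply: contraTN wv => wb; apply: bad_nonadj.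
have z2w := bad_end_adj cfg'; have z1w := bad_end_adj cfg.
have dz2' : deg E z2 <> 3.
  have [ez|nz] := eqVneq z1 z2; first by rewrite -ez; apply: bad_twins_deg cfg ez.
  apply: (bad_ends_deg cfg nz); apply: nbh3 => //; first by rewrite adjC.
    by rewrite adjC.
  by rewrite /= !inE negb_or nz1 nz2 nz.
have [_ /subsetP /(_ w)] := tight_full (deg_gt3 (adj_cover z2w) dz2 dz2').
by rewrite in_nbh z2w !in_setU (negPf wb) (negPf (no_poor w)) inE d3 => /(_ isT).
Qed.

Lemma tight_bad v x : v \in bad -> x \in nb v -> deg E x = 2 -> nb x \subset bad.
Proof.
move=> vb xv dx; have [x1 [x2 [w [z1 [z2 cfg]]]]] := exists_bad_config vb.
have [_ /subsetP sw] := tight_full (tight_bad_nbr vb cfg).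
have zb z : adj E z w -> deg E z <> 2 -> z \in bad.
  move=> zw /deg2P dz; have := sw z; rewrite in_nbh adjC zw !in_setU (negPf dz).
  by rewrite (negPf (no_poor z)) orbF => /(_ isT).
have [dz1 dz2] := bad_end_deg cfg; have z1w := bad_end_adj cfg.
have z2w := bad_end_adj (bad_config_sym cfg); have [nv _ _ [n1 n2] _] := cfg.
move: xv; rewrite nv !inE -orbA => /or3P[] /eqP ex.
- by rewrite ex n1 subUset !sub1set vb zb.
- by rewrite ex n2 subUset !sub1set vb zb.
- by case: (bad_nbr_deg cfg); rewrite -ex.
Qed.

Lemma no_bad v : v \notin bad.
Proof.
apply/negP => vb; pose D' := [set x in D | nb x \subset bad].
have hasD' u : u \in bad -> exists x1 x2 w, [/\ nb u = [set x1; x2; w], x1 \in D' & x2 \in D'].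
  move=> ub; have [x1 [x2 [w [z1 [z2 [nu _ [d1 d2] _ _]]]]]] := exists_bad_config ub.
  exists x1, x2, w; split=> //; rewrite in_set; apply/andP; split; try exact/deg2P.
    by apply: tight_bad ub _ d1; rewrite nu !inE eqxx.
  by apply: tight_bad ub _ d2; rewrite nu !inE eqxx orbT.
have [x1 [x2 [w [nv x1D' _]]]] := hasD' v vb.
apply: (@deg2_no_matching 4 _ T E C4_deg crE D' bad x1 x1D').
- by apply: (nbh_cover (u := v)); rewrite nv !inE eqxx.
- by move=> y; rewrite in_set => /andP[/deg2P].
- apply/pred0P => y /=; apply/negP => /andP[]; rewrite in_set => /andP[yD _] /bad_deg.
  by move/deg3_notin_deg2; rewrite yD.
- move=> u /badP [_ <-]; apply/subset_leq_card/setIS/subsetP => y.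
  by rewrite in_set => /andP[].
move=> S u CS uS ub; have [y1 [y2 [w' [nu y1D' y2D']]]] := hasD' u ub.
by have := deg3_copy nu CS uS; case/or3P => /andP[s1 _]; [exists y1|exists y1|exists y2].
Qed.

Lemma full_nbr_deg v u : 3 < deg E v -> adj E v u -> deg E u = 2.
Proof.
move=> dv vu; have [_ /subsetP /(_ u)] := tight_full dv.
by rewrite in_nbh vu !in_setU (negPf (no_bad u)) (negPf (no_poor u)) !orbF => /(_ isT) /deg2P.
Qed.

Lemma tight_deg3_nbh v : deg E v = 3 -> #|nb v :&: D| = 1.
Proof.
move=> dv; rewrite -(tight_deg3_receives dv (no_bad v) (no_poor v)); apply: eq_card => u.
by rewrite !in_setI !in_setU (negPf (no_bad u)) (negPf (no_poor u)) !orbF.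
Qed.

Lemma tight_deg3_uniq v x y : deg E v = 3 ->
  adj E v x -> adj E v y -> deg E x = 2 -> deg E y = 2 -> x = y.
Proof.
move=> /tight_deg3_nbh /eq_leq/card_le1_eqP h vx vy /deg2P dx /deg2P dy.
by apply: h; rewrite in_setI in_nbh ?vx ?vy.
Qed.

Section FullVertices.
Variables a b : T.
Hypotheses (da : 3 < deg E a) (nab : a != b).

Lemma full_nbh s c : adj E a s -> adj E s c -> a != c -> nb s = [set a; c].
Proof.
move=> as_ sc nac; have sa : adj E s a by rewrite adjC.
have [c' [ns _ _]] := deg2_other (full_nbr_deg da as_) sa.
by move: sc; rewrite -in_nbh ns !inE (eq_sym c a) (negPf nac) /= => /eqP ->.
Qed.

Lemma full_common_card2 : #|nb a :&: nb b| <> 2.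
Proof.
move=> /eqP/cards2P [x [y [nxy ab]]].
have common u : u \in [set x; y] -> adj E a u /\ adj E b u.
  by rewrite -ab in_setI !in_nbh => /andP.
have other S u u' : [set x; y] = [set u; u'] -> C4 S -> u \in S -> u' \in S.
  move=> exy CS uS; have [au bu] : adj E a u /\ adj E b u by apply: common; rewrite exy set21.
  have nu : nb u = [set a; b] by apply: full_nbh => //; rewrite adjC.
  have [t [ntu at_ bt ->]] := deg2_copy nu (full_nbr_deg da au) CS uS.
  have : t \in [set u; u'] by rewrite -exy -ab in_setI !in_nbh at_ bt.
  by rewrite !inE (negPf ntu) => /eqP ->; rewrite eqxx !orbT.
have [ax _] := common x (set21 x y); apply: (no_twins nxy) => [|S CS].
  by apply: (adj_cover (v := a)); rewrite adjC.
by apply/idP/idP; apply: other; rewrite // setUC.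
Qed.

Lemma full_nbh_neq : 3 < deg E b -> nb a <> nb b.
Proof.
move=> db eab; have aE : a \in cover E by rewrite in_cover_deg // (leq_trans _ da).
apply: (no_twins nab aE) => S CS.
have other u u' : 3 < deg E u -> nb u = nb u' -> u \in S -> u' \in S.
  move=> du eu uS; have /card_gt0P [s /setIP[us sS]] := ltnW (copy_deg C4_deg CS uS).
  have ds : deg E s = 2 by apply: full_nbr_deg du _; rewrite -in_nbh.
  by apply: deg2_adj ds _ CS sS; rewrite adjC -in_nbh -eu.
by apply/idP/idP; apply: other.
Qed.

Lemma full_common_sub : 2 < #|nb a :&: nb b| -> nb a \subset nb b.
Proof.
move=> c3; apply/subsetP => s sa; apply: contraT => sb; have as_ : adj E a s by rewrite -in_nbh.
have sa' : adj E s a by rewrite adjC.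
have ds := full_nbr_deg da as_; have [c [ns nac _]] := deg2_other ds sa'.
have sc : adj E s c by apply: adj_of_nbh ns _; rewrite set22.
have [s' [ns' as' cs']] := deg2_common ns ds.
have ns'E : nb s' = [set a; c] by apply: full_nbh => //; rewrite adjC.
have ncb : b != c by apply: contraNneq sb => ->; rewrite in_nbh adjC.
have s'b : s' \notin nb b by rewrite nbhC ns'E !inE negb_or (eq_sym b a) nab.
have disj : [disjoint nb a :&: nb b & [set s; s']].
  rewrite disjoint_sym disjoints_subset subUset !sub1set !in_setC !in_setI.
  by rewrite (negPf sb) (negPf s'b) !andbF.
have : #|(nb a :&: nb b) :|: [set s; s']| <= deg E a.
  by apply/subset_leq_card; rewrite subUset subsetIl subUset !sub1set !in_nbh as_ as'.
rewrite cardsU (disjoint_setI0 disj) cards0 cards2 eq_sym ns' (tight_full da).1; move: c3;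
  move: #|_|; clear; lia.
Qed.

End FullVertices.

Lemma deg2_nbr_not_full x a b : deg E x = 2 -> nb x = [set a; b] -> a != b -> deg E a <= 3.
Proof.
move=> dx nx nab; rewrite leqNgt; apply/negP => da.
have xa : adj E x a by apply: adj_of_nbh nx _; rewrite set21.
have xb : adj E x b by apply: adj_of_nbh nx _; rewrite set22.
have ax : adj E a x by rewrite adjC.
have bx : adj E b x by rewrite adjC.
have [y [nyx ay by_]] := deg2_common nx dx; have dy := full_nbr_deg da ay.
have db : 3 < deg E b.
  apply: deg_gt3 (adj_cover bx) (deg2_nonadj xb dx) _ => db3.
  by case/eqP: nyx; apply: tight_deg3_uniq db3 by_ bx dy dx.
have c2 : 1 < #|nb a :&: nb b|.
  by apply/card_gt1P; exists y, x; rewrite !in_setI !in_nbh ay by_ ax bx.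
have c3 : 2 < #|nb a :&: nb b|.
  by rewrite ltn_neqAle c2 andbT eq_sym; apply/eqP/full_common_card2.
apply: (full_nbh_neq da nab db); apply/eqP.
by rewrite eqEcard full_common_sub // -/(deg E a) -/(deg E b) (tight_full da).1 (tight_full db).1.
Qed.

Section CubicCycle.
Variables x a b y c c' : T.
Hypotheses (dx : deg E x = 2) (nx : nb x = [set a; b]) (nab : a != b).
Hypotheses (da : deg E a = 3) (db : deg E b = 3) (dy : deg E y = 3) (nyx : y != x).
Hypotheses (ay : adj E a y) (yb : adj E b y) (yc : adj E y c) (dc : deg E c = 2).
Hypotheses (nc : nb c = [set y; c']) (ac' : adj E a c').

Let xa : adj E x a. Proof. by apply: adj_of_nbh nx _; rewrite set21. Qed.
Let xb : adj E x b. Proof. by apply: adj_of_nbh nx _; rewrite set22. Qed.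
Let ax : adj E a x. Proof. by rewrite adjC. Qed.
Let bx : adj E b x. Proof. by rewrite adjC. Qed.
Let cc' : adj E c c'. Proof. by apply: adj_of_nbh nc _; rewrite set22. Qed.
Let dc' : deg E c' <> 2. Proof. exact: deg2_nonadj cc' dc. Qed.

Let nyc' : y != c'.
Proof. by apply/eqP => e; move: dc; rewrite /deg nc e setUid cards1. Qed.

Let nxc' : x != c'.
Proof. by apply/eqP => e; move: dc'; rewrite -e. Qed.

Let nc'b : c' != b.
Proof.
apply/eqP => e; have ecx : c = x.
  by apply: tight_deg3_uniq db _ bx dc dx; rewrite -e adjC.
have : y \in nb x by rewrite -ecx nc set21.
rewrite nx !inE => /orP[] /eqP ey; first by move: (adj_neq gE ay); rewrite ey eqxx.
by move: (adj_neq gE yb); rewrite ey eqxx.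
Qed.

Let na : nb a = [set x; y; c'].
Proof. by apply: nbh3 => //; rewrite /= !inE negb_or nxc' eq_sym nyx nyc'. Qed.

Let ny : nb y = [set a; b; c].
Proof.
apply: nbh3 => //; try by rewrite adjC.
rewrite /= !inE negb_or nab; apply/and3P; split=> //; apply/eqP => e.
  by move: da; rewrite e dc.
by move: db; rewrite e dc.
Qed.

Lemma cubic_cycle_copy S : C4 S ->
  (x \in S -> a \in S /\ b \in S) /\ (c \in S -> y \in S /\ c' \in S).
Proof. by move=> CS; split=> uS; split; apply: deg2_adj CS uS; rewrite // adjC. Qed.

Lemma cubic_cycle_nonadj : ~~ adj E b c'.
Proof.
apply/negP => bc'; have c'c : adj E c' c by rewrite adjC.
have c'a : adj E c' a by rewrite adjC.
have c'b : adj E c' b by rewrite adjC.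
have nb_ : nb b = [set x; y; c'] by apply: nbh3; rewrite //= !inE negb_or nxc' eq_sym nyx nyc'.
have dc'3 : deg E c' = 3.
  have [//|/eqP dc'3] := eqVneq (deg E c') 3.
  by have := full_nbr_deg (deg_gt3 (adj_cover c'c) dc' dc'3) c'a; rewrite da.
have nbc' : nb c' = [set a; b; c].
  apply: nbh3 => //; rewrite /= !inE negb_or nab; apply/and3P; split=> //; apply/eqP => e.
    by move: da; rewrite e dc.
  by move: db; rewrite e dc.
apply: (@no_two_pairs a b y c'); last first.
- move=> S CS meetS; have [hx hc] := cubic_cycle_copy CS.
  have ab u : u \in S -> nb u = [set x; y; c'] ->
      (a \in S) && (b \in S) || (y \in S) && (c' \in S).
    move=> uS nu; case/or3P: (deg3_copy nu CS uS) => /andP[s1 s2]; last by rewrite s1 s2 orbT.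
      by have [-> ->] := hx s1.
    by have [-> ->] := hx s1.
  have yc'_ u : u \in S -> nb u = [set a; b; c] ->
      (a \in S) && (b \in S) || (y \in S) && (c' \in S).
    move=> uS nu; case/or3P: (deg3_copy nu CS uS) => /andP[s1 s2]; first by rewrite s1 s2.
      by have [-> ->] := hc s2; rewrite orbT.
    by have [-> ->] := hc s2; rewrite orbT.
  by case/or4P: meetS => uS; [exact: ab na|exact: ab nb_|exact: yc'_ ny|exact: yc'_ nbc'].
- exact: adj_cover ay.
rewrite /= !inE !negb_or nab (adj_neq gE ay) (adj_neq gE ac') (adj_neq gE yb) (eq_sym b c') nc'b.
by rewrite nyc'.
Qed.

Lemma no_cubic_cycle : False.
Proof.
have /negP bc' := cubic_cycle_nonadj.
apply: (no_twins (adj_neq gE ay) (adj_cover ay)) => S CS; have [hx hc] := cubic_cycle_copy CS.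
apply/idP/idP => uS.
  case/or3P: (deg3_copy na CS uS) => /andP[s1 s2] //.
  have [t [_ _ bt SE]] := deg2_copy nx dx CS s1.
  move: s2; rewrite SE !inE (eq_sym c' x) (negPf nxc') (negPf nc'b) orbF eq_sym.
  by rewrite (negPf (adj_neq gE ac')) => /eqP e; rewrite e in bc'; case: bc'.
case/or3P: (deg3_copy ny CS uS) => /andP[s1 s2] //.
have [t [ntc yt c't SE]] := deg2_copy nc dc CS s2.
have tS : t \in S by rewrite SE !inE eqxx !orbT.
move: yt; rewrite -in_nbh ny !inE (negPf ntc) orbF => /orP[] /eqP et; first by rewrite -et.
by case: bc'; rewrite adjC -et.
Qed.

End CubicCycle.

Lemma tight_deg2 : exists2 x, x \in cover E & deg E x = 2.
Proof.
have /set0Pn [u uE] := @critical_cover_neq0 4 _ T E C4_deg gE crE isT.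
have [d2|/eqP d2] := eqVneq (deg E u) 2; first by exists u.
have [d3|/eqP d3] := eqVneq (deg E u) 3.
  have /card_gt0P [x /setIP[ux /deg2P dx]] : 0 < #|nb u :&: D| by rewrite tight_deg3_nbh.
  by exists x => //; apply: nbh_cover ux.
have d4 := deg_gt3 uE d2 d3; have /card_gt0P [x ux] : 0 < deg E u by apply: leq_trans d4.
by exists x; [apply: nbh_cover ux|apply: full_nbr_deg d4 _; rewrite -in_nbh].
Qed.

Lemma no_tight_four_cycle : False.
Proof.
have [x _ dx] := tight_deg2; have /card_gt0P [a] : 0 < deg E x by rewrite dx.
rewrite in_nbh => xa; have [b [nx nab _]] := deg2_other dx xa.
have xb : adj E x b by apply: adj_of_nbh nx _; rewrite set22.
have nx' : nb x = [set b; a] by rewrite setUC.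
have nba : b != a by rewrite eq_sym.
have deg3 u v : nb x = [set u; v] -> u != v -> adj E x u -> deg E u = 3.
  move=> nuv n_uv xu; have ux : adj E u x by rewrite adjC.
  have := deg2_nbr_not_full dx nuv n_uv; have := deg_gt3 (adj_cover ux) (deg2_nonadj xu dx).
  by have [//|/eqP ne /(_ ne) lt] := eqVneq (deg E u) 3; rewrite leqNgt lt.
have da := deg3 a b nx nab xa; have db := deg3 b a nx' nba xb.
have [y [nyx ay yb]] := deg2_common nx dx; have ya : adj E y a by rewrite adjC.
have dy : deg E y = 3.
  have ax : adj E a x by rewrite adjC.
  have dy2 : deg E y <> 2 by move=> dy; case/eqP: nyx; apply: tight_deg3_uniq da ay ax dy dx.
  have [//|/eqP dy3] := eqVneq (deg E y) 3.
  by have := full_nbr_deg (deg_gt3 (adj_cover ya) dy2 dy3) ya; rewrite da.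
have /card_gt0P [c /setIP[]] : 0 < #|nb y :&: D| by rewrite tight_deg3_nbh.
rewrite in_nbh => yc /deg2P dc; have cy : adj E c y by rewrite adjC.
have [c' [nc _ _]] := deg2_other dc cy; have [t [ntc yt c't]] := deg2_common nc dc.
have ny : nb y = [set a; b; c].
  apply: nbh3 => //; first by rewrite adjC.
  rewrite /= !inE negb_or nab; apply/and3P; split=> //; apply/eqP => e.
    by rewrite e dc in da.
  by rewrite e dc in db.
rewrite adjC in c't; move: yt; rewrite -in_nbh ny !inE (negPf ntc) orbF.
case/orP => /eqP et; rewrite et in c't.
  exact: no_cubic_cycle dx nx nab da db dy nyx ay yb yc dc nc c't.
exact: no_cubic_cycle dx nx' nba db da dy nyx yb ay yc dc nc c't.
Qed.

End TightFourCycles.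

Lemma four_cycle_dense : 4 * #|cover E| < 3 * #|E|.
Proof.
have [|//|tight] := graph_discharging gE (sends := four_cycle_sends) _ four_cycle_charge.
  by move=> u v /andP[].
by case: (no_tight_four_cycle tight).
Qed.

End FourCycles.

(** * Critical graphs are dense *)

Lemma is_graph_pairs n (E : {set {set 'I_n}}) : is_graph E = (E \subset pairs n).
Proof.
by apply/forall_inP/subsetP => gE e eE; have := gE e eE; rewrite inE.
Qed.

(* Strictly 1-balanced and without isolated vertices. *)
Definition balanced (k : nat) (EK : {set {set 'I_k}}) : Prop :=
  [/\ is_graph EK, cover EK = setT &
      forall I : {set 'I_k}, 1 < #|I| -> #|I| < k ->
        k.-1 * #|induced EK I| < #|EK| * #|I|.-1].

Lemma card_clique_edges k : 2 * #|clique_edges k| = k * k.-1.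
Proof.
have -> : #|clique_edges k| = 'C(k, 2) by rewrite /clique_edges /pairs card_draws card_ord.
by rewrite -mul_bin_diag bin1.
Qed.

Lemma clique_balanced k : 1 < k -> balanced (clique_edges k).
Proof.
move=> k2; split=> [||I I2 Ik]; first by rewrite is_graph_pairs.
  apply/setP => i; rewrite inE; apply/bigcupP.
  have /card_gt0P [j] : 0 < #|[set~ i]| by rewrite cardsC1 card_ord; lia.
  by rewrite !inE => nji; exists [set i; j]; rewrite ?set21 // inE cards2 (eq_sym i) nji.
have eI : #|induced (clique_edges k) I| = 'C(#|I|, 2).
  by rewrite -cards_draws; apply: eq_card => e; rewrite !inE andbC.
have cI : 2 * 'C(#|I|, 2) = #|I| * #|I|.-1 by rewrite -mul_bin_diag bin1.
rewrite eI -(ltn_pmul2l (isT : 0 < 2)) mulnCA cI (mulnA 2) card_clique_edges mulnA.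
rewrite ltn_pmul2r; last by rewrite -subn1 subn_gt0.
by rewrite mulnC ltn_pmul2r // -subn1 subn_gt0.
Qed.

Lemma ordS_closed k (I : {set 'I_k}) : I != set0 -> {in I, forall i, ordS i \in I} -> I = setT.
Proof.
move=> /set0Pn [i0 i0I] closed.
have it m : iter m (@ordS k) i0 \in I by elim: m => //= m IH; apply: closed.
have val_it m : val (iter m (@ordS k) i0) = (i0 + m) %% k.
  elim: m => [|m IH] /=; first by rewrite addn0 modn_small.
  by rewrite IH addnS -addn1 modnDml addn1.
apply/setP => j; rewrite inE.
have -> : j = iter (j + (k - i0)) (@ordS k) i0; last exact: it.
by apply/val_inj; rewrite val_it addnCA subnKC ?modnDr ?modn_small // ltnW.
Qed.

Lemma cycle_balanced k : 2 < k -> balanced (cycle_edges k).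
Proof.
move=> k3; split=> [||I I2 Ik]; first exact: is_graph_cycle.
  by apply/setP => i; rewrite inE (adj_cover (adj_ordS i)).
rewrite card_cycle_edges //; have lt : #|induced (cycle_edges k) I| < #|I|.
  apply: leq_ltn_trans (_ : #|[set i in I | ordS i \in I]| < _).
    apply: leq_trans (leq_imset_card (fun i : 'I_k => [set i; ordS i]) _).
    apply/subset_leq_card/subsetP => _ /setIdP [/imsetP [i _ ->]].
    by rewrite subUset !sub1set => iI; apply: imset_f; rewrite inE.
  apply/proper_card/properP; split; first by apply/subsetP => i /setIdP[].
  have [/exists_inP [i iI niI]|/exists_inPn all] := boolP [exists i in I, ordS i \notin I].
    by exists i; rewrite // inE iI.
  suff IT : I = setT by move: Ik; rewrite IT cardsT card_ord ltnn.
  apply: ordS_closed => [|i /all]; last by rewrite negbK.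
  by rewrite -card_gt0 ltnW.
by move: #|I| #|induced _ _| I2 lt k3; clear => s e; nia.
Qed.

Lemma clique_or_cycle_balanced k (EK : {set {set 'I_k}}) : 2 < k ->
  EK = clique_edges k \/ EK = cycle_edges k -> balanced EK.
Proof. by move=> k3 [->|->]; [apply/clique_balanced/ltnW|apply: cycle_balanced]. Qed.

Lemma balanced_neq0 k (EK : {set {set 'I_k}}) : 0 < k -> balanced EK -> EK != set0.
Proof.
move=> k0 [_ cK _]; apply/eqP => EK0; move: cK.
by rewrite EK0 /cover big_set0 => /setP /(_ (Ordinal k0)); rewrite !inE.
Qed.

Lemma cycle_edges3 : cycle_edges 3 = clique_edges 3.
Proof.
apply/eqP; rewrite eqEcard -is_graph_pairs is_graph_cycle // card_cycle_edges //.
by have := card_clique_edges 3; move: #|_|; clear; lia.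
Qed.

Definition pairing_degree (k : nat) : nat := if k == 3 then 2 else 1.

Lemma critical_dense k (EK : {set {set 'I_k}}) (T : finType) (E : {set {set T}}) : 2 < k ->
  EK = clique_edges k \/ EK = cycle_edges k -> is_graph E ->
  critical (pairing_degree k) EK E -> #|EK| * #|cover E| < k.-1 * #|E|.
Proof.
rewrite /pairing_degree => k3 EKE gE; have k0 : 0 < k.-1 by rewrite -subn1 subn_gt0 ltnW.
have clique_case : k * #|cover E| < 2 * #|E| ->
    #|clique_edges k| * #|cover E| < k.-1 * #|E|.
  have := card_clique_edges k; move: k0 #|clique_edges k| #|cover E| #|E|.
  by move: k.-1; clear => k'; nia.
have [ek|/eqP nk3] := eqVneq k 3.
  subst k; have -> : EK = clique_edges 3 by case: EKE => ->; rewrite ?cycle_edges3.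
  by move=> crE; apply/clique_case/triangle_dense.
have k4 : 3 < k by move: k3 nk3; clear; lia.
case: EKE => -> crE; first exact/clique_case/large_clique_dense.
rewrite card_cycle_edges //; have [k5|k5] := ltnP 4 k.
  exact: (critical_dense_min_deg2 (cycle_deg k3) gE crE k5).
have ek : k = 4 by apply/eqP; rewrite eqn_leq k4 k5.
by subst k; apply: four_cycle_dense.
Qed.

(** * Exploration of connected unions of copies *)

Section Exploration.
Variables (k : nat) (EK : {set {set 'I_k}}) (T : finType).
Hypotheses (bal : balanced EK) (k_gt1 : 1 < k).
Implicit Types (U E G : {set {set T}}) (f : {ffun 'I_k -> T}) (A : {set T}) (v : T).

Local Notation q := #|EK|.

Lemma cover_copy_edges f : cover (copy_edges EK f) = f @: setT.
Proof.
have [_ cK _] := bal; apply/setP => v; apply/bigcupP/imsetP => [[_ /imsetP [e eK ->]]|[i _ ->]].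
  by case/imsetP => i ie ->; exists i.
have /bigcupP [e eK ie] : i \in cover EK by rewrite cK inE.
by exists (f @: e); apply: imset_f.
Qed.

Definition new_vertices U f : {set T} := f @: setT :\: cover U.

Lemma cover_add_copy U f : cover (U :|: copy_edges EK f) = cover U :|: new_vertices U f.
Proof. by rewrite coverU cover_copy_edges /new_vertices setDE setUIr setUCr setIT. Qed.

Lemma card_cover_add_copy U f :
  #|cover (U :|: copy_edges EK f)| = #|cover U| + #|new_vertices U f|.
Proof.
rewrite cover_add_copy cardsU disjoint_setI0 ?cards0 ?subn0 //.
by rewrite disjoint_sym disjoints_subset /new_vertices setDE subsetIr.
Qed.

Lemma card_injective_image f : injective f -> #|f @: setT| = k.
Proof. by move=> fi; rewrite card_imset // cardsT card_ord. Qed.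

Lemma card_new_vertices_le U f v :
  injective f -> v \in f @: setT -> v \in cover U -> #|new_vertices U f| <= k.-1.
Proof.
move=> fi vf vU; apply: (@leq_trans #|(f @: setT) :\ v|).
  by apply/subset_leq_card/setDS; rewrite sub1set.
by have := card_injective_image fi; rewrite (cardsD1 v) vf; move: #|_|; clear; lia.
Qed.

Lemma card_add_copy U f : injective f ->
  #|U :|: copy_edges EK f| = #|U| + (q - #|copy_edges EK f :&: U|).
Proof.
move=> fi; rewrite cardsU setIC -(card_copy_edges EK fi) -addnBA //.
exact/subset_leq_card/subsetIl.
Qed.

Lemma card_old_edges_lt U f : injective f -> ~~ (copy_edges EK f \subset U) ->
  #|copy_edges EK f :&: U| < q.
Proof.
move=> fi nsub; rewrite -(card_copy_edges EK fi); apply: proper_card.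
by rewrite properE subsetIl; apply: contra nsub => /subset_trans; apply; apply: subsetIr.
Qed.

Lemma card_old_edges_le U f : injective f ->
  #|copy_edges EK f :&: U| <= #|induced EK (f @^-1: cover U)|.
Proof.
move=> fi; rewrite -(card_imset (induced EK _) (imset_inj fi)).
apply/subset_leq_card/subsetP => _ /setIP[/imsetP [e eK ->] eU]; apply: imset_f.
rewrite inE eK; apply/subsetP => i ie; rewrite inE; apply/bigcupP; exists (f @: e) => //.
exact: imset_f.
Qed.

Lemma card_preim_cover U f : injective f ->
  #|f @^-1: cover U| + #|new_vertices U f| = k.
Proof.
move=> fi; rewrite -[RHS](card_injective_image fi) -[RHS](cardsID (cover U)); congr (_ + _).
rewrite -(card_imset (f @^-1: cover U) fi); apply: eq_card => u.
rewrite in_setI; apply/imsetP/andP => [[i]|[/imsetP [i _ ->] iU]].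
  by rewrite inE => iU ->; rewrite imset_f.
by exists i; rewrite ?inE.
Qed.

(* A copy meeting [U] in a single vertex keeps the balance of vertices and edges; any other
   copy gains at least one edge, because [EK] is strictly balanced. *)
Lemma add_copy_balance U f v : injective f -> v \in f @: setT -> v \in cover U ->
  ~~ (copy_edges EK f \subset U) ->
  let d := #|new_vertices U f| in let t := #|copy_edges EK f :&: U| in
  d = k.-1 /\ t = 0 \/ q * d + (k.-1 * t).+1 <= k.-1 * q.
Proof.
move=> fi vf vU nsub d t; have [gK _ strict] := bal.
have tq := card_old_edges_lt fi nsub; have te := card_old_edges_le U fi.
have := card_preim_cover U fi; set I := f @^-1: cover U in te *; rewrite -/d -/t in tq te *.
have /imsetP [i0 _ ev] := vf; have i0I : i0 \in I by rewrite inE -ev.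
have I0 : 0 < #|I| by apply/card_gt0P; exists i0.
have kq : 0 < k.-1 by rewrite -subn1 subn_gt0.
have [I1|I1] := leqP #|I| 1 => sumI.
  left; split; first by move: sumI I1 I0; clear; lia.
  apply/eqP; rewrite -leqn0; apply: leq_trans te _; rewrite leqn0 cards_eq0.
  apply/eqP/setP => e; rewrite !inE; apply/negP => /andP[eK /subset_leq_card].
  by rewrite (card_edge gK eK) leqNgt ltnS I1.
right; have [Ik|Ik] := ltnP #|I| k; last first.
  have -> : d = 0 by move: sumI Ik; clear; lia.
  by rewrite muln0 add0n; move: tq kq; clear; nia.
have -> : k.-1 * q = q * d + q * #|I|.-1.
  by rewrite mulnC -mulnDr; congr (_ * _); move: sumI I0; clear; lia.
by rewrite leq_add2l; apply: leq_ltn_trans (strict I I1 Ik); rewrite leq_mul2l te orbT.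
Qed.

Variable L : nat.

Definition terminal U : bool := (q * #|cover U| < k.-1 * #|U|) || (L <= #|U|).

Definition extends U v f : bool :=
  [&& injectiveb f, v \in f @: setT & ~~ (copy_edges EK f \subset U)].

(* [A] is the set of vertices of the explored part [U] still to be processed. *)
Fixpoint explored (fuel : nat) G A U : bool :=
  terminal U ||
  match fuel with
  | 0 => false
  | m.+1 => if [pick v in A] is Some v then
      explored m G (A :\ v) U ||
      [exists f : {ffun 'I_k -> T},
        extends U v f && ((copy_edges EK f \subset G) &&
          explored m G (A :|: new_vertices U f) (U :|: copy_edges EK f))]
    else false
  end.

Definition processed E A U : Prop := forall f, embeds EK E f ->
  (exists2 i, f i \in cover U & f i \notin A) -> copy_edges EK f \subset U.

Lemma processed_add E A U f :
  processed E A U -> processed E (A :|: new_vertices U f) (U :|: copy_edges EK f).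
Proof.
move=> procU g gE [i]; rewrite cover_add_copy !in_setU negb_or => gi /andP[giA giN].
apply: subset_trans (subsetUl _ _); apply: procU gE _; exists i => //.
by case/orP: gi => // giN'; rewrite giN' in giN.
Qed.

Lemma processed_remove E A U v : processed E A U ->
  (forall f, embeds EK E f -> v \in f @: setT -> copy_edges EK f \subset U) ->
  processed E (A :\ v) U.
Proof.
move=> procU all f fE [i fiU]; rewrite in_setD1 negb_and negbK => /orP[/eqP e|fiA].
  by apply: all fE _; rewrite -e imset_f.
by apply: procU fE _; exists i.
Qed.

Lemma exploration_measure E A U f v : injective f -> v \in f @: setT -> v \in cover U ->
  ~~ (copy_edges EK f \subset U) -> U :|: copy_edges EK f \subset E ->
  k * (#|E| - #|U :|: copy_edges EK f|) + #|A :|: new_vertices U f| < k * (#|E| - #|U|) + #|A|.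
Proof.
move=> fi vf vU nsub /subset_leq_card.
have := leq_card_setU A (new_vertices U f) => -[cA _].
have := card_new_vertices_le fi vf vU; have := card_old_edges_lt fi nsub; rewrite card_add_copy //.
move: cA k_gt1; move: #|A :|: _| #|A| #|E| #|U| #|new_vertices U f| (q) #|copy_edges EK f :&: U|.
by clear; nia.
Qed.

Lemma explored_complete E G fuel A U : E \subset G -> connected_copies EK E ->
  q * #|cover E| < k.-1 * #|E| -> U \subset E -> U != set0 -> A \subset cover U ->
  processed E A U -> k * (#|E| - #|U|) + #|A| <= fuel -> explored fuel G A U.
Proof.
move=> sEG conn dense; have termE : terminal E by rewrite /terminal dense.
elim: fuel A U => [|m IH] A U sU U0 sA procU lem /=.
  suff -> : U = E by rewrite termE.
  apply/eqP; rewrite eqEcard sU -subn_eq0; move: lem; rewrite leqn0 addn_eq0 muln_eq0.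
  by move: k_gt1; case: (k) => [|k'] //= _ /andP[].
apply/orP; case: pickP => [v vA|A0]; last first.
  left; suff -> : U = E by [].
  by apply: conn => // f fE [i fi]; apply: procU fE _; exists i; rewrite ?A0.
have vU : v \in cover U := subsetP sA v vA; right; apply/orP.
have [/existsP [f /and3P[fE vf nfU]]|/existsPn no] := boolP [exists f : {ffun 'I_k -> T},
   [&& embeds EK E f, v \in f @: setT & ~~ (copy_edges EK f \subset U)]].
  have /embedsP [fi sf] := fE; have sUf : U :|: copy_edges EK f \subset E by rewrite subUset sU.
  right; apply/existsP; exists f;
    rewrite /extends vf nfU (subset_trans sf sEG) !andbT (introT (injectiveP f) fi).
  apply: IH => //; last 1 first.
  - by rewrite -ltnS; apply: leq_trans (exploration_measure A fi vf vU nfU sUf) lem.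
  - by apply/set0Pn; have /set0Pn [e eU] := U0; exists e; rewrite inE eU.
  - by rewrite cover_add_copy setSU.
  - exact: processed_add.
left; apply: IH => //.
- by apply: subset_trans sA; apply: subD1set.
- by apply: processed_remove => // f fE vf; have := no f; rewrite fE vf /= negbK.
- by move: lem; rewrite (cardsD1 v A) vA add1n addnS.
Qed.

End Exploration.

(** * The game *)

Lemma subset_of_card (T : finType) (A F : {set T}) m : A \subset F -> #|A| <= m -> m <= #|F| ->
  exists S : {set T}, [/\ A \subset S, S \subset F & #|S| = m].
Proof.
move=> sAF leAm lemF; have [d em] : exists d, m = #|A| + d by exists (m - #|A|); rewrite subnKC.
elim: d A sAF leAm em => [|d IH] A sAF leAm em; first by exists A; rewrite em addn0.
have /card_gt0P [x /setDP[xF xA]] : 0 < #|F :\: A|.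
  by rewrite cardsDS // subn_gt0; apply: leq_trans lemF; rewrite em addnS ltnS leq_addr.
have cxA : #|x |: A| + d = m by rewrite cardsU1 xA em add1n addSnnS.
have [|||S [sS SF cS]] := IH (x |: A).
- by rewrite subUset sub1set xF.
- by rewrite -cxA leq_addr.
- by rewrite cxA.
by exists S; split=> //; apply: subset_trans sS; apply: subsetUr.
Qed.

Section Partners.
Variables (T : finType) (P : {set {set T}}).
Hypothesis gP : is_graph P.
Implicit Types (M : {set T}) (v : T).

Definition partners M : {set T} := \bigcup_(v in M) nbh P v.

Lemma partners_add v M : partners (v |: M) = nbh P v :|: partners M.
Proof. by rewrite /partners bigcup_setU big_set1. Qed.

Lemma disjoint_partners M : ~~ hits P M -> [disjoint partners M & M].
Proof.
move=> nM; apply/pred0P => u /=; apply/negP => /andP[/bigcupP [v vM]]; rewrite in_nbh => vu uM.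
by case/negP: nM; apply: adj_hits vu vM uM.
Qed.

Lemma unhit_add v M : ~~ hits P M -> v \notin partners M -> ~~ hits P (v |: M).
Proof.
move=> nM vM; apply/negP => /(hits_adj gP) [x [y []]].
have nv u : u \in M -> ~~ adj P u v.
  by move=> uM; apply: contra vM => uv; apply/bigcupP; exists u; rewrite ?in_nbh.
move=> /setU1P[->|xM] /setU1P[->|yM] xy.
- by have := adj_neq gP xy; rewrite eqxx.
- by have := nv y yM; rewrite adjC xy.
- by have := nv x xM; rewrite xy.
by case/negP: nM; apply: adj_hits xy xM yM.
Qed.

End Partners.

Section Game.
Variables (h : nat) (EH : {set {set 'I_h}}) (n : nat) (EG : {set {set 'I_n}}) (b : nat).
Implicit Types M B S : {set 'I_n}.

Lemma disjoint_claim M B S : [disjoint M & B] -> S \subset ~: (M :|: B) ->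
  [disjoint M & B :|: S].
Proof.
move=> dMB SF; rewrite disjoint_sym disjoints_subset subUset -!disjoints_subset disjoint_sym dMB /=.
by rewrite disjoints_subset (subset_trans SF) // setCU subsetIl.
Qed.

Lemma breaker_wins_from (P : {set {set 'I_n}}) fuel M B turn : bounded_graph b P ->
  (forall M, ~~ hits P M -> ~~ contains_copy EH EG M) -> [disjoint M & B] -> ~~ hits P M ->
  (if turn then partners P M \subset B else #|partners P M :\: B| <= b) ->
  ~~ maker_wins_from EH EG b fuel M B turn.
Proof.
move=> /bounded_graphP [gP dP] noH.
elim: fuel M B turn => [|fuel IH] M B turn dMB nM inv /=; first exact: noH.
case: eqP => [_|/eqP /set0Pn [x0 x0F]]; first exact: noH.
case: turn inv => [sub|card].
  apply/exists_inPn => v; rewrite !inE negb_or => /andP[vM vB]; apply: IH.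
  - by rewrite disjoints_subset subUset sub1set inE vB -disjoints_subset.
  - by apply: unhit_add => //; apply: contra vB => /(subsetP sub).
  - apply: leq_trans (dP v); apply/subset_leq_card; rewrite partners_add setDUl subUset subsetDl.
    by move: sub; rewrite -setD_eq0 => /eqP ->; rewrite sub0set.
set F := ~: (M :|: B).
have sub : partners P M :\: B \subset F.
  apply/subsetP => u /setDP[uP uB]; rewrite !inE negb_or uB andbT.
  by rewrite (disjointFr (disjoint_partners nM) uP).
have [|S [sS SF cS]] := subset_of_card sub _ (geq_minr b #|F|).
  by rewrite leq_min card subset_leq_card.
apply/forallPn; exists S; rewrite negb_imply SF cS eqxx /=; apply: IH => //.
  exact: disjoint_claim.
apply/subsetP => u uP; rewrite inE; have [//|uB] := boolP (u \in B).
by apply: (subsetP sS); rewrite inE uB.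
Qed.

Lemma breaker_wins (P : {set {set 'I_n}}) maker_first : bounded_graph b P ->
  (forall M, ~~ hits P M -> ~~ contains_copy EH EG M) -> ~~ makers_win EH EG b maker_first.
Proof.
move=> bP noH; have [gP _] := bounded_graphP _ _ bP.
have p0 : partners P set0 = set0 by rewrite /partners big_set0.
apply: breaker_wins_from bP noH _ _ _.
- by rewrite -setI_eq0 setI0.
- apply/exists_inPn => e eP; rewrite subset0 -cards_eq0 (card_edge gP eP) //.
- by rewrite p0; case: maker_first; rewrite ?sub0set // set0D cards0.
Qed.

Section Maker.
Hypothesis b_gt0 : 0 < b.
Hypothesis dense : forall S, n <= b.+1 * #|S| + b -> contains_copy EH EG S.

Lemma maker_final M B : [disjoint M & B] -> ~: (M :|: B) = set0 -> #|B| <= b * #|M| + b ->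
  contains_copy EH EG M.
Proof.
move=> dMB F0 leB; apply: dense.
have : #|M :|: B| = n by rewrite -[RHS]card_ord -cardsT -(setCK (M :|: B)) F0 setC0.
by rewrite cardsU disjoint_setI0 // cards0 subn0; move: leB; clear; lia.
Qed.

Lemma maker_wins_from_dense fuel M B turn : [disjoint M & B] ->
  #|~: (M :|: B)| <= fuel -> #|B| <= b * #|M| + (if turn then b else 0) ->
  maker_wins_from EH EG b fuel M B turn.
Proof.
elim: fuel M B turn => [|fuel IH] M B turn dMB leF leB /=.
  apply: (maker_final dMB); first by apply/eqP; rewrite -cards_eq0 -leqn0.
  by apply: leq_trans leB _; case: turn; rewrite ?addn0 ?leq_addr.
case: eqP => [F0|/eqP /set0Pn [v vF]].
  by apply: (maker_final dMB F0); apply: leq_trans leB _; case: turn; rewrite ?addn0 ?leq_addr.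
have [vM vB] : v \notin M /\ v \notin B by apply/andP; move: vF; rewrite !inE negb_or.
case: turn leB => leB.
  apply/exists_inP; exists v => //; apply: IH.
  - by rewrite disjoints_subset subUset sub1set inE vB -disjoints_subset.
  - have -> : ~: (v |: M :|: B) = ~: (M :|: B) :\ v.
      by rewrite -setUA setCU setDE setIC.
    by move: leF; rewrite (cardsD1 v (~: (M :|: B))) vF.
  - by rewrite cardsU1 vM mulnDr muln1 addn0 addnC.
apply/forallP => S; apply/implyP => /andP[SF /eqP cS]; apply: IH.
- exact: disjoint_claim.
- rewrite setUA setCU -setDE cardsDS // cS; have : 0 < #|~: (M :|: B)| by apply/card_gt0P; exists v.
  by move: leF b_gt0; move: #|~: _|; clear; lia.
- rewrite addn0 in leB; apply: leq_trans (leq_card_setU _ _) _.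
  by rewrite cS; apply: leq_add => //; apply: geq_minl.
Qed.

Lemma maker_wins_dense maker_first : makers_win EH EG b maker_first.
Proof.
apply: maker_wins_from_dense.
- by rewrite -setI_eq0 set0I.
- by apply: leq_trans (max_card _) _; rewrite card_ord.
- by rewrite cards0.
Qed.

End Maker.

End Game.

Section PairingStrategy.
Variables (k b h : nat) (EK : {set {set 'I_k}}) (EH : {set {set 'I_h}}).
Variable phi : {ffun 'I_k -> 'I_h}.
Hypotheses (phiE : embeds EK EH phi) (b_ge : pairing_degree k <= b).

Lemma contains_copy_set n (G : {set {set 'I_n}}) (M : {set 'I_n}) :
  contains_copy EH G M -> exists2 S, copy_set EK G S & S \subset M.
Proof.
have /embedsP [phi_inj /copy_edges_subP phiEH] := phiE.
move=> /existsP [f /and3P[/injectiveP fi /forallP fM /forall_inP fE]].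
pose g := [ffun i => f (phi i)]; exists (g @: setT); last first.
  by apply/subsetP => _ /imsetP [i _ ->]; rewrite ffunE.
apply/copy_setP; exists g => //; apply/embedsP; split.
  by move=> i j; rewrite !ffunE => /fi /phi_inj.
apply/copy_edges_subP => e eK; have -> : g @: e = f @: (phi @: e).
  by rewrite -imset_comp; apply: eq_imset => i; rewrite ffunE.
exact/fE/phiEH.
Qed.

Lemma pairable_breaker_wins n (G : {set {set 'I_n}}) maker_first :
  pairable b EK G -> ~~ makers_win EH G b maker_first.
Proof.
move=> /pairableP [P bP hP]; apply: (breaker_wins _ bP) => M.
by apply: contra => /contains_copy_set [S /hP /exists_inP [e eP eS] sSM];
  apply/exists_inP; exists e => //; apply: subset_trans sSM.
Qed.

Lemma maker_win_dense n (G : {set {set 'I_n}}) maker_first : 2 < k -> balanced EK ->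
  EK = clique_edges k \/ EK = cycle_edges k -> is_graph G ->
  makers_win EH G b maker_first -> exists E : {set {set 'I_n}},
     [/\ E \subset G, connected_copies EK E, #|EK| * #|cover E| < k.-1 * #|E| &
        exists f, embeds EK E f].
Proof.
move=> k3 [_ cK _] EKE gG win.
have npG : ~~ pairable (pairing_degree k) EK G.
  apply: contraTN win => /pairableP [P bP hP]; apply: pairable_breaker_wins.
  apply/pairableP; exists P => //; have /bounded_graphP [gP dP] := bP.
  by apply/bounded_graphP; split=> // v; apply: leq_trans (dP v) b_ge.
have [E crE sEG] := exists_critical npG; have gE := is_graphS sEG gG.
exists E; split=> //; first exact: critical_connected crE gE cK.
  exact: critical_dense k3 EKE gE crE.
by have [S /copy_setP [f fE _]] := critical_copy crE; exists f.
Qed.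

End PairingStrategy.

Section RandomGraphs.
Import ring lra.
Import Order.TTheory GRing.Theory Num.Theory.
Local Open Scope ring_scope.

(** * Random subsets *)

Section RandomSubset.
Variables (R : realDomainType) (T : finType) (p : R).
Hypothesis p01 : 0 <= p <= 1.
Implicit Types (W X Y A : {set T}) (F G : {set T} -> bool) (g : {set T} -> R).

Let p0 : 0 <= p. Proof. by case/andP: p01. Qed.
Let q0 : 0 <= 1 - p. Proof. by rewrite subr_ge0; case/andP: p01. Qed.

Definition weight W X : R := p ^+ #|X| * (1 - p) ^+ (#|W| - #|X|).

Definition Pr W F : R := \sum_(X in powerset W | F X) weight W X.

Definition mean W g : R := \sum_(X in powerset W) weight W X * g X.

Lemma weight_ge0 W X : 0 <= weight W X.
Proof. by apply: mulr_ge0; apply: exprn_ge0. Qed.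

Lemma Pr_ge0 W F : 0 <= Pr W F.
Proof. by apply: sumr_ge0 => X _; apply: weight_ge0. Qed.

Lemma eq_Pr W F G : (forall X, X \subset W -> F X = G X) -> Pr W F = Pr W G.
Proof. by move=> e; apply: eq_bigl => X; rewrite inE; case sX: (X \subset W); rewrite //= e. Qed.

Lemma Pr_mono W F G : (forall X, X \subset W -> F X -> G X) -> Pr W F <= Pr W G.
Proof.
move=> sFG; rewrite /Pr [leLHS]big_mkcondr [leRHS]big_mkcondr /=; apply: ler_sum => X.
rewrite inE => sX; have := sFG X sX; case: (F X) => [/(_ isT) -> //|_].
by case: (G X); rewrite ?weight_ge0.
Qed.

Lemma Pr_split W F G : Pr W F = Pr W (fun X => F X && G X) + Pr W (fun X => F X && ~~ G X).
Proof. by rewrite /Pr (bigID G) /=; congr (_ + _); apply: eq_bigl => X; rewrite andbA. Qed.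

Lemma Pr_or W F G : Pr W (fun X => F X || G X) <= Pr W F + Pr W G.
Proof.
rewrite (Pr_split W (fun X => F X || G X) F).
apply: lerD; apply: Pr_mono => X _; first by move=> /andP[].
by case: (F X) => //=; rewrite ?andbT.
Qed.

Lemma Pr_has (I : Type) W (s : seq I) (F : I -> {set T} -> bool) :
  Pr W (fun X => has (fun i => F i X) s) <= \sum_(i <- s) Pr W (F i).
Proof.
elim: s => [|i s IH].
  by rewrite big_nil /Pr big_pred0 // => X; rewrite andbF.
by rewrite big_cons; apply: le_trans (Pr_or W (F i) _) _; rewrite lerD2l.
Qed.

Lemma Pr_exists (I : finType) W (Q : pred I) (F : I -> {set T} -> bool) :
  Pr W (fun X => [exists i, Q i && F i X]) <= \sum_(i | Q i) Pr W (F i).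
Proof.
rewrite -big_enum; apply: le_trans (Pr_has _ _ _); apply: Pr_mono => X _.
by move=> /existsP [i /andP[Qi Fi]]; apply/hasP; exists i; rewrite // mem_enum.
Qed.

Definition free_of t F : Prop := forall X, F (t |: X) = F X.

Lemma Pr_in t W F : t \in W -> free_of t F ->
  Pr W (fun X => (t \in X) && F X) = p * Pr (W :\ t) F.
Proof.
move=> tW freeF; rewrite /Pr mulr_sumr.
rewrite (reindex_onto (fun Y => t |: Y) (fun X => X :\ t)) /=; last first.
  by move=> X /andP[_ /andP[tX _]]; rewrite setD1K.
apply: eq_big => [Y|Y].
  rewrite !inE eqxx freeF subUset sub1set tW /= subsetD1.
  have [tY|tY] := boolP (t \in Y); last by rewrite setU1K // eqxx !andbT.
  rewrite andbF; apply/negP => /andP[_ /eqP e].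
  by have := setD11 t (t |: Y); rewrite e tY.
rewrite !inE subUset sub1set tW /= => /andP[/andP[sY _] /eqP e].
have tY : t \notin Y by rewrite -e setD11.
by rewrite /weight cardsU1 tY exprS -!mulrA (cardsD1 t W) tW.
Qed.

Lemma Pr_out t W F : t \in W -> free_of t F ->
  Pr W (fun X => F X && ~~ (t \in X)) = (1 - p) * Pr (W :\ t) F.
Proof.
move=> tW freeF; rewrite /Pr mulr_sumr; apply: eq_big => [Y|Y].
  by rewrite !inE subsetD1 -andbA [F Y && _]andbC.
rewrite !inE => /andP[sY /andP[_ tY]].
have sY' : Y \subset W :\ t by rewrite subsetD1 sY.
rewrite /weight mulrCA -exprS (cardsD1 t W) tW add1n subSn //.
exact: subset_leq_card.
Qed.

Lemma Pr_free t W F : t \in W -> free_of t F -> Pr W F = Pr (W :\ t) F.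
Proof.
move=> tW freeF; rewrite (Pr_split W F (fun X => t \in X)) Pr_out //.
rewrite (@eq_Pr W _ (fun X => (t \in X) && F X)) ?Pr_in //; last by move=> X _; rewrite andbC.
by rewrite -mulrDl addrC subrK mul1r.
Qed.

Lemma Pr_true W : Pr W xpredT = 1.
Proof.
elim: {W}_.+1 {-2}W (ltnSn #|W|) => // m IH W ltW.
have [->|/set0Pn [t tW]] := eqVneq W set0.
  rewrite /Pr (big_pred1 set0) ?/weight ?cards0 ?expr0 ?mulr1 // => X.
  by rewrite inE andbT subset0.
by rewrite (Pr_free tW) // IH //; move: ltW; rewrite (cardsD1 t W) tW.
Qed.

Lemma Pr_sub A W F : A \subset W -> (forall X, F (X :|: A) = F X) ->
  Pr W (fun X => (A \subset X) && F X) = p ^+ #|A| * Pr W F.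
Proof.
elim: {A}_.+1 {-2}A (ltnSn #|A|) F => // m IH A ltA F sA freeF.
have [->|/set0Pn [t tA]] := eqVneq A set0.
  by rewrite cards0 mul1r; apply: eq_Pr => X _; rewrite sub0set.
have tW : t \in W := subsetP sA t tA.
have ft : free_of t F.
  move=> X; rewrite -freeF -[RHS]freeF; congr F; apply/setP => u; rewrite !inE.
  by case: eqP => // ->; rewrite tA !orbT.
have sAt : A :\ t \subset W by apply: subset_trans sA; apply: subD1set.
have fAt X : F (X :|: A :\ t) = F X by rewrite -ft setUCA setD1K.
have fg : free_of t (fun X => (A :\ t \subset X) && F X).
  by move=> X; rewrite ft !subDset setUA setUid.
rewrite (@eq_Pr W _ (fun X => (t \in X) && ((A :\ t \subset X) && F X))); last first.
  by move=> X _; rewrite andbA -{1}(setD1K tA) subUset sub1set.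
rewrite Pr_in // -Pr_free // IH // ?(cardsD1 t A) ?tA ?exprS ?mulrA //.
by move: ltA; rewrite (cardsD1 t A) tA.
Qed.

Lemma Pr_subset A W : A \subset W -> Pr W (fun X => A \subset X) = p ^+ #|A|.
Proof.
move=> sA; rewrite -[RHS]mulr1 -(Pr_true W) -(@Pr_sub A W xpredT) //.
by apply: eq_Pr => X _; rewrite andbT.
Qed.

Lemma Pr_sub_decreasing A W F : A \subset W -> (forall X Y, X \subset Y -> F Y -> F X) ->
  Pr W (fun X => (A \subset X) && F X) <= p ^+ #|A| * Pr W F.
Proof.
move=> sA dec.
rewrite (@eq_Pr W _ (fun X => (A \subset X) && F (X :|: A))); last first.
  by move=> X _; case: (boolP (A \subset X)) => //= sAX; rewrite (setUidPl sAX).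
rewrite (@Pr_sub A W (fun X => F (X :|: A))) //; last by move=> X; rewrite -setUA setUid.
apply: ler_wpM2l; first exact: exprn_ge0.
by apply: Pr_mono => X _; apply: dec; apply: subsetUl.
Qed.

Lemma mean_sum (I : finType) W (F : I -> {set T} -> bool) (c : I -> R) :
  mean W (fun X => \sum_(i | F i X) c i) = \sum_i Pr W (F i) * c i.
Proof.
rewrite /mean; under eq_bigr => X _ do rewrite mulr_sumr.
rewrite (exchange_big_dep xpredT) //=; apply: eq_bigr => i _.
by rewrite -mulr_suml; congr (_ * _).
Qed.

Lemma meanB W g1 g2 : mean W (fun X => g1 X - g2 X) = mean W g1 - mean W g2.
Proof. by rewrite /mean -sumrB; apply: eq_bigr => X _; rewrite mulrBr. Qed.

Lemma exists_ge_mean W g : exists X : {set T}, mean W g <= g X.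
Proof.
have W0 : set0 \in powerset W by rewrite inE sub0set.
have [X _ maxX] := arg_maxP g W0.
exists X; apply: le_trans (_ : \sum_(Y in powerset W) weight W Y * g X <= _).
  by apply: ler_sum => Y /maxX le; apply: ler_wpM2l le; apply: weight_ge0.
have total : \sum_(Y in powerset W) weight W Y = 1.
  by rewrite -[RHS](Pr_true W); apply: eq_bigl => Y; rewrite andbT.
by rewrite -mulr_suml total mul1r.
Qed.

End RandomSubset.

(** * Janson's inequality *)

(* Averaging over a random subset [J] in which every index is kept with probability [th]. *)
Lemma sparse_subfamily (R : realDomainType) (I : finType) (th : R) (a : I -> R) (c : I -> I -> R) :
  0 <= th <= 1 ->
  exists J : {set I}, th * (\sum_i a i) - th ^+ 2 * (\sum_i \sum_(j | j != i) c i j) <=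
    \sum_(i in J) a i - \sum_(i in J) \sum_(j in J | j != i) c i j.
Proof.
move=> th01; have [J leJ] := exists_ge_mean th01 [set: I] (fun J : {set I} =>
  \sum_(i in J) a i - \sum_(u : I * I | [&& u.1 \in J, u.2 \in J & u.2 != u.1]) c u.1 u.2).
exists J; rewrite [X in _ <= _ - X]pair_big_dep /=.
apply: le_trans leJ; rewrite meanB !mean_sum le_eqVlt; apply/orP; left; apply/eqP; congr (_ - _).
  rewrite mulr_sumr; apply: eq_bigr => i _; congr (_ * _).
  rewrite (@eq_Pr _ _ _ _ _ (fun J : {set I} => [set i] \subset J)) => [|J' _];
    last by rewrite sub1set.
  by rewrite Pr_subset ?subsetT // cards1 expr1.
rewrite pair_big_dep /= mulr_sumr big_mkcond /=; apply: eq_bigr => -[i j] _ /=.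
have [->|nji] := eqVneq j i; first by rewrite /Pr big_pred0 ?mul0r // => X; rewrite !andbF.
congr (_ * _); rewrite (@eq_Pr _ _ _ _ _ (fun J : {set I} => [set i; j] \subset J)) => [|J' _].
  by rewrite Pr_subset ?subsetT // cards2 eq_sym nji.
by rewrite subUset !sub1set andbT.
Qed.

Section Janson.
Variables (R : realType) (T I : finType) (p : R) (W : {set T}) (A : I -> {set T}).
Hypothesis p01 : 0 <= p <= 1.
Hypothesis AW : forall i, A i \subset W.
Implicit Types (s : seq I) (X Y : {set T}) (i j : I).

Let p0 : 0 <= p. Proof. by case/andP: p01. Qed.

Definition none s X : bool := all (fun i => ~~ (A i \subset X)) s.
Definition meets i j : bool := ~~ [disjoint A i & A j].
Definition gain i s : R := p ^+ #|A i| - \sum_(j <- s | meets i j) p ^+ #|A i :|: A j|.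

Lemma none_decreasing s X Y : X \subset Y -> none s Y -> none s X.
Proof.
move=> sXY /allP nY; apply/allP => i /nY; apply: contra => sA.
exact: subset_trans sXY.
Qed.

Lemma none_filter s (Q : pred I) X : none s X -> none (filter Q s) X.
Proof. by move=> /allP n; apply/allP => i; rewrite mem_filter => /andP[_ /n]. Qed.

Lemma Pr_none_disjoint i s :
  Pr p W (fun X => (A i \subset X) && none [seq j <- s | ~~ meets i j] X) =
  p ^+ #|A i| * Pr p W (none [seq j <- s | ~~ meets i j]).
Proof.
apply: Pr_sub => // X; apply: eq_in_all => j; rewrite mem_filter negbK => /andP[dij _].
congr (~~ _); apply/idP/idP => [/subsetP sub|/subset_trans]; last by apply; apply: subsetUl.
apply/subsetP => t tj; have := sub t tj; rewrite inE => /orP[//|ti].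
by have := disjointFr dij ti; rewrite tj.
Qed.

Lemma gain_le i s :
  gain i s * Pr p W (none s) <= Pr p W (fun X => (A i \subset X) && none s X).
Proof.
have [neg|pos] := ltrP (gain i s) 0.
  by apply: le_trans (Pr_ge0 p01 _ _); apply: mulr_le0_ge0; [exact: ltW|exact: Pr_ge0].
pose far := [seq j <- s | ~~ meets i j]; pose near := [seq j <- s | meets i j].
apply: le_trans (_ : gain i s * Pr p W (none far) <= _).
  by apply: ler_wpM2l => //; apply: (Pr_mono p01) => X _; apply: none_filter.
rewrite mulrBl -Pr_none_disjoint lerBlDr.
apply: le_trans (_ : Pr p W (fun X => ((A i \subset X) && none s X) ||
    has (fun j => (A i :|: A j \subset X) && none far X) near) <= _).
  apply: (Pr_mono p01) => X _ /andP[Ai nfar]; rewrite Ai /=.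
  have [//|] := boolP (none s X); rewrite -has_predC => /hasP [j js /=]; rewrite negbK => Aj.
  apply/hasP; exists j; last by rewrite subUset Ai Aj nfar.
  rewrite mem_filter js andbT; have [//|nm] := boolP (meets i j).
  by move/allP: nfar => /(_ j); rewrite mem_filter nm js Aj => /(_ isT).
apply: le_trans (Pr_or p01 _ _ _) _; rewrite lerD2l.
apply: le_trans (Pr_has p01 _ _ _) _; rewrite /near big_filter mulr_suml.
apply: ler_sum => j _; apply: (Pr_sub_decreasing p01); first by rewrite subUset !AW.
exact: none_decreasing.
Qed.

Lemma janson_step i s : Pr p W (none (i :: s)) <= (1 - gain i s) * Pr p W (none s).
Proof.
rewrite mulrBl mul1r lerBrDl [leRHS](Pr_split p W (none s) (fun X => A i \subset X)).
apply: lerD; first apply: le_trans (gain_le i s) _.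
  by rewrite le_eqVlt; apply/orP; left; apply/eqP/eq_Pr => X _; rewrite andbC.
by rewrite le_eqVlt; apply/orP; left; apply/eqP/eq_Pr => X _; rewrite /= andbC.
Qed.

Fixpoint total_gain s : R := if s is i :: s' then gain i s' + total_gain s' else 0.

Lemma janson_seq s : Pr p W (none s) <= expR (- total_gain s).
Proof.
elim: s => [|i s IH] /=; first by rewrite oppr0 expR0 (@eq_Pr _ _ _ _ _ xpredT) // Pr_true.
apply: le_trans (janson_step i s) _; rewrite [- (gain i s + _)]opprD expRD.
apply: le_trans (ler_wpM2r (Pr_ge0 p01 _ _) (expR_ge1Dx _)) _.
by apply: ler_wpM2l IH; apply: expR_ge0.
Qed.

Lemma total_gain_ge s : uniq s ->
  \sum_(i <- s) p ^+ #|A i| -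
  \sum_(i <- s) \sum_(j <- s | (j != i) && meets i j) p ^+ #|A i :|: A j| <= total_gain s.
Proof.
elim: s => [|i s IH] /=; first by rewrite !big_nil subrr.
case/andP => nis us; rewrite !big_cons /gain eqxx /=.
have tail : \sum_(l <- s) \sum_(j <- s | (j != l) && meets l j) p ^+ #|A l :|: A j| <=
    \sum_(l <- s) \sum_(j <- i :: s | (j != l) && meets l j) p ^+ #|A l :|: A j|.
  apply: ler_sum => l _; rewrite big_cons; case: ifP => // _.
  by rewrite lerDr exprn_ge0.
have -> : \sum_(j <- s | (j != i) && meets i j) p ^+ #|A i :|: A j| =
    \sum_(j <- s | meets i j) p ^+ #|A i :|: A j|.
  rewrite big_seq_cond [RHS]big_seq_cond; apply: eq_bigl => j.
  case: (boolP (j \in s)) => //= js; have -> // : j != i.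
  by apply: contraNneq nis => <-.
rewrite opprD addrACA; apply: lerD => //; apply: le_trans (IH us).
by rewrite lerD2l lerN2.
Qed.

Lemma janson th : 0 <= th <= 1 ->
  Pr p W (fun X => [forall i, ~~ (A i \subset X)]) <=
  expR (- (th * (\sum_i p ^+ #|A i|) -
           th ^+ 2 * (\sum_i \sum_(j | (j != i) && meets i j) p ^+ #|A i :|: A j|))).
Proof.
move=> th01; pose c i j := if meets i j then p ^+ #|A i :|: A j| else 0.
have [J leJ] := sparse_subfamily (fun i => p ^+ #|A i|) c th01.
apply: le_trans (_ : Pr p W (none (enum J)) <= _).
  by apply: (Pr_mono p01) => X _ /forallP h; apply/allP => i _.
apply: le_trans (janson_seq _) _; rewrite ler_expR lerN2.
apply: le_trans (total_gain_ge (enum_uniq _)); rewrite big_enum /=.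
have eqc (Q : pred I) i : \sum_(j | Q j && ((j != i) && meets i j)) p ^+ #|A i :|: A j| =
    \sum_(j | Q j && (j != i)) c i j.
  by rewrite /c -big_mkcondr; apply: eq_bigl => j; rewrite andbA.
under [X in _ - _ * X]eq_bigr => i _ do rewrite (eqc xpredT i).
apply: le_trans leJ _; rewrite lerD2l lerN2 big_enum /=; apply: ler_sum => i _.
by rewrite big_enum_cond (eqc (mem J) i).
Qed.

End Janson.

(** * First moment bound for dense unions *)

Lemma card_cover_le (T : finType) (E : {set {set T}}) : is_graph E -> (#|cover E| <= 2 * #|E|)%N.
Proof.
move=> gE; apply: leq_trans (leq_card_cover E) _.
rewrite mulnC -sum_nat_const; apply: leq_sum => e eE.
by rewrite (card_edge gE eE).
Qed.

Lemma sum_prod_ffun (R : comNzRingType) (I T : finType) (g : T -> R) :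
  \sum_(f : {ffun I -> T}) \prod_i g (f i) = (\sum_u g u) ^+ #|I|.
Proof. by rewrite -(bigA_distr_bigA (fun _ u => g u)) prodr_const. Qed.

Section ExplorationBound.
Variables (k : nat) (EK : {set {set 'I_k}}).
Hypotheses (bal : balanced EK) (k_gt1 : (1 < k)%N).
Local Notation q := #|EK|.
Variables (R : realFieldType) (n L : nat) (p z : R).
Hypothesis p01 : 0 <= p <= 1.
Hypothesis z01 : 0 < z <= 1.
(* [z] is n^(-1/q), hence [p_le] below reads p <= x/4 * n^(-(k-1)/q). *)
Hypothesis nz : n%:R * z ^+ q = 1.
Hypothesis n_le : (n <= 2 ^ L)%N.

Variables x D : R.
Hypothesis x_gt0 : 0 < x.
Hypothesis x_small : x * 3 ^+ k <= 4^-1.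
Hypothesis D_ge1 : 1 <= D.
Hypothesis D_large : D^-1 * (2 * L + 2)%:R ^+ k <= 4^-1.
Hypothesis p_le : p <= x / 4 * z ^+ k.-1.

Implicit Types (U E G : {set {set 'I_n}}) (f : {ffun 'I_k -> 'I_n}) (A V : {set 'I_n}).

Let z_gt0 : 0 < z. Proof. by case/andP: z01. Qed.
Let z_le1 : z <= 1. Proof. by case/andP: z01. Qed.
Let p_ge0 : 0 <= p. Proof. by case/andP: p01. Qed.
Let D_gt0 : 0 < D. Proof. exact: lt_le_trans D_ge1. Qed.

Let x_le1 : x <= 1.
Proof.
have c1 : 1 <= 3 ^+ k :> R by rewrite exprn_ege1 // ler1n.
have : x <= x * 3 ^+ k by rewrite ler_peMr // ltW.
by move=> le; apply: le_trans le (le_trans x_small _); lra.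
Qed.

Let q_gt0 : (0 < q)%N.
Proof. by rewrite card_gt0 (balanced_neq0 _ bal) // ltnW. Qed.

Let n_gt0 : (0 < n)%N.
Proof. by rewrite lt0n; apply: contra_eq_neq nz => ->; rewrite mul0r eq_sym oner_neq0. Qed.

Let z_exp a b : (a <= b)%N -> z ^+ b <= z ^+ a.
Proof. by move=> ab; apply: ler_wiXn2l => //; apply: ltW. Qed.

Definition slack U : nat := (q * #|cover U| + 1 - k.-1 * #|U|)%N.

(* Bounds the probability that an exploration in state [(A, U)] ends in a terminal set. *)
Definition potential A U : R :=
  z ^+ (q * #|cover U| + 1) * 2 ^+ #|A| * x ^+ #|U| * D ^+ slack U.

Lemma potential_ge0 A U : 0 <= potential A U.
Proof. by rewrite !mulr_ge0 // exprn_ge0 // ltW. Qed.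

Lemma potential_ge A U : z ^+ (q * #|cover U| + 1) * x ^+ #|U| <= potential A U.
Proof.
have a1 : 1 <= 2 ^+ #|A| :> R by rewrite exprn_ege1 // ler1n.
have d1 : 1 <= D ^+ slack U by rewrite exprn_ege1.
rewrite /potential [X in _ <= X * _]mulrAC -[leRHS]mulrA; apply: ler_peMr; last exact: mulr_ege1.
by rewrite mulr_ge0 // exprn_ge0 // ltW.
Qed.

(* A state of the exploration starts with a single copy and never loses balance. *)
Definition sparse_state U : bool := (q * #|cover U| <= k.-1 * #|U| + q)%N.

Lemma terminal_exp U : sparse_state U -> terminal EK L U ->
  z ^+ (k.-1 * #|U|) / 4 ^+ #|U| <= z ^+ (q * #|cover U| + 1).
Proof.
move=> inv /orP[lt|big].
  apply: le_trans (z_exp (_ : q * #|cover U| + 1 <= k.-1 * #|U|)%N); last by rewrite addn1.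
  by rewrite ler_piMr ?exprn_ge0 ?(ltW z_gt0) // invf_le1 ?exprn_gt0 // exprn_ege1 // ler1n.
have n_neq0 : n%:R != 0 :> R by rewrite pnatr_eq0 -lt0n.
have zn : z ^+ q = n%:R^-1 by apply: (mulfI n_neq0); rewrite nz divff.
have small : (4 ^+ #|U|)^-1 <= z ^+ (q + 1).
  apply: le_trans (_ : z ^+ (q + q) <= _); last by apply: z_exp; rewrite leq_add2l.
  rewrite exprD zn -invfM lef_pV2 ?posrE ?exprn_gt0 ?mulr_gt0 ?ltr0n //.
  rewrite -natrM -natrX ler_nat; apply: leq_trans (leq_mul n_le n_le) _.
  by rewrite -expnD addnn -muln2 mulnC expnM leq_exp2l.
apply: le_trans (ler_wpM2l (exprn_ge0 _ (ltW z_gt0)) small) _.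
by rewrite -exprD; apply: z_exp; move: inv; rewrite /sparse_state; clear; lia.
Qed.

Lemma terminal_bound A U : sparse_state U -> terminal EK L U -> p ^+ #|U| <= potential A U.
Proof.
move=> inv term; apply: le_trans (potential_ge A U).
apply: le_trans (_ : (x / 4 * z ^+ k.-1) ^+ #|U| <= _).
  by rewrite lerXn2r // ?nnegrE // mulr_ge0 ?exprn_ge0 ?divr_ge0 // ltW.
rewrite exprMn -exprM expr_div_n -mulrA [leRHS]mulrC [_^-1 * _]mulrC.
by apply: ler_wpM2l (terminal_exp inv term); rewrite exprn_ge0 // ltW.
Qed.

Definition escape V (u : 'I_n) : R := if u \in V then 1 else 2 * z ^+ q.

Let escape_base_ge0 : 0 <= 2 * z ^+ q.
Proof. by rewrite mulr_ge0 // exprn_ge0 // ltW. Qed.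

Lemma escape_ge0 V u : 0 <= escape V u.
Proof. by rewrite /escape; case: ifP. Qed.

Lemma prod_escape f V : injective f ->
  \prod_i escape V (f i) = (2 * z ^+ q) ^+ #|f @: setT :\: V|.
Proof.
rewrite /escape => fi; rewrite (bigID (fun i => f i \in V)) /= big1 ?mul1r => [|i ->] //.
rewrite (eq_bigr (fun=> 2 * z ^+ q)) => [|i /negPf -> //]; rewrite prodr_const; congr (_ ^+ _).
rewrite -(card_imset _ fi); apply: eq_card => u; rewrite in_setD.
apply/imsetP/andP => [[i iV ->]|[uV /imsetP [i _ e]]]; first by rewrite imset_f.
by exists i; rewrite // unfold_in /= -e.
Qed.

Lemma sum_escape V : \sum_u escape V u <= #|V|%:R + 2.
Proof.
rewrite /escape (bigID (mem V)) /=; apply: lerD.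
  by rewrite (eq_bigr (fun=> 1)) => [|u ->//]; rewrite sumr_const.
apply: le_trans (_ : \sum_(u : 'I_n) 2 * z ^+ q <= _); last first.
  by rewrite sumr_const card_ord -[_ *+ n]mulr_natl mulrCA nz mulr1.
rewrite [leRHS](bigID (mem V)) /= [leRHS]addrC (eq_bigr (fun=> 2 * z ^+ q)) => [|u /negPf -> //].
by rewrite lerDl; apply: sumr_ge0.
Qed.

Lemma sum_prod_escape V m : (#|V| + 2 <= m)%N ->
  \sum_(f : {ffun 'I_k -> 'I_n}) \prod_i escape V (f i) <= m%:R ^+ k.
Proof.
move=> Vm; rewrite sum_prod_ffun card_ord lerXn2r ?nnegrE //.
  by apply: sumr_ge0 => u _; apply: escape_ge0.
by apply: le_trans (sum_escape V) _; rewrite -(natrD _ _ 2) ler_nat.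
Qed.

(* A copy through [v] either meets [U] in [v] alone, which the first summand pays for, or
   consumes slack. *)
Definition extension_cost U v f : R :=
  x * (\prod_i escape [set v] (f i)) + D^-1 * \prod_i escape (cover U) (f i).

Lemma extension_cost_ge0 U v f : 0 <= extension_cost U v f.
Proof.
by apply: addr_ge0; apply: mulr_ge0; rewrite ?invr_ge0 ?(ltW x_gt0) ?(ltW D_gt0) //;
  apply: prodr_ge0 => i _; apply: escape_ge0.
Qed.

Lemma sum_extension_cost U v : is_graph U -> ~~ terminal EK L U ->
  \sum_f extension_cost U v f <= 2^-1.
Proof.
move=> gU; rewrite negb_or -!ltnNge => /andP[_ ltL].
rewrite big_split /= -!mulr_sumr; have -> : 2^-1 = 4^-1 + 4^-1 :> R by field.
apply: lerD; [apply: le_trans x_small|apply: le_trans D_large]; apply: ler_wpM2l;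
  rewrite ?invr_ge0 ?(ltW x_gt0) ?(ltW D_gt0) //; apply: sum_prod_escape.
  by rewrite cards1.
by rewrite leq_add2r; apply: leq_trans (card_cover_le gU) _; rewrite leq_mul2l (ltnW ltL).
Qed.

Lemma potential_add_le A U f (X dl : R) : injective f -> 0 <= X -> 0 <= dl ->
  x ^+ (q - #|copy_edges EK f :&: U|) <= X ->
  D ^+ slack (U :|: copy_edges EK f) <= D ^+ slack U * dl ->
  potential (A :|: new_vertices U f) (U :|: copy_edges EK f) <=
    potential A U * (X * dl * (2 * z ^+ q) ^+ #|new_vertices U f|).
Proof.
move=> fi X0 dl0 leX ledl; rewrite /potential (card_cover_add_copy bal) (card_add_copy _ _ fi).
set d := #|new_vertices U f|; rewrite mulnDr addnAC [z ^+ (_ + q * d)]exprD exprM.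
rewrite [x ^+ (_ + _)]exprD.
have le2 : 2 ^+ #|A :|: new_vertices U f| <= 2 ^+ #|A| * 2 ^+ d :> R.
  by rewrite -exprD ler_weXn2l ?ler1n // leq_card_setU.
set z1 := z ^+ (_ + 1); rewrite exprMn; set zd := z ^+ q ^+ d.
have -> : z1 * 2 ^+ #|A| * x ^+ #|U| * D ^+ slack U * (X * dl * (2 ^+ d * zd)) =
    z1 * zd * (2 ^+ #|A| * 2 ^+ d) * (x ^+ #|U| * X) * (D ^+ slack U * dl).
  by move: z1 zd (2 ^+ #|A|) (2 ^+ d) (x ^+ _) (D ^+ _) => ? ? ? ? ? ?; ring.
have pow_ge0 (y : R) i : 0 < y -> 0 <= y ^+ i by move=> y0; rewrite exprn_ge0 // ltW.
have zz_ge0 : 0 <= z1 * zd by rewrite mulr_ge0 ?pow_ge0 ?exprn_gt0.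
have xx_ge0 i : 0 <= x ^+ #|U| * x ^+ i by rewrite mulr_ge0 ?pow_ge0.
apply: ler_pM => //; rewrite ?mulr_ge0 ?pow_ge0 ?exprn_gt0 //; apply: ler_pM => //.
- by rewrite mulr_ge0 ?pow_ge0.
- exact: ler_wpM2l.
- by apply: ler_wpM2l => //; apply: pow_ge0.
Qed.

Lemma sparse_state_add U f v : sparse_state U -> injective f -> v \in f @: setT ->
  v \in cover U -> ~~ (copy_edges EK f \subset U) -> sparse_state (U :|: copy_edges EK f).
Proof.
rewrite /sparse_state => inv fi vf vU nsub.
have := add_copy_balance bal k_gt1 fi vf vU nsub; have := card_old_edges_lt fi nsub.
rewrite (card_cover_add_copy bal) card_add_copy //; move: inv.
move: #|new_vertices U f| #|copy_edges EK f :&: U| #|cover U| #|U| (q) => d t c e m.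
by clear => inv tq [[-> ->]|]; move: inv tq; nia.
Qed.

Lemma potential_add A U f v : injective f -> v \in f @: setT -> v \in cover U ->
  ~~ (copy_edges EK f \subset U) -> ~~ terminal EK L U ->
  potential (A :|: new_vertices U f) (U :|: copy_edges EK f) <=
    potential A U * extension_cost U v f.
Proof.
move=> fi vf vU nsub; rewrite negb_or -leqNgt => /andP[phi _].
have cf : #|f @: setT :\: [set v]| = k.-1.
  by rewrite cardsD (setIidPr _) ?sub1set // cards1 card_injective_image ?subn1.
rewrite /extension_cost !prod_escape // cf -/(new_vertices U f).
have tq := card_old_edges_lt fi nsub; have P_ge0 := potential_ge0 A U.
have base_ge0 i : 0 <= (2 * z ^+ q) ^+ i by apply: exprn_ge0.
have [[dk t0]|le] := add_copy_balance bal k_gt1 fi vf vU nsub.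
  apply: le_trans (ler_wpM2l P_ge0 (_ : x * (2 * z ^+ q) ^+ k.-1 <= _)); last first.
    by rewrite lerDl mulr_ge0 ?invr_ge0 ?(ltW D_gt0).
  rewrite -dk -[x]mulr1; apply: potential_add_le; rewrite ?(ltW x_gt0) ?ler01 //.
    by rewrite t0 subn0 -[leRHS]expr1; apply: ler_wiXn2l => //; apply: ltW.
  rewrite mulr1 /slack (card_cover_add_copy bal) (card_add_copy _ _ fi) dk t0 subn0.
  by rewrite !mulnDr [(q * k.-1)%N]mulnC addnAC subnDr.
apply: le_trans (ler_wpM2l P_ge0 (_ : D^-1 * (2 * z ^+ q) ^+ #|new_vertices U f| <= _)); last first.
  by rewrite lerDr mulr_ge0 ?(ltW x_gt0).
rewrite -[D^-1]mul1r; apply: potential_add_le; rewrite ?invr_ge0 ?(ltW D_gt0) ?ler01 //.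
  by apply: exprn_ile1 => //; apply: ltW.
rewrite ler_pdivlMr // -exprSr; apply: ler_weXn2l => //; rewrite /slack.
rewrite (card_cover_add_copy bal) (card_add_copy _ _ fi); move: le phi tq.
by move: #|cover U| #|U| (q) #|new_vertices U f| #|copy_edges EK f :&: U|; clear; nia.
Qed.

Lemma explored_step m A U v : [pick v in A] = Some v -> ~~ terminal EK L U ->
  Pr p (pairs n) (fun G => (U \subset G) && explored EK L m.+1 G A U) <=
  Pr p (pairs n) (fun G => (U \subset G) && explored EK L m G (A :\ v) U) +
  \sum_(f : {ffun 'I_k -> 'I_n} | extends EK U v f)
    Pr p (pairs n) (fun G => (U :|: copy_edges EK f \subset G) &&
      explored EK L m G (A :|: new_vertices U f) (U :|: copy_edges EK f)).
Proof.
move=> pickA nterm /=; rewrite pickA (negPf nterm) /=.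
apply: le_trans (lerD (lexx _) (Pr_exists p01 _ _ _)).
apply: le_trans (Pr_or p01 _ _ _); apply: (Pr_mono p01) => G _ /andP[UG].
case/orP=> [ex|/existsP [f /andP[Qf /andP[fG ex]]]]; first by rewrite UG ex.
by apply/orP; right; apply/existsP; exists f; rewrite Qf subUset UG fG.
Qed.

Lemma explored_bound fuel A U : U \subset pairs n -> A \subset cover U -> sparse_state U ->
  Pr p (pairs n) (fun G => (U \subset G) && explored EK L fuel G A U) <= potential A U.
Proof.
elim: fuel A U => [|m IH] A U sU sA inv; (have [term|nterm] := boolP (terminal EK L U);
  [by apply: le_trans (terminal_bound A inv term); rewrite -(Pr_subset p sU);
      apply: (Pr_mono p01) => X _ /andP[]|]).
  by rewrite /= (negPf nterm) /Pr big_pred0 ?potential_ge0 // => X; rewrite !andbF.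
case pickA: [pick v in A] => [v|]; last first.
  by rewrite /= pickA (negPf nterm) /Pr big_pred0 ?potential_ge0 // => X; rewrite !andbF.
apply: le_trans (explored_step m pickA nterm) _.
have vA : v \in A by move: pickA; case: pickP => // w wA [<-].
have vU : v \in cover U := subsetP sA v vA.
rewrite [leRHS]splitr; apply: lerD.
  apply: le_trans (IH _ _ sU _ inv) _; first by apply: subset_trans sA; apply: subD1set.
  rewrite /potential (cardsD1 v A) vA exprS [leRHS](_ : _ = z ^+ (q * #|cover U| + 1) *
    2 ^+ #|A :\ v| * x ^+ #|U| * D ^+ slack U) //.
  by move: (z ^+ _) (2 ^+ _) (x ^+ _) (D ^+ _) => ? ? ? ?; field.
apply: le_trans (ler_wpM2l (potential_ge0 A U) (sum_extension_cost v _ nterm)); last first.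
  by rewrite is_graph_pairs.
rewrite mulr_sumr [leRHS](bigID (extends EK U v)) /=.
apply: ler_wpDr.
  by apply: sumr_ge0 => f _; apply: mulr_ge0; [exact: potential_ge0|exact: extension_cost_ge0].
apply: ler_sum => f /and3P[/injectiveP fi vf nsub].
apply: le_trans (potential_add A fi vf vU nsub nterm); apply: IH.
- by rewrite subUset sU -is_graph_pairs is_graph_copy //; case: bal.
- by rewrite (cover_add_copy bal) setSU.
- exact: (sparse_state_add inv fi vf vU nsub).
Qed.

Lemma dense_union_explored E G fuel : E \subset G -> E \subset pairs n ->
  connected_copies EK E -> (q * #|cover E| < k.-1 * #|E|)%N -> (exists f, embeds EK E f) ->
  (k * #|pairs n| + n <= fuel)%N ->
  [exists f : {ffun 'I_k -> 'I_n}, injectiveb f &&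
    ((copy_edges EK f \subset G) && explored EK L fuel G (f @: setT) (copy_edges EK f))].
Proof.
move=> sEG sE conn dense [f fE] fuel_ge; have /embedsP [fi sf] := fE.
apply/existsP; exists f; rewrite (introT (injectiveP f) fi) (subset_trans sf sEG) /=.
apply: (explored_complete bal k_gt1 L sEG conn dense) => //.
- by rewrite -card_gt0 card_copy_edges.
- by rewrite (cover_copy_edges bal).
- by move=> g _ [i]; rewrite (cover_copy_edges bal) => ->.
apply: leq_trans fuel_ge; rewrite leq_add ?leq_mul2l //; last by rewrite -[leqRHS]card_ord max_card.
by apply/orP; right; apply: leq_trans (leq_subr _ _) (subset_leq_card sE).
Qed.

Lemma explored_start_bound fuel f : injective f ->
  Pr p (pairs n) (fun G => (copy_edges EK f \subset G) &&
    explored EK L fuel G (f @: setT) (copy_edges EK f)) <=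
  z ^+ (q * k) * (z * 2 ^+ k * D ^+ (q + 1)).
Proof.
move=> fi; apply: le_trans (explored_bound fuel _ _ _) _.
- by rewrite -is_graph_pairs is_graph_copy //; case: bal.
- by rewrite (cover_copy_edges bal).
- rewrite /sparse_state (cover_copy_edges bal) card_copy_edges // card_injective_image //.
  by move: k_gt1 (q); clear; nia.
rewrite /potential /slack (cover_copy_edges bal) card_copy_edges // card_injective_image //.
have -> : (q * k + 1 - k.-1 * q = q + 1)%N by move: k_gt1 (q); clear; nia.
rewrite exprD expr1 -!mulrA; do 3 ?[apply: ler_wpM2l; first by rewrite ?exprn_ge0 ?(ltW z_gt0)].
by rewrite ler_piMl ?exprn_ge0 ?(ltW D_gt0) // exprn_ile1 // ltW.
Qed.

Lemma dense_union_bound (bad : {set {set 'I_n}} -> bool) :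
  (forall G, G \subset pairs n -> bad G -> exists E : {set {set 'I_n}},
     [/\ E \subset G, connected_copies EK E, q * #|cover E| < k.-1 * #|E| &
        exists f, embeds EK E f]%N) ->
  Pr p (pairs n) bad <= z * 2 ^+ k * D ^+ (q + 1).
Proof.
move=> bad_dense; pose fuel := (k * #|pairs n| + n)%N.
pose start f G := (copy_edges EK f \subset G) && explored EK L fuel G (f @: setT) (copy_edges EK f).
apply: le_trans (_ : Pr p (pairs n) (fun G =>
    [exists f : {ffun 'I_k -> 'I_n}, injectiveb f && start f G]) <= _).
  apply: (Pr_mono p01) => G sG /(bad_dense G sG) [E [sE conn dense copyE]].
  exact: (dense_union_explored sE (subset_trans sE sG) conn dense copyE).
apply: le_trans (Pr_exists p01 _ _ _) _.
apply: le_trans (ler_sum _ (fun f fi => explored_start_bound fuel (injectiveP f fi))) _.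
set B := z * 2 ^+ k * _; have B_ge0 : 0 <= z ^+ (q * k) * B.
  by rewrite !mulr_ge0 ?exprn_ge0 // ltW.
apply: le_trans (_ : \sum_(f : {ffun 'I_k -> 'I_n}) z ^+ (q * k) * B <= _).
  by rewrite [leRHS](bigID (fun f : {ffun 'I_k -> 'I_n} => injectiveb f)) /= lerDl sumr_ge0.
rewrite sumr_const card_ffun !card_ord -[_ *+ (n ^ k)]mulr_natl mulrA natrX exprM -exprMn.
by rewrite nz expr1n mul1r.
Qed.

End ExplorationBound.

(** * Sets without a copy *)

Lemma ffact_ge m h : ((m - h) ^ h <= m ^_ h)%N.
Proof.
rewrite ffact_prod -[X in (_ ^ X)%N]card_ord -prod_nat_const; apply: leq_prod => i _.
by rewrite leq_sub2l // ltnW.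
Qed.

Lemma leq_self_exp m c v : (c <= m -> v <= m -> c ^ v <= m ^ m)%N.
Proof.
case: m => [|m] cm vm; first by move: vm; rewrite leqn0 => /eqP ->.
by apply: leq_trans (leq_pexp2l _ vm) => //; case: v vm => // v _; rewrite leq_exp2r.
Qed.

Lemma card_ffun_into (I T : finType) (V : {set I}) (A : {set T}) :
  #|[set f : {ffun I -> T} | f @: V \subset A]| = (#|A| ^ #|V| * #|T| ^ #|~: V|)%N.
Proof.
pose into (a : I) := [pred t | (a \in V) ==> (t \in A)].
have -> : #|[set f : {ffun I -> T} | f @: V \subset A]| = #|family into|.
  apply: eq_card => f; rewrite inE; apply/subsetP/familyP => [sub a|fV _ /imsetP [a aV ->]].
    by rewrite inE; apply/implyP => aV; apply: sub; apply: imset_f.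
  by have := fV a; rewrite inE aV.
rewrite card_family foldrE big_map big_enum /= (bigID (mem V)) /=; congr (_ * _)%N.
  by rewrite -prod_nat_const; apply: eq_bigr => a aV; apply: eq_card => t; rewrite unfold_in aV.
rewrite -prod_nat_const; apply: eq_big => a; rewrite ?inE // => /negPf aV.
by apply: eq_card => t; rewrite unfold_in aV.
Qed.

Section SharedEdges.
Variables (h n : nat) (EH : {set {set 'I_h}}).
Implicit Types (f g : {ffun 'I_h -> 'I_n}) (V : {set 'I_h}).

Definition shared f g : {set {set 'I_h}} := [set e in EH | f @: e \in copy_edges EH g].

Lemma shared_sub f g : shared f g \subset EH.
Proof. by apply/subsetP => e; rewrite inE => /andP[]. Qed.

Lemma card_shared f g : injective f ->
  #|copy_edges EH f :&: copy_edges EH g| = #|shared f g|.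
Proof.
move=> fi; rewrite -(card_imset (shared f g) (imset_inj fi)); apply: eq_card => e'.
rewrite in_setI; apply/andP/imsetP => [[/imsetP [e eH ->] eg]|[e]].
  by exists e; rewrite // inE eH.
by rewrite inE => /andP[eH eg] ->; rewrite imset_f.
Qed.

Lemma disjoint_copies f g : injective f ->
  [disjoint copy_edges EH f & copy_edges EH g] = (shared f g == set0).
Proof. by move=> fi; rewrite -setI_eq0 -!cards_eq0 card_shared. Qed.

Lemma card_copy_union f g : injective f -> injective g ->
  #|copy_edges EH f :|: copy_edges EH g| = (2 * #|EH| - #|shared f g|)%N.
Proof. by move=> fi gi; rewrite -(card_shared g fi) cardsU !card_copy_edges // addnn mul2n. Qed.

Lemma cover_shared f g : f @: cover (shared f g) \subset g @: setT.
Proof.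
apply/subsetP => _ /imsetP [a /bigcupP [e + ae] ->]; rewrite inE => /andP[_ /imsetP [e' _ eg]].
have : f a \in f @: e by apply: imset_f.
by rewrite eg; apply/subsetP/imsetS/subsetT.
Qed.

Lemma card_overlapping V :
  (#|[set u : {ffun 'I_h -> 'I_n} * {ffun 'I_h -> 'I_n} | u.1 @: V \subset u.2 @: setT]| <=
   h ^ h * n ^ h * n ^ (h - #|V|))%N.
Proof.
rewrite -sum1dep_card.
rewrite -(pair_big_dep xpredT (fun f g => f @: V \subset g @: setT) (fun _ _ => 1%N)) /=.
rewrite (exchange_big_dep xpredT) //= [leqRHS]mulnAC [leqRHS]mulnC -[X in (X ^ h * _)%N]card_ord.
rewrite -[X in (_ ^ X * _)%N]card_ord -card_ffun -sum_nat_const; apply: leq_sum => g _.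
rewrite sum1dep_card card_ffun_into card_ord; apply: leq_mul; last first.
  by rewrite leq_eqVlt cardsCs setCK card_ord eqxx.
apply: leq_self_exp; last by rewrite -[leqRHS]card_ord max_card.
by rewrite (leq_trans (leq_imset_card _ _)) // cardsT card_ord.
Qed.

End SharedEdges.

Definition copy_const h (EH : {set {set 'I_h}}) : nat := 2 ^ #|EH| * h ^ h.

Lemma copy_const_gt0 h (EH : {set {set 'I_h}}) :
  is_graph EH -> EH != set0 -> (0 < copy_const EH)%N.
Proof.
move=> gH /set0Pn [e eE]; rewrite muln_gt0 !expn_gt0 /= -[X in (0 < X)%N]card_ord.
by rewrite (leq_trans _ (max_card (mem e))) ?(card_edge gH eE).
Qed.

Section NoCopy.
Variables (h n : nat) (EH : {set {set 'I_h}}).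
Hypotheses (gH : is_graph EH) (EH_neq0 : EH != set0).
Variables (R : realType) (p K a : R).
Hypotheses (p01 : 0 <= p <= 1) (K_gt0 : 0 < K).
Hypothesis many_copies : forall J : {set {set 'I_h}}, J \subset EH -> J != set0 ->
  K <= n%:R ^+ #|cover J| * p ^+ #|J|.
Implicit Types (f g : {ffun 'I_h -> 'I_n}) (J : {set {set 'I_h}}).

Let p_ge0 : 0 <= p. Proof. by case/andP: p01. Qed.

Let B : R := (copy_const EH)%:R.
Let M : R := n%:R ^+ h * p ^+ #|EH|.

Let n_gt0 : (0 < n)%N.
Proof.
have /set0Pn [e eE] := EH_neq0.
have cover_gt0 : (0 < #|cover EH|)%N.
  by apply: leq_trans (subset_leq_card (bigcup_sup e eE)); rewrite (card_edge gH eE).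
rewrite lt0n; apply: contraTneq (many_copies (subxx EH) EH_neq0) => ->.
by rewrite -(prednK cover_gt0) exprS !mul0r -ltNge.
Qed.

Let K_le : K <= M.
Proof.
apply: le_trans (many_copies (subxx EH) EH_neq0) _; apply: ler_wpM2r; first exact: exprn_ge0.
by apply: ler_weXn2l; rewrite ?ler1n // -[leqRHS]card_ord max_card.
Qed.

Let M_gt0 : 0 < M. Proof. exact: lt_le_trans K_le. Qed.

Let B_ge1 : 1 <= B.
Proof. by rewrite ler1n copy_const_gt0. Qed.

Lemma overlap_term_le J : J \subset EH -> J != set0 ->
  p ^+ (2 * #|EH| - #|J|) * (h ^ h * n ^ h * n ^ (h - #|cover J|))%:R <= (h ^ h)%:R * (M ^+ 2 / K).
Proof.
move=> sJ J0; rewrite mulrA ler_pdivlMr //.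
apply: le_trans (ler_wpM2l _ (many_copies sJ J0)) _; first by rewrite mulr_ge0 ?exprn_ge0.
have cJ : (#|J| <= 2 * #|EH|)%N.
  by apply: leq_trans (subset_leq_card sJ) _; rewrite mul2n -addnn leq_addr.
have cV : (#|cover J| <= h)%N by rewrite -[leqRHS]card_ord max_card.
rewrite /M !natrM !natrX [leLHS](_ : _ =
    h%:R ^+ h * (n%:R ^+ h * (n%:R ^+ (h - #|cover J|) * n%:R ^+ #|cover J|) *
      (p ^+ (2 * #|EH| - #|J|) * p ^+ #|J|))); last first.
  by move: (p ^+ _) (p ^+ _) (n%:R ^+ _) (n%:R ^+ _) (n%:R ^+ _) (h%:R ^+ _) => *; ring.
by rewrite -!exprD !subnK // exprMn -!exprM addnn -muln2 (mulnC 2).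
Qed.

Lemma overlap_bound (Q : {set {ffun 'I_h -> 'I_n}}) : {in Q, forall f, injective f} ->
  \sum_(f in Q) \sum_(g in Q | shared EH f g != set0)
    p ^+ #|copy_edges EH f :|: copy_edges EH g| <= B * M ^+ 2 / K.
Proof.
move=> Qinj; rewrite pair_big_dep /=.
rewrite (partition_big (fun u => shared EH u.1 u.2) (fun J => (J \in powerset EH) && (J != set0)))
  => [|u /and3P[_ _ ->]] /=; last by rewrite powersetE shared_sub.
apply: le_trans (_ : \sum_(J in powerset EH) (h ^ h)%:R * (M ^+ 2 / K) <= _); last first.
  by rewrite sumr_const card_powerset -[_ *+ (2 ^ _)]mulr_natl !mulrA -natrM.
have c_ge0 : 0 <= (h ^ h)%:R * (M ^+ 2 / K) by rewrite mulr_ge0 // divr_ge0 ?exprn_ge0 // ltW.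
rewrite big_mkcondr /=; apply: ler_sum => J; rewrite powersetE => sJ.
case: ifP => // J0; apply: le_trans (overlap_term_le sJ J0).
pose V := cover J; rewrite mulr_natr.
apply: le_trans (_ : \sum_(u in [set u : {ffun 'I_h -> 'I_n} * {ffun 'I_h -> 'I_n} |
    u.1 @: V \subset u.2 @: setT]) p ^+ (2 * #|EH| - #|J|) <= _); last first.
  by rewrite sumr_const ler_wpMn2l ?exprn_ge0 ?card_overlapping.
rewrite big_mkcond [leRHS]big_mkcond; apply: ler_sum => -[f g] _ /=; rewrite inE /=.
case: ifP => [/andP[/and3P[fQ gQ _] /eqP eJ]|_]; last by case: ifP; rewrite ?exprn_ge0.
by rewrite /V -eJ cover_shared card_copy_union //; apply: Qinj.
Qed.

Section CopiesInSet.
Variable S : {set 'I_n}.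
Hypothesis a01 : 0 < a <= 1.
Hypothesis large : a * n%:R ^+ h <= ((#|S| - h) ^ h)%:R.

Let a_gt0 : 0 < a. Proof. by case/andP: a01. Qed.

Definition copies_in : {set {ffun 'I_h -> 'I_n}} := [set f in ffun_on (mem S) | injectiveb f].

Let copy (i : 'I_#|copies_in|) : {set {set 'I_n}} := copy_edges EH (enum_val i).

Lemma copies_in_inj : {in copies_in, forall f, injective f}.
Proof. by move=> f; rewrite inE => /andP[_ /injectiveP]. Qed.

Let copy_inj (i : 'I_#|copies_in|) : injective (enum_val i).
Proof. by apply: copies_in_inj; apply: enum_valP. Qed.

Lemma no_copy_forall G : ~~ contains_copy EH G S -> [forall i, ~~ (copy i \subset G)].
Proof.
move=> nc; apply/forallP => i; apply: contra nc => sG; apply/existsP; exists (enum_val i).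
have := enum_valP i; rewrite inE => /andP[/ffun_onP fS ->] /=; apply/andP; split;
  first exact/forallP.
by apply/forall_inP => e eH; apply: (subsetP sG); apply: imset_f.
Qed.

Lemma expected_copies_ge : a * M <= \sum_i p ^+ #|copy i|.
Proof.
under eq_bigr => i _ do rewrite card_copy_edges //.
rewrite sumr_const card_ord -[_ *+ #|_|]mulr_natl /M mulrA; apply: ler_wpM2r;
  first exact: exprn_ge0.
apply: le_trans large _; rewrite ler_nat card_inj_ffuns_on card_ord.
exact: ffact_ge.
Qed.

Lemma expected_overlaps_le :
  \sum_i \sum_(j | (j != i) && meets copy i j) p ^+ #|copy i :|: copy j| <= B * M ^+ 2 / K.
Proof.
apply: le_trans (overlap_bound copies_in_inj).
rewrite [leRHS]big_enum_val /=; apply: ler_sum => i _; rewrite [leRHS]big_enum_val_cond /=.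
rewrite big_mkcond [leRHS]big_mkcond; apply: ler_sum => j _.
rewrite /meets disjoint_copies //.
by case: (j != i); case: ifP => //=; rewrite exprn_ge0.
Qed.

(* Maximises [th * (a * M) - th ^+ 2 * (B * M ^+ 2 / K)]. *)
Let th : R := a / (2 * B) * (K / M).

Let th01 : 0 <= th <= 1.
Proof.
have B_gt0 : 0 < B := lt_le_trans ltr01 B_ge1.
have B2_gt0 : 0 < 2 * B by rewrite mulr_gt0.
have aB_le1 : a / (2 * B) <= 1.
  rewrite ler_pdivrMr // mul1r; case/andP: a01 => _ /le_trans; apply.
  by apply: le_trans B_ge1 _; rewrite ler_peMl ?ler1n // ltW.
have KM_le1 : K / M <= 1 by rewrite ler_pdivrMr // mul1r.
have [aB_ge0 KM_ge0] : 0 <= a / (2 * B) /\ 0 <= K / M by split; apply/ltW/divr_gt0.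
by apply/andP; split; [apply: mulr_ge0|apply: mulr_ile1].
Qed.

Lemma no_copy_bound :
  Pr p (pairs n) (fun G => ~~ contains_copy EH G S) <= expR (- (a ^+ 2 * K / (4 * B))).
Proof.
have copyW i : copy i \subset pairs n by rewrite -is_graph_pairs is_graph_copy.
have th_ge0 : 0 <= th by case/andP: th01.
apply: le_trans (Pr_mono p01 _) (le_trans (janson p01 copyW th01) _).
  by move=> G _; apply: no_copy_forall.
rewrite ler_expR lerN2.
apply: le_trans (_ : th * (a * M) - th ^+ 2 * (B * M ^+ 2 / K) <= _); last first.
  by apply: lerB; apply: ler_wpM2l; rewrite ?exprn_ge0 ?expected_copies_ge ?expected_overlaps_le.
have : B != 0 by rewrite gt_eqF // (lt_le_trans ltr01).
have : M != 0 by rewrite gt_eqF.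
have : K != 0 by rewrite gt_eqF.
rewrite /th le_eqVlt; move: a M B K => a' M' B' K' K0 M0 B0; apply/orP; left; apply/eqP.
by field; rewrite K0 M0 B0.
Qed.

End CopiesInSet.
End NoCopy.

(** * Bounds at the threshold *)

Lemma powRN_lt_eps (R : realType) (A s eps : R) : 0 < s -> 0 < eps ->
  exists N, forall n, (N <= n)%N -> A * n%:R `^ (- s) < eps.
Proof.
move=> s_gt0 eps_gt0; pose a := `|A| + 1.
have a_gt0 : 0 < a by rewrite ltr_wpDl.
have root_ge0 : 0 <= (a / eps) `^ s^-1 by apply: powR_ge0.
exists (Num.bound ((a / eps) `^ s^-1)) => n Nn; set y := n%:R `^ s.
have lt_n : (a / eps) `^ s^-1 < n%:R.
  by apply: lt_le_trans (archi_boundP root_ge0) _; rewrite ler_nat.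
have lt_y : a / eps < y.
  have := gt0_ltr_powR s_gt0 root_ge0 (ler0n R n) lt_n.
  by rewrite -powRrM mulVf ?gt_eqF // powRr1 // ltW // divr_gt0.
have y_gt0 : 0 < y by apply: lt_trans lt_y; apply: divr_gt0.
rewrite powRN ltr_pdivrMr //; apply: le_lt_trans (ler_norm A) _.
by apply: lt_trans (_ : a < _); rewrite ?ltrDl // mulrC -ltr_pdivrMr.
Qed.

Lemma expRN_lt_eps (R : realType) (eps : R) : 0 < eps ->
  exists N, forall n, (N <= n)%N -> expR (- n%:R) < eps.
Proof.
move=> eps_gt0; exists (Num.bound eps^-1) => n Nn.
rewrite expRN invf_plt ?posrE ?expR_gt0 //.
have eps_ge0 : 0 <= eps^-1 by rewrite invr_ge0 ltW.
apply: lt_le_trans (archi_boundP eps_ge0) _; apply: le_trans (expR_ge1Dx _).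
by rewrite -[leLHS]add0r lerD ?ler_nat.
Qed.

Lemma trunc_log_le_powR (R : realType) (t : R) n : 0 < t -> (0 < n)%N ->
  (2 * (trunc_log 2 n).+1 + 2)%:R <= (2 / (t * ln 2) + 4) * n%:R `^ t.
Proof.
move=> t_gt0 n_gt0; set l := trunc_log 2 n.
have ln2_gt0 : 0 < ln 2 :> R by rewrite ln_gt0 // ltr1n.
have nR_gt0 : 0 < n%:R :> R by rewrite ltr0n.
have pow_ge1 : 1 <= n%:R `^ t by rewrite -[leLHS](powRr0 n%:R) ler_powR ?ler1n // ltW.
have l_le : l%:R * ln 2 <= ln n%:R :> R.
  by rewrite mulr_natl -lnXn // ler_ln ?posrE ?exprn_gt0 // -natrX ler_nat trunc_logP.
have tl_le : t * ln 2 * l%:R <= n%:R `^ t.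
  rewrite -mulrA [ln 2 * _]mulrC /powR gt_eqF //.
  apply: le_trans (_ : t * ln n%:R <= _); first by rewrite ler_wpM2l // ltW.
  by apply: le_trans (expR_ge1Dx _); rewrite lerDr.
have -> : (2 * l.+1 + 2)%:R = 2 * l%:R + 4 :> R by rewrite mulnS addnAC natrD natrM addrC.
rewrite [leRHS]mulrDl; apply: lerD; last by rewrite ler_peMr.
by rewrite -mulrA ler_wpM2l // mulrC ler_pdivlMr ?mulr_gt0 // mulrC.
Qed.

Section ZeroStatement.
Variables (k b h : nat) (EK : {set {set 'I_k}}) (EH : {set {set 'I_h}}).
Variable phi : {ffun 'I_k -> 'I_h}.
Hypotheses (k_gt2 : (2 < k)%N) (EKE : EK = clique_edges k \/ EK = cycle_edges k).
Hypotheses (phiE : embeds EK EH phi) (b_ge : (pairing_degree k <= b)%N).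
Variable R : realType.
Implicit Type p : R.

Local Notation q := #|EK|.
Local Notation qR := (#|EK|%:R : R).

Definition zero_const : R := (4 * 3 ^+ k)^-1 / 4.

Lemma zero_const_gt0 : 0 < zero_const.
Proof. by rewrite divr_gt0 ?invr_gt0 ?mulr_gt0 ?exprn_gt0. Qed.

Let bal : balanced EK := clique_or_cycle_balanced k_gt2 EKE.

Let q_gt0 : 0 < qR.
Proof. by rewrite ltr0n card_gt0 (balanced_neq0 _ bal) // (ltn_trans _ k_gt2). Qed.

Lemma makers_win_prob_le n L p maker_first : (0 < n)%N -> (n <= 2 ^ L)%N -> 0 <= p <= 1 ->
  p <= zero_const * n%:R `^ (- (k.-1%:R / qR)) ->
  Pr p (pairs n) (fun G => makers_win EH G b maker_first) <=
  n%:R `^ (- qR^-1) * 2 ^+ k * (4 * (2 * L + 2)%:R ^+ k) ^+ (q + 1).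
Proof.
move=> n_gt0 n_le p01 p_le; pose z : R := n%:R `^ (- qR^-1).
have n_ge1 : 1 <= n%:R :> R by rewrite ler1n.
have z_exp m : z ^+ m = n%:R `^ (- (m%:R / qR)).
  by rewrite -powR_mulrn ?powR_ge0 // -powRrM mulNr mulrC.
have z01 : 0 < z <= 1.
  by rewrite powR_gt0 ?ltr0n //= -[leRHS](powRr0 n%:R) ler_powR // oppr_le0 invr_ge0 ltW.
have nz : n%:R * z ^+ q = 1.
  by rewrite z_exp divff ?gt_eqF // powR_inv1 ?ler0n // divff // gt_eqF // ltr0n.
apply: (@dense_union_bound k EK bal (ltnW k_gt2) R n L p z p01 z01 nz n_le (4 * 3 ^+ k)^-1).
- by rewrite invr_gt0 mulr_gt0 ?exprn_gt0.
- by rewrite invfM mulfVK ?expf_neq0 ?pnatr_eq0.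
- by rewrite mulr_ege1 ?exprn_ege1 ?ler1n // addn2.
- by rewrite invfM mulfVK ?expf_neq0 ?pnatr_eq0 ?addn2.
- by rewrite z_exp.
by move=> G sG; apply: (maker_win_dense phiE b_ge) => //; rewrite is_graph_pairs.
Qed.

Lemma makers_win_prob_le_powR : exists A : R, forall n p maker_first, (0 < n)%N -> 0 <= p <= 1 ->
  p <= zero_const * n%:R `^ (- (k.-1%:R / qR)) ->
  Pr p (pairs n) (fun G => makers_win EH G b maker_first) <= A * n%:R `^ (- (2 * qR)^-1).
Proof.
have d_gt0 : 0 < (k * (q + 1))%:R :> R by rewrite ltr0n muln_gt0 (ltn_trans _ k_gt2) // addn1.
pose t : R := (2 * qR)^-1 / (k * (q + 1))%:R.
have t_gt0 : 0 < t by rewrite divr_gt0 // invr_gt0 mulr_gt0.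
pose a := 2 / (t * ln 2) + 4.
have a_ge0 : 0 <= a by rewrite addr_ge0 // ltW // divr_gt0 // mulr_gt0 // ln_gt0 // ltr1n.
exists (2 ^+ k * (4 * a ^+ k) ^+ (q + 1)) => n p mf n_gt0 p01 p_le.
have n_le : (n <= 2 ^ (trunc_log 2 n).+1)%N by apply/ltnW/trunc_log_ltn.
apply: le_trans (makers_win_prob_le mf n_gt0 n_le p01 p_le) _.
have -> : - qR^-1 = - (2 * qR)^-1 - (2 * qR)^-1 by rewrite invfM; field; rewrite gt_eqF.
have n_neq0 : n%:R != 0 :> R by rewrite pnatr_eq0 -lt0n.
rewrite powRD ?n_neq0 ?implybT //; set u := n%:R `^ _.
rewrite [leRHS]mulrC -!mulrA ler_wpM2l ?powR_ge0 // mulrCA ler_wpM2l ?exprn_ge0 //.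
have -> : u = ((n%:R `^ t) ^+ k ^+ (q + 1))^-1.
  by rewrite -exprM -powR_mulrn ?powR_ge0 // -powRrM divfK ?gt_eqF // -powRN.
rewrite mulrC ler_pdivrMr ?exprn_gt0 ?powR_gt0 ?ltr0n // -exprMn lerXn2r ?nnegrE //.
- by rewrite mulr_ge0 ?exprn_ge0.
- by rewrite !mulr_ge0 ?exprn_ge0 ?powR_ge0.
rewrite -mulrA -exprMn ler_wpM2l // lerXn2r ?nnegrE ?ler0n //; last exact: trunc_log_le_powR.
by rewrite mulr_ge0 ?powR_ge0.
Qed.

Lemma makers_win_prob_lt_eps (eps : R) : 0 < eps -> exists N, forall n p maker_first,
  (N <= n)%N -> 0 <= p <= 1 -> p <= zero_const * n%:R `^ (- (k.-1%:R / qR)) ->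
  Pr p (pairs n) (fun G => makers_win EH G b maker_first) < eps.
Proof.
move=> eps_gt0; have [A leA] := makers_win_prob_le_powR.
have s_gt0 : 0 < (2 * qR)^-1 by rewrite invr_gt0 mulr_gt0.
have [N ltN] := powRN_lt_eps A s_gt0 eps_gt0; exists (maxn 1 N) => n p mf.
rewrite geq_max => /andP[n_gt0 Nn] p01 p_le.
exact: le_lt_trans (leA n p mf n_gt0 p01 p_le) (ltN n Nn).
Qed.

End ZeroStatement.

Section OneStatement.
Variables (b h : nat) (EH : {set {set 'I_h}}).
Hypotheses (gH : is_graph EH) (EH_neq0 : EH != set0) (b_gt0 : (0 < b)%N).
Variables (R : realType) (m : R).
Hypothesis m_gt0 : 0 < m.
Hypothesis density_le : forall J : {set {set 'I_h}}, J \subset EH -> J != set0 ->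
  #|J|%:R <= m * (#|cover J|.-1)%:R.
Implicit Type p : R.

Definition set_const : R := (4 * b.+1%:R)^-1 ^+ h.
Definition one_const : R := Num.max 1 (8 * (copy_const EH)%:R / set_const ^+ 2).

Let b4_ge1 : 1 <= 4 * b.+1%:R :> R.
Proof. by rewrite mulr_ege1 ?ler1n. Qed.

Let b4_gt0 : 0 < 4 * b.+1%:R :> R.
Proof. by rewrite mulr_gt0. Qed.

Lemma one_const_ge1 : 1 <= one_const.
Proof. by rewrite le_max lexx. Qed.

Lemma set_const01 : 0 < set_const <= 1.
Proof. by rewrite exprn_gt0 ?invr_gt0 //= exprn_ile1 ?invr_ge0 ?invf_le1 // ltW. Qed.

Lemma expected_subcopies_ge C n p (J : {set {set 'I_h}}) : 1 <= C -> (0 < n)%N ->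
  C * n%:R `^ (- m^-1) <= p -> J \subset EH -> J != set0 ->
  C * n%:R <= n%:R ^+ #|cover J| * p ^+ #|J|.
Proof.
move=> C_ge1 n_gt0 p_ge sJ J0; have C_ge0 : 0 <= C by apply: le_trans C_ge1.
have n_ge1 : 1 <= n%:R :> R by rewrite ler1n.
have j_gt0 : (0 < #|J|)%N by rewrite card_gt0.
have v_gt0 : (0 < #|cover J|)%N.
  have /set0Pn [e eJ] := J0; apply: leq_trans (subset_leq_card (bigcup_sup e eJ)).
  by rewrite (card_edge gH (subsetP sJ e eJ)).
have pJ : C * n%:R ^- #|cover J|.-1 <= p ^+ #|J|.
  apply: le_trans (_ : (C * n%:R `^ (- m^-1)) ^+ #|J| <= _); last first.
    by rewrite lerXn2r ?nnegrE ?(le_trans _ p_ge) // mulr_ge0 ?powR_ge0.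
  rewrite exprMn ler_pM ?invr_ge0 ?exprn_ge0 //; first by rewrite ler_eXnr.
  rewrite -powR_invn // -powR_mulrn ?powR_ge0 // -powRrM ler_powR // mulNr lerN2.
  by rewrite mulrC ler_pdivrMr // mulrC density_le.
have -> : C * n%:R = n%:R ^+ #|cover J| * (C * n%:R ^- #|cover J|.-1).
  rewrite mulrCA; congr (_ * _); rewrite -{1}(prednK v_gt0) exprS mulfK //.
  by rewrite expf_neq0 // gt_eqF // ltr0n.
by rewrite ler_wpM2l ?exprn_ge0.
Qed.

Lemma large_set_ge n (S : {set 'I_n}) : (4 * b.+1 * h.+1 <= n)%N -> (n <= b.+1 * #|S| + b)%N ->
  set_const * n%:R ^+ h <= ((#|S| - h) ^ h)%:R.
Proof.
move=> n_large nS; rewrite /set_const -exprMn natrX lerXn2r ?nnegrE ?mulr_ge0 ?invr_ge0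
  ?(ltW b4_gt0) //.
rewrite ler_pdivrMl // -!natrM ler_nat.
by move: n_large nS; move: #|S| => s; clear; nia.
Qed.

Lemma no_copy_prob_le n p (S : {set 'I_n}) : (4 * b.+1 * h.+1 <= n)%N -> 0 <= p <= 1 ->
  one_const * n%:R `^ (- m^-1) <= p -> (n <= b.+1 * #|S| + b)%N ->
  Pr p (pairs n) (fun G => ~~ contains_copy EH G S) <= expR (- (2 * n%:R)).
Proof.
move=> n_large p01 p_ge nS; have n_gt0 : (0 < n)%N by apply: leq_trans n_large.
have K_gt0 : 0 < one_const * n%:R by rewrite mulr_gt0 ?ltr0n // (lt_le_trans ltr01 one_const_ge1).
have many J := expected_subcopies_ge one_const_ge1 n_gt0 p_ge (J := J).
apply: le_trans (no_copy_bound gH EH_neq0 p01 K_gt0 many set_const01 (large_set_ge n_large nS)) _.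
have [set_gt0 _] := andP set_const01; have set2_gt0 : 0 < set_const ^+ 2 by apply: exprn_gt0.
have copy_gt0 : 0 < (copy_const EH)%:R :> R by rewrite ltr0n copy_const_gt0.
rewrite ler_expR lerN2 ler_pdivlMr ?mulr_gt0 //.
have : 8 * (copy_const EH)%:R / set_const ^+ 2 <= one_const by rewrite le_max lexx orbT.
rewrite ler_pdivrMr //.
by move: (n%:R) (ler0n R n) (one_const) (copy_const EH)%:R (set_const ^+ 2) => ? ? ? ? ?; nra.
Qed.

Lemma makers_lose_prob_le n p maker_first : (4 * b.+1 * h.+1 <= n)%N -> 0 <= p <= 1 ->
  one_const * n%:R `^ (- m^-1) <= p ->
  Pr p (pairs n) (fun G => ~~ makers_win EH G b maker_first) <= expR (- n%:R).
Proof.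
move=> n_large p01 p_ge; pose Q (S : {set 'I_n}) := (n <= b.+1 * #|S| + b)%N.
apply: le_trans (_ : Pr p (pairs n) (fun G => [exists S, Q S && ~~ contains_copy EH G S]) <= _).
  apply: (Pr_mono p01) => G _; apply: contraR => /existsPn all_copies.
  apply: maker_wins_dense => // S QS.
  by have := all_copies S; rewrite /Q QS /= negbK.
apply: le_trans (Pr_exists p01 _ _ _) _.
apply: le_trans (_ : \sum_(S | Q S) expR (- (2 * n%:R)) <= _).
  by apply: ler_sum => S QS; apply: no_copy_prob_le.
have card_le : #|Q|%:R <= expR 1 ^+ n :> R.
  apply: le_trans (_ : 2 ^+ n <= _); last by rewrite lerXn2r ?nnegrE ?expR_ge0 // expR_ge1Dx.
  rewrite -natrX ler_nat; apply: leq_trans (max_card _) _.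
  by rewrite -cardsT -powersetT card_powerset cardsT card_ord.
rewrite sumr_const -[_ *+ _]mulr_natl; apply: le_trans (ler_wpM2r (expR_ge0 _) card_le) _.
by rewrite -expRM_natr mul1r -expRD ler_expR; lra.
Qed.

Lemma makers_lose_prob_lt_eps (eps : R) : 0 < eps -> exists N, forall n p maker_first,
  (N <= n)%N -> 0 <= p <= 1 -> one_const * n%:R `^ (- m^-1) <= p ->
  Pr p (pairs n) (fun G => ~~ makers_win EH G b maker_first) < eps.
Proof.
move=> /expRN_lt_eps [N ltN]; exists (maxn (4 * b.+1 * h.+1) N) => n p mf.
rewrite geq_max => /andP[n_large Nn] p01 p_ge.
exact: le_lt_trans (makers_lose_prob_le mf n_large p01 p_ge) (ltN n Nn).
Qed.

End OneStatement.

(** * The threshold *)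

Lemma prob_gnpE n (p : R) (F : {set {set 'I_n}} -> bool) : prob_gnp p F = Pr p (pairs n) F.
Proof.
rewrite /prob_gnp /Pr -[foldr _ _ _]/(foldr +%R 0%R _) foldrE big_map big_enum /=.
rewrite [RHS]big_mkcondr /=; apply: eq_big => [E|E _]; first by rewrite !inE.
by case: (F E); rewrite // /weight !RpowE.
Qed.

Lemma Rpower_powR n (y : R) : (0 < n)%N -> Rpower (INR n) y = n%:R `^ y.
Proof. by move=> n_gt0; rewrite /Rpower /powR !RealsE pnatr_eq0 (gtn_eqF n_gt0). Qed.

Lemma Rle_unit_interval (x : R) : Rle 0 x /\ Rle x 1 -> 0 <= x <= 1.
Proof. by case=> /RleP ? /RleP ?; apply/andP. Qed.

Lemma one_density_le_max h (EH : {set {set 'I_h}}) (V : {set 'I_h}) (E : {set {set 'I_h}}) :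
  is_subgraph EH V E -> (1 < #|V|)%N -> one_density V E <= max_one_density EH.
Proof.
move=> sub V2; rewrite /max_one_density.
have le_foldr (s : seq R) x : x \in s -> x <= foldr Rmax 0%R s.
  elim: s => //= y s IH; rewrite inE RmaxE le_max => /predU1P[->|/IH ->]; rewrite ?lexx ?orbT //.
by apply: le_foldr; apply/mapP; exists (V, E); rewrite // mem_enum inE sub.
Qed.

Lemma card_edges_le_density h (EH J : {set {set 'I_h}}) : is_graph EH -> J \subset EH ->
  J != set0 -> #|J|%:R <= max_one_density EH * (#|cover J|.-1)%:R.
Proof.
move=> gH sJ /set0Pn [e eJ].
have cover_gt1 : (1 < #|cover J|)%N.
  by rewrite -(card_edge gH (subsetP sJ e eJ)); apply/subset_leq_card/bigcup_sup.
rewrite -ler_pdivrMr ?ltr0n -?subn1 ?subn_gt0 // -!INRE -RdivE.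
apply: one_density_le_max => //; rewrite /is_subgraph sJ /=.
by apply/forall_inP => e' e'J; apply: bigcup_sup.
Qed.

Lemma extremal_copy k h (EH E : {set {set 'I_h}}) (V : {set 'I_h}) :
  is_subgraph EH V E -> one_density V E = max_one_density EH -> is_Kk k V E \/ is_Ck k V E ->
  exists (EK : {set {set 'I_k}}) (phi : {ffun 'I_k -> 'I_h}),
    [/\ EK = clique_edges k \/ EK = cycle_edges k, embeds EK EH phi &
        max_one_density EH = #|EK|%:R / k.-1%:R].
Proof.
case/andP=> sE _ <- iso.
have [EK EKE /existsP [phi /and3P[/injectiveP phi_inj /eqP -> /eqP eE]]] :
    exists2 EK, EK = clique_edges k \/ EK = cycle_edges k & iso_to EK V E.
  by case: iso => iso; [exists (clique_edges k)|exists (cycle_edges k)]; auto.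
exists EK, phi; split=> //; first by apply/embedsP; split; rewrite // -[copy_edges _ _]eE.
rewrite /one_density eE -/(copy_edges EK phi) card_copy_edges // card_injective_image //.
by rewrite subn1 !RealsE.
Qed.

Lemma Un_cv_prob_gnp0 (p : nat -> R) (F : forall n, {set {set 'I_n}} -> bool) :
  (forall n, 0 <= p n <= 1) ->
  (forall eps : R, 0 < eps -> exists N, forall n, (N <= n)%N -> Pr (p n) (pairs n) (@F n) < eps) ->
  Un_cv (fun n => prob_gnp (p n) (@F n)) 0%R.
Proof.
move=> p01 small eps /RltP eps_gt0; have [N ltN] := small eps eps_gt0; exists N => n /ssrnat.leP Nn.
by apply/RltP; rewrite prob_gnpE !RealsE subr0 ger0_norm ?Pr_ge0 ?ltN.
Qed.

Lemma Un_cv_prob_gnp1 (p : nat -> R) (F : forall n, {set {set 'I_n}} -> bool) :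
  (forall n, 0 <= p n <= 1) ->
  (forall eps : R, 0 < eps -> exists N, forall n, (N <= n)%N ->
     Pr (p n) (pairs n) (fun G => ~~ F n G) < eps) ->
  Un_cv (fun n => prob_gnp (p n) (@F n)) 1%R.
Proof.
move=> p01 small eps /RltP eps_gt0; have [N ltN] := small eps eps_gt0; exists N => n /ssrnat.leP Nn.
apply/RltP; rewrite prob_gnpE !RealsE -[X in _ - X](Pr_true (p n) (pairs n)).
by rewrite (Pr_split _ _ xpredT (@F n)) opprD addNKr normrN ger0_norm ?Pr_ge0 ?ltN.
Qed.

Lemma embeds_edges_neq0 k h (EK : {set {set 'I_k}}) (EH : {set {set 'I_h}}) phi :
  embeds EK EH phi -> EK != set0 -> EH != set0.
Proof.
move=> /embedsP [_ sub] /set0Pn [e eK]; apply/set0Pn; exists (phi @: e).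
by apply: (subsetP sub); apply: imset_f.
Qed.

Section Limits.
Variables (b h : nat) (EH : {set {set 'I_h}}) (p : nat -> R) (maker_first : bool).
Hypothesis p01 : forall n, 0 <= p n <= 1.
Local Notation m := (max_one_density EH).
Local Notation win_prob :=
  (fun n => prob_gnp (p n) (fun G : {set {set 'I_n}} => makers_win EH G b maker_first)).

Lemma makers_win_cv1 : is_graph EH -> EH != set0 -> (0 < b)%N -> 0 < m ->
  (exists N : nat, forall n, (N <= n)%N -> one_const b EH _ * Rpower (INR n) (- Rinv m) <= p n) ->
  Un_cv win_prob 1%R.
Proof.
move=> gH EH_neq0 b_gt0 m_gt0 [N p_ge]; apply: Un_cv_prob_gnp1 => // eps eps_gt0.
have density_le J := @card_edges_le_density h EH J gH.
have [N' lose] := makers_lose_prob_lt_eps gH EH_neq0 b_gt0 m_gt0 density_le eps_gt0.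
exists (maxn 1 (maxn N N')) => n; rewrite !geq_max => /and3P[n_gt0 Nn N'n].
by apply: lose => //; have := p_ge n Nn; rewrite Rpower_powR.
Qed.

Lemma makers_win_cv0 k (EK : {set {set 'I_k}}) phi : (2 < k)%N ->
  EK = clique_edges k \/ EK = cycle_edges k -> embeds EK EH phi -> (pairing_degree k <= b)%N ->
  m = #|EK|%:R / k.-1%:R ->
  (exists N : nat, forall n, (N <= n)%N -> p n <= zero_const k _ * Rpower (INR n) (- Rinv m)) ->
  Un_cv win_prob 0%R.
Proof.
move=> k_gt2 EKE phiE b_ge densK [N p_le]; apply: Un_cv_prob_gnp0 => // eps eps_gt0.
have [N' win] := makers_win_prob_lt_eps k_gt2 EKE phiE b_ge eps_gt0.
exists (maxn 1 (maxn N N')) => n; rewrite !geq_max => /and3P[n_gt0 Nn N'n].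
by apply: win => //; have := p_le n Nn; rewrite Rpower_powR // densK RinvE invf_div.
Qed.

End Limits.

End RandomGraphs.

Delimit Scope R_scope with R.
Delimit Scope nat_scope with nat.

Theorem theorem1 (k b h : nat) (EH : {set {set 'I_h}}) (maker_first : bool) :
  (0 < k)%nat -> (0 < b)%nat ->
  ((4 <= k)%nat \/ (k = 3 /\ (2 <= b)%nat)) ->
  simple_graph EH ->
  (exists (V : {set 'I_h}) (E : {set {set 'I_h}}),
      is_subgraph EH V E /\ (1 < #|V|)%nat /\ one_density V E = max_one_density EH /\
      (is_Kk k V E \/ is_Ck k V E)) ->
  exists c C : R, (0 < c)%R /\ (0 < C)%R /\
    forall p : nat -> R, (forall n, 0 <= p n <= 1)%R ->
      ((exists N : nat, forall n : nat, (N <= n)%nat ->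
          (p n >= C * Rpower (INR n) (- / max_one_density EH))%R) ->
       Un_cv (fun n => @prob_gnp n (p n) (fun EG : {set {set 'I_n}} => makers_win EH EG b maker_first)) 1%R)
      /\
      ((exists N : nat, forall n : nat, (N <= n)%nat ->
          (p n <= c * Rpower (INR n) (- / max_one_density EH))%R) ->
       Un_cv (fun n => @prob_gnp n (p n) (fun EG : {set {set 'I_n}} => makers_win EH EG b maker_first)) 0%R).
Proof.
move=> _ b_gt0 kb; rewrite /simple_graph -is_graph_pairs => gH [V [E [sub [_ [dens iso]]]]].
have k_gt2 : 2 < k by case: kb => [/ltnW|[-> _]].
have b_ge : pairing_degree k <= b by rewrite /pairing_degree; case: eqP kb => // -> [|[]].
have [EK [phi [EKE phiE densK]]] := extremal_copy sub dens iso.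
have EK_neq0 := balanced_neq0 (ltn_trans (isT : 0 < 2) k_gt2) (clique_or_cycle_balanced k_gt2 EKE).
have m_gt0 : (0 < max_one_density EH)%R.
  rewrite densK; apply/RltP; rewrite Num.Theory.divr_gt0 ?Num.Theory.ltr0n ?card_gt0 //.
  by rewrite -subn1 subn_gt0 ltnW.
exists (zero_const k _), (one_const b EH _); split; first exact/RltP/zero_const_gt0.
split; first exact/RltP/(Order.POrderTheory.lt_le_trans Num.Theory.ltr01 (one_const_ge1 _ _ _)).
move=> p p01; have p01' n := Rle_unit_interval (p01 n).
split=> [[N p_ge]|[N p_le]].
  apply: makers_win_cv1 => //; [exact: embeds_edges_neq0 phiE EK_neq0|exact/RltP|].
  by exists N => n Nn; apply/RleP/Rge_le/p_ge.
apply: (makers_win_cv0 _ _ k_gt2 EKE phiE b_ge densK) => //.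
by exists N => n Nn; apply/RleP/p_le.
Qed.
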